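(* Assume $1\ne u\in\mathbf{F}$ is a non-power and let $w=u^d$ for some $d\in\mathbb{Z}_{\ge1}$. Then, as $N\to\infty$, $$\mathbb{E}_w[\xi_1]=\mathbb{E}_u[\xi_d]=\tau(d)+\frac{|\mathrm{Crit}(u)|}{N^{\pi(u)-1}}+O\left(\frac{1}{N^{\pi(u)}}\right).$$
   Context: $\mathbf{F}$ is the free group on $r\ge1$ generators. A word is a non-power if it is not of the form $v^m$ with $v\in\mathbf{F}$, $m\ge2$. For a permutation $\sigma$, $\xi_k(\sigma)$ is the number of fixed points of $\sigma^k$. For a word $w$, $\mathbb{E}_w[\xi_k]$ is the function of $N$ whose value is the average of $\xi_k(w(\sigma_1,\ldots,\sigma_r))$ over independent uniformly random $\sigma_1,\ldots,\sigma_r\in S_N$. $\tau(d)$ is the number of positive divisors of $d$. An element of a free group is primitive if it belongs to some basis. The primitivity rank $\pi(u)$ is the minimal rank of a subgroup $H\le\mathbf{F}$ containing $u$ as a non-primitive element of $H$, and $\pi(u)=\infty$ if there is no such subgroup. $\mathrm{Crit}(u)$ is the (finite) set of subgroups $H\le\mathbf{F}$ with $\mathrm{rk}\,H=\pi(u)$, $u\in H$ and $u$ non-primitive in $H$. Convention: $N^{-\infty}$ is interpreted as $0$. The implied constant may depend on $u$ and $d$. *)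

(* Defs.v *)
From HB Require Import structures.
From mathcomp Require Import all_boot all_order all_fingroup all_algebra.
From mathcomp Require Import all_classical all_reals all_analysis.

Set Implicit Arguments.
Unset Strict Implicit.
Unset Printing Implicit Defensive.
Import Order.TTheory GRing.Theory Num.Theory.
Import numFieldNormedType.Exports.

Local Open Scope classical_set_scope.
Local Open Scope card_scope.
Local Open Scope group_scope.

(* A letter (t, e) stands for t if e = false and for t^-1 if e = true. *)
Section Words.
Context {T : choiceType}.
Implicit Types (x y : T * bool) (s : seq (T * bool)).

Definition inv_letter x := (x.1, ~~ x.2).

Definition reduced s := sorted (fun x y => y != inv_letter x) s.

Definition eval_word {G : groupType} (f : T -> G) s : G :=
  \prod_(x <- s) (if x.2 then (f x.1)^-1 else f x.1).

Definition cons_letter x s :=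
  if s is y :: s' then if y == inv_letter x then s' else x :: s else [:: x].

Definition mul_word s1 s2 := foldr cons_letter s2 s1.

Definition inv_word s := rev (map inv_letter s).

Lemma inv_letterK : involutive inv_letter.
Proof. by move=> [t e]; rewrite /inv_letter /= negbK. Qed.

Lemma reduced_behead x s : reduced (x :: s) -> reduced s.
Proof. exact: path_sorted. Qed.

Lemma cons_letter_reduced x s : reduced s -> reduced (cons_letter x s).
Proof.
case: s => [|y s] //= red_s; case: (y =P _) => [_|/eqP xy].
  exact: path_sorted red_s.
by rewrite /= xy.
Qed.

Lemma mul_word_reduced s1 s2 : reduced s2 -> reduced (mul_word s1 s2).
Proof. by move=> ?; elim: s1 => //= x s IH; apply: cons_letter_reduced. Qed.

Lemma cons_letter_id x s : reduced (x :: s) -> cons_letter x s = x :: s.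
Proof. by case: s => [|y s] //= /andP[/negPf->]. Qed.

Lemma cons_letterK x s :
  reduced s -> cons_letter x (cons_letter (inv_letter x) s) = s.
Proof.
case: s => [|y s] red_s; first by rewrite /= eqxx.
rewrite [cons_letter (inv_letter x) _]/= inv_letterK; case: (y =P x) => [<-|_].
  by rewrite cons_letter_id.
by rewrite /= eqxx.
Qed.

Lemma mul_word_cons x s1 s2 : reduced s2 ->
  mul_word (cons_letter x s1) s2 = cons_letter x (mul_word s1 s2).
Proof.
move=> red2; case: s1 => [|y s1] //=; case: (y =P _) => [->|//].
by rewrite cons_letterK //; apply: mul_word_reduced.
Qed.

Lemma mul_wordA s1 s2 s3 : reduced s3 ->
  mul_word s1 (mul_word s2 s3) = mul_word (mul_word s1 s2) s3.
Proof.
by move=> red3; elim: s1 => //= x s1 ->; rewrite mul_word_cons.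
Qed.

Lemma mul_word0 s : reduced s -> mul_word s [::] = s.
Proof.
elim: s => //= x s IH red_s.
by rewrite IH ?cons_letter_id //; apply: reduced_behead red_s.
Qed.

Lemma inv_wordK : involutive inv_word.
Proof.
move=> s; rewrite /inv_word map_rev revK -map_comp.
by rewrite (eq_map (g := id)) ?map_id // => x /=; apply: inv_letterK.
Qed.

Lemma inv_word_reduced s : reduced s -> reduced (inv_word s).
Proof.
rewrite /reduced /inv_word rev_sorted sorted_map; apply: sub_sorted => x y /=.
by rewrite inv_letterK eq_sym.
Qed.

Lemma mulVword s : mul_word (inv_word s) s = [::].
Proof.
elim: s => [|x s IH] //.
rewrite /inv_word map_cons rev_cons -cats1 /mul_word foldr_cat /=.
by rewrite inv_letterK eqxx.
Qed.

End Words.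

Record free_group (r : nat) :=
  FreeGroup { fg_word :> seq ('I_r * bool); fg_reduced : reduced fg_word }.

HB.instance Definition _ r := [isSub for @fg_word r].
HB.instance Definition _ r := [Choice of free_group r by <:].

Section FreeGroup.
Variable r : nat.
Implicit Types u v w : free_group r.

Definition fg_one : free_group r := FreeGroup (isT : reduced [::]).
Definition fg_mul u v : free_group r :=
  FreeGroup (mul_word_reduced u (fg_reduced v)).
Definition fg_inv u : free_group r :=
  FreeGroup (inv_word_reduced (fg_reduced u)).
Definition fg_gen (i : 'I_r) : free_group r :=
  FreeGroup (isT : reduced [:: (i, false)]).

Fact fg_mulA : associative fg_mul.
Proof. by move=> u v w; apply: val_inj; apply: mul_wordA; apply: fg_reduced. Qed.
Fact fg_mul1 : left_id fg_one fg_mul.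
Proof. by move=> u; apply: val_inj. Qed.
Fact fg_mulr1 : right_id fg_one fg_mul.
Proof. by move=> u; apply: val_inj; apply: mul_word0; apply: fg_reduced. Qed.
Fact fg_mulV : left_inverse fg_one fg_inv fg_mul.
Proof. by move=> u; apply: val_inj; apply: mulVword. Qed.
Fact fg_mulrV : right_inverse fg_one fg_inv fg_mul.
Proof.
by move=> u; apply: val_inj; rewrite /= -{1}[val u]inv_wordK; apply: mulVword.
Qed.

HB.instance Definition _ := isGroup.Build (free_group r)
  fg_mulA fg_mul1 fg_mulr1 fg_mulV fg_mulrV.

End FreeGroup.

(* Least n with P n; None encodes infinity, when there is no such n. *)
Definition least (P : nat -> Prop) : option nat :=
  if pselect (exists n, `[< P n >]) is left exP then Some (ex_minn exP)
  else None.

Section Subgroups.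
Variable G : groupType.
Implicit Types (H B : set G) (u : G).

Definition non_power u := ~ exists v m, (2 <= m)%N /\ u = v ^+ m.

Definition is_subgroup H :=
  [/\ H 1, forall x y, H x -> H y -> H (x * y) & forall x, H x -> H x^-1].

Definition generated B : set G := smallest is_subgroup B.

Definition is_basis H B :=
  generated B = H /\
  forall s : seq (G * bool), (forall x, x \in s -> B x.1) ->
    reduced s -> s <> [::] -> eval_word id s <> 1.

Definition primitive_in H u := exists2 B, is_basis H B & B u.

(* None when H has no finite basis; for subgroups of a free group this means
   infinite rank, and otherwise all bases of H have the same cardinality. *)
Definition rk H : option nat :=
  least (fun k => exists2 B, is_basis H B & B #= `I_k).

Definition primitivity_rank u : option nat :=
  least (fun k => exists H,
    [/\ is_subgroup H, rk H = Some k, H u & ~ primitive_in H u]).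

Definition Crit u : set (set G) :=
  [set H | [/\ is_subgroup H, rk H = primitivity_rank u,
               H u & ~ primitive_in H u]].

End Subgroups.

Definition fixpoints (k N : nat) (s : 'S_N) : nat :=
  #|[set i : 'I_N | (s ^+ k) i == i]|.

Definition num_divisors (d : nat) : nat := size (divisors d).

Local Open Scope ring_scope.

Definition expected_fixpoints (R : realType) (r : nat) (w : free_group r)
    (k N : nat) : R :=
  (\sum_(s : {ffun 'I_r -> 'S_N}) (fixpoints k (eval_word s w))%:R)
    / #|{ffun 'I_r -> 'S_N}|%:R.

(* N ^ (- e), with the convention N ^ (- infinity) = 0. *)
Definition inv_pow (R : realType) (N : nat) (e : option nat) : R :=
  if e is Some k then N%:R ^- k else 0.

Lemma fg_gen_basis (r : nat) : is_basis [set: free_group r] (range (@fg_gen r)).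
Proof.
have gen_letter (x : 'I_r * bool) (w : free_group r) :
    val ((if x.2 then (fg_gen x.1)^-1 else fg_gen x.1) * w)%g
    = cons_letter x (val w).
  by case: x => i [].
have evalE (s : seq ('I_r * bool)) : reduced s ->
    val (eval_word (@fg_gen r) s) = s.
  elim: s => [|x s IH] red_s; rewrite /eval_word ?big_nil // big_cons.
  rewrite gen_letter IH ?cons_letter_id //; exact: reduced_behead red_s.
split.
  rewrite eqEsubset; split=> // w _ H [[H1 HM HV] Hgen].
  have -> : w = eval_word (@fg_gen r) w.
    by apply: val_inj; rewrite evalE //; apply: fg_reduced.
  rewrite /eval_word; apply: (big_ind H) => // x _.
  have Hx : H (fg_gen x.1) by apply: Hgen; exists x.1.
  by case: x.2 => //; apply: HV.
move=> s sgen red_s s0 s1; apply: s0.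
have [t st] : exists t : seq ('I_r * bool), s = [seq (fg_gen x.1, x.2) | x <- t].
  elim: s sgen {red_s s1} => [|[g e] s IH] sgen; first by exists [::].
  have [|t ->] := IH; first by move=> x xs; apply: sgen; rewrite inE xs orbT.
  have [|i _ /= <-] := sgen (g, e); first by rewrite inE eqxx.
  by exists ((i, e) :: t).
have gen_inj : injective (@fg_gen r) by move=> i j /(congr1 val) [].
have red_t : reduced t.
  move: red_s; rewrite st /reduced sorted_map; apply: sub_sorted => x y /=.
  by apply: contraNneq => ->.
have /(congr1 val) : eval_word (@fg_gen r) t = 1%g.
  by rewrite -s1 st /eval_word big_map.
by rewrite evalE // st => ->.
Qed.

(* Main.v *)
Require Import Defs.
From mathcomp Require Import finmap.
From mathcomp Require Import all_boot all_order all_fingroup all_algebra.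
From mathcomp Require Import all_classical all_reals all_analysis.
From mathcomp Require Import zify ring lra.
Import numFieldNormedType.Exports.
Local Open Scope classical_set_scope.
Local Open Scope ring_scope.

Set Implicit Arguments.
Unset Strict Implicit.
Unset Printing Implicit Defensive.
Import Order.TTheory GRing.Theory Num.Theory.

(* A fixed point of w = u^d under random permutations is a closed lift of the
   walk spelled by w, and the coincidences along the lift form a folded quotient
   K of the cycle reading w.  The expected number of lifts with pattern K is a
   ratio of products N (N-1) ..., of order N^(1 - rk H_K), where H_K is the
   subgroup of the free group carried by K.  Working over random covers of an
   arbitrary quotient J, the 1/N-expansions of these ratios are Moebius inverted
   over the quotients D below J; the contribution R_D starts at N^(1 - rk H_D),
   because each further power of 1/N pays for one more generator.
   Let u^k be the first power of u in H_D.  If it is primitive there, then w is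
   distributed over random covers of D like sigma^(d/k) for a uniform
   permutation sigma, whose expected number of fixed points is tau(d/k); by
   inversion, all these quotients together contribute exactly the cyclic ones
   <u^e> with e | d, i.e. tau(d).  If it is not primitive, then rk H_D >= pi(u),
   with equality only for H_D in Crit(u): for k >= 2, adjoining u to H_D lowers
   the rank and leaves u imprimitive.  Each critical subgroup contributes
   N^(1 - pi(u)), since lower order terms cancel by the Hopf property. *)

(** * Words, generated subgroups and bases *)

Section Words.
Local Open Scope group_scope.

(** The count for the free group itself gives one equation for many unknown contributions. Letting J
    vary gives a system triangular for inclusion, because R_D does not depend on J: the weight of a
    pattern K involves J only through indicators that J identifies two positions a, b. Each
    indicator carries a factor 1/N and, as a function of J, is the sum over D below J of a point
    mass at K with a glued to b, which costs one generator. Products of indicators turn into joins.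
    Where a power of u is primitive the left hand sides are known exactly, and the system is solved
    by induction on D.

    For the other D, a term K of R_D of critical order would complete a basis of H_K to a generating
    set of H_D of minimal size, hence to a basis; a primitive power in H_K would remain primitive in
    H_D, so K has none, and then its rank leaves only K = D.

    The obstacle is a subgroup where a power u^k, k at least 2, is imprimitive while u is absent: it
    says nothing directly about pi(u). The required drop of rank becomes an inequality between
    dimensions of spaces of functions on a cycle; its pivots are compared through an order on cyclic
    conjugates of u that survives conjugation by generators, whence the bi-invariant order. *)

Definition letter_value (T : choiceType) (G : groupType) (f : T -> G)
    (x : T * bool) : G := if x.2 then (f x.1)^-1 else f x.1.

Section Eval.
Variables (T : choiceType) (G : groupType) (f : T -> G).
Implicit Types (x y : T * bool) (s : seq (T * bool)).

Lemma letter_valueV x : letter_value f (inv_letter x) = (letter_value f x)^-1.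
Proof. by case: x => t []; rewrite /letter_value /= ?invgK. Qed.

Lemma eval_nil : eval_word f [::] = 1.
Proof. by rewrite /eval_word big_nil. Qed.

Lemma eval_cons x s : eval_word f (x :: s) = letter_value f x * eval_word f s.
Proof. by rewrite /eval_word big_cons. Qed.

Lemma eval_cat s1 s2 : eval_word f (s1 ++ s2) = eval_word f s1 * eval_word f s2.
Proof. by rewrite /eval_word big_cat. Qed.

Lemma eval_rcons s x : eval_word f (rcons s x) = eval_word f s * letter_value f x.
Proof. by rewrite -cats1 eval_cat eval_cons eval_nil mulg1. Qed.

Lemma eval_cons_letter x s :
  eval_word f (cons_letter x s) = letter_value f x * eval_word f s.
Proof.
case: s => [|y s]; first by rewrite /= eval_cons.
rewrite /=; case: eqP => [->|_]; last by rewrite eval_cons.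
by rewrite eval_cons letter_valueV mulVKg.
Qed.

Lemma eval_mul s1 s2 :
  eval_word f (mul_word s1 s2) = eval_word f s1 * eval_word f s2.
Proof.
elim: s1 => [|x s1 IH] /=; first by rewrite eval_nil mul1g.
by rewrite eval_cons_letter IH eval_cons mulgA.
Qed.

Lemma eval_inv s : eval_word f (inv_word s) = (eval_word f s)^-1.
Proof.
elim: s => [|x s IH]; first by rewrite /= eval_nil invg1.
rewrite /inv_word /= rev_cons eval_rcons.
by rewrite -[rev _]/(inv_word s) IH letter_valueV eval_cons invgM.
Qed.

End Eval.

(** Homomorphisms are total functions multiplicative only on a subgroup, so membership of the
    partial products in [P] has to travel along with the identity. *)
Lemma eval_morph (T : choiceType) (G H : groupType) (f : T -> G) (r : G -> H) (P : set G) s :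
    P 1 -> (forall x, x \in s -> P (f x.1)) ->
    (forall a b, P a -> P b -> P (a * b)) -> (forall a, P a -> P a^-1) ->
    (forall a b, P a -> P b -> r (a * b) = r a * r b) ->
  P (eval_word f s) /\ r (eval_word f s) = eval_word (r \o f) s.
Proof.
move=> P1 Ps PM PV rM.
have r1 : r 1 = 1 by apply: (@mulgI _ (r 1)); rewrite -rM // !mulg1.
have rV a : P a -> r a^-1 = (r a)^-1.
  by move=> Pa; apply: (@mulgI _ (r a)); rewrite -rM ?mulgV ?r1 ?mulgV //; apply: PV.
elim: s Ps => [|[g e] s IH] Ps; first by rewrite !eval_nil r1.
have Pg : P (f g) by apply: (Ps (g, e)); rewrite mem_head.
have [|Ps1 Ps2] := IH; first by move=> y ys; apply: Ps; rewrite inE ys orbT.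
have Px : P (letter_value f (g, e)) by rewrite /letter_value /=; case: (e) => //; apply: PV.
rewrite !eval_cons; split; first exact: PM.
rewrite rM // Ps2; congr (_ * _); rewrite /letter_value /=.
by case: (e) => //; apply: rV.
Qed.

Lemma eval_eq (T : choiceType) (G : groupType) (f g : T -> G) s :
  (forall x, x \in s -> f x.1 = g x.1) -> eval_word f s = eval_word g s.
Proof.
rewrite /eval_word => fg; apply: eq_big_seq => x xs.
by rewrite fg.
Qed.

Lemma mem_cons_letter (T : choiceType) (x y : T * bool) s :
  y \in cons_letter x s -> (y == x) || (y \in s).
Proof.
case: s => [|z s] /=; first by rewrite inE => ->.
by case: eqP => _; rewrite !inE // => ->; rewrite !orbT.
Qed.

Lemma mem_mul_word (T : choiceType) (y : T * bool) s1 s2 :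
  y \in mul_word s1 s2 -> (y \in s1) || (y \in s2).
Proof.
elim: s1 => //= x s1 IH /mem_cons_letter /orP[/eqP->|/IH]; first by rewrite mem_head.
by rewrite inE => /orP[->|->]; rewrite ?orbT.
Qed.

Lemma mem_inv_word (T : choiceType) (y : T * bool) s :
  y \in inv_word s -> inv_letter y \in s.
Proof. by rewrite /inv_word mem_rev => /mapP[x xs ->]; rewrite inv_letterK. Qed.

Section Subgroup.
Variables (G : groupType) (H : set G).
Hypothesis sH : is_subgroup H.

Lemma sgp1 : H 1. Proof. by case: sH. Qed.
Lemma sgpM x y : H x -> H y -> H (x * y). Proof. by case: sH => _ h _; apply: h. Qed.
Lemma sgpV x : H x -> H x^-1. Proof. by case: sH => _ _; apply. Qed.
Lemma sgpVE x : H x^-1 <-> H x.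
Proof. by split=> [/sgpV|/sgpV //]; rewrite invgK. Qed.
Lemma sgpMl x y : H x -> (H (x * y) <-> H y).
Proof.
by move=> Hx; split=> [Hxy|]; [rewrite -(mulKg x y); apply: sgpM => //; apply: sgpV|apply: sgpM].
Qed.
Lemma sgpX x n : H x -> H (x ^+ n).
Proof.
by move=> Hx; elim: n => [|n IH]; [rewrite expg0; apply: sgp1|rewrite expgS; apply: sgpM].
Qed.
End Subgroup.

Section Generated.
Variable G : groupType.
Implicit Types (B C H : set G).

Lemma sub_gen B : B `<=` Defs.generated B.
Proof. exact: sub_gen_smallest. Qed.

Lemma gen_sub B H : is_subgroup H -> B `<=` H -> Defs.generated B `<=` H.
Proof. by move=> sH BH x; apply. Qed.

Lemma gen_subgroup B : is_subgroup (Defs.generated B).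
Proof.
split=> [H [[]] //|x y Bx By H HB|x Bx H HB]; have [sH _] := HB.
- by apply: sgpM => //; [apply: Bx|apply: By].
- by apply: sgpV => //; apply: Bx.
Qed.

Lemma gen_mono B C : B `<=` Defs.generated C -> Defs.generated B `<=` Defs.generated C.
Proof. by move=> BC; apply: gen_sub => //; apply: gen_subgroup. Qed.

Lemma gen_id H : is_subgroup H -> Defs.generated H = H.
Proof. by move=> sH; rewrite eqEsubset; split; [apply: gen_sub|apply: sub_gen]. Qed.

Lemma gen_word B h : Defs.generated B h ->
  exists s : seq (G * bool), [/\ reduced s, forall x, x \in s -> B x.1 & eval_word id s = h].
Proof.
move: h; apply: gen_sub.
  split.
  - by exists [::]; rewrite eval_nil.
  - move=> x y [s [rs sB <-]] [t [rt tB <-]]; exists (mul_word s t); split.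
    + exact: mul_word_reduced.
    + by move=> z /mem_mul_word /orP[/sB|/tB].
    + exact: eval_mul.
  - move=> x [s [rs sB <-]]; exists (inv_word s); split.
    + exact: inv_word_reduced.
    + by move=> z /mem_inv_word /sB.
    + exact: eval_inv.
move=> b Bb; exists [:: (b, false)]; split=> //.
- by move=> x; rewrite inE => /eqP->.
- by rewrite eval_cons eval_nil mulg1.
Qed.

Lemma gen_eval B (s : seq (G * bool)) :
  (forall x, x \in s -> B x.1) -> Defs.generated B (eval_word id s).
Proof.
have sB := gen_subgroup B => Bs.
have [||||//] := @eval_morph _ G G id id (Defs.generated B) s (sgp1 sB).
- by move=> x xs; apply: sub_gen; apply: Bs.
- by move=> a b; apply: (sgpM sB).
- by move=> a; apply: (sgpV sB).
- by [].
Qed.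

(** The reduced form of the quotient of the two words evaluates to 1, so freeness makes it empty. *)
Lemma reduced_eval_inj B (s t : seq (G * bool)) :
    (forall s : seq (G * bool), (forall x, x \in s -> B x.1) ->
      reduced s -> s <> [::] -> eval_word id s <> 1) ->
    (forall x, x \in s -> B x.1) -> (forall x, x \in t -> B x.1) ->
    reduced s -> reduced t -> eval_word id s = eval_word id t -> s = t.
Proof.
move=> free sB tB rs rt st.
have : mul_word (inv_word s) t = [::].
  apply: contrapT => h; apply: (free _ _ _ h).
  - by move=> x /mem_mul_word /orP[/mem_inv_word /sB|/tB].
  - exact: mul_word_reduced.
  - by rewrite eval_mul eval_inv st mulVg.
move/(congr1 (mul_word s)); rewrite mul_word0 // mul_wordA //.
by rewrite -{1}(inv_wordK s) mulVword /= => ->.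
Qed.

(** A total function on [G] avoids a separate type for each subgroup; its values outside [H] are
    arbitrary. *)
Definition morph_on (G' : groupType) H (r : G -> G') :=
  forall x y, H x -> H y -> r (x * y) = r x * r y.

Lemma morph_on1 (G' : groupType) H (r : G -> G') :
  is_subgroup H -> morph_on H r -> r 1 = 1.
Proof.
by move=> sH rM; apply: (@mulgI _ (r 1)); rewrite -rM ?mulg1 //; apply: sgp1.
Qed.

Lemma morph_onV (G' : groupType) H (r : G -> G') x :
  is_subgroup H -> morph_on H r -> H x -> r x^-1 = (r x)^-1.
Proof.
move=> sH rM Hx; apply: (@mulgI _ (r x)); rewrite -rM //; last exact: sgpV.
by rewrite !mulgV (morph_on1 sH).
Qed.

Lemma morph_onX (G' : groupType) H (r : G -> G') x n :
  is_subgroup H -> morph_on H r -> H x -> r (x ^+ n) = r x ^+ n.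
Proof.
move=> sH rM Hx; elim: n => [|n IH]; first by rewrite !expg0 (morph_on1 sH).
by rewrite !expgS rM ?IH //; apply: sgpX.
Qed.

Lemma morph_on_gen_eq (G' : groupType) B (r1 r2 : G -> G') :
  morph_on (Defs.generated B) r1 -> morph_on (Defs.generated B) r2 ->
  {in B, r1 =1 r2} -> {in Defs.generated B, r1 =1 r2}.
Proof.
move=> m1 m2 eqB x /set_mem Bx.
have sB := gen_subgroup B.
suff [] : [set x | Defs.generated B x /\ r1 x = r2 x] x by [].
move: x Bx; apply: gen_sub => [|b Bb]; last first.
  by split; [apply: sub_gen|apply: eqB; apply/mem_set].
split=> /=.
- by split; [apply: (sgp1 sB)|rewrite (morph_on1 sB m1) (morph_on1 sB m2)].
- move=> x y [Bx ex] [By ey]; split; first by apply: (sgpM sB).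
  by rewrite m1 // m2 // ex ey.
- move=> x [Bx ex]; split; first by apply: (sgpV sB).
  by rewrite (morph_onV sB m1) // (morph_onV sB m2) // ex.
Qed.

(** By freeness each element of [H] has exactly one reduced word over [B]; [r] evaluates that word
    at [f], and uniqueness makes it multiplicative. *)
Lemma basis_ext (G' : groupType) H B (f : G -> G') : is_basis H B ->
  exists2 r : G -> G', morph_on H r & {in B, r =1 f}.
Proof.
move=> [<- free].
pose P h s := [/\ reduced s, forall x, x \in s -> B x.1 & eval_word id s = h].
pose r h := eval_word f (xget [::] (P h)).
have rP h : Defs.generated B h -> P h (xget [::] (P h)).
  by move=> /gen_word [s Ps]; apply: xgetPex; exists s.
have rE s : reduced s -> (forall x, x \in s -> B x.1) -> r (eval_word id s) = eval_word f s.
  move=> rs sB; rewrite /r; congr (eval_word f _).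
  have [|rx xB ex] := rP (eval_word id s).
    exact: gen_eval.
  by apply: (reduced_eval_inj free).
exists r => [x y Bx By|b /set_mem Bb].
  have [rs sB <-] := rP x Bx; have [rt tB <-] := rP y By.
  rewrite -eval_mul !rE //; first exact: eval_mul.
  - exact: mul_word_reduced.
  - by move=> z /mem_mul_word /orP[/sB|/tB].
have eb : eval_word id [:: (b, false)] = b by rewrite eval_cons eval_nil mulg1.
rewrite -{1}eb.
rewrite rE //; last by move=> x; rewrite inE => /eqP->.
rewrite eval_cons eval_nil mulg1 //.
Qed.

End Generated.

Section FreeGroupEval.
Variable r : nat.
Implicit Types w : free_group r.

Lemma val_letter_mul x w : val (letter_value (@fg_gen r) x * w) = cons_letter x (val w).
Proof. by case: x => i []. Qed.

Lemma val_eval (s : seq ('I_r * bool)) : reduced s -> val (eval_word (@fg_gen r) s) = s.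
Proof.
elim: s => [|x s IH] red_s; first by rewrite eval_nil.
by rewrite eval_cons val_letter_mul IH ?cons_letter_id //; apply: reduced_behead red_s.
Qed.

Lemma eval_val w : eval_word (@fg_gen r) (val w) = w.
Proof. by apply: val_inj; rewrite val_eval //; apply: fg_reduced. Qed.

Lemma eval_homM (G : groupType) (f : 'I_r -> G) w1 w2 :
  eval_word f (w1 * w2) = eval_word f w1 * eval_word f w2.
Proof. exact: eval_mul. Qed.

Lemma eval_homX (G : groupType) (f : 'I_r -> G) w n :
  eval_word f (w ^+ n) = eval_word f w ^+ n.
Proof.
elim: n => [|n IH]; first by rewrite !expg0 eval_nil.
by rewrite !expgS eval_homM IH.
Qed.

Lemma eval_hom_word (G : groupType) (f : 'I_r -> G) (s : seq ('I_r * bool)) :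
  eval_word f (eval_word (@fg_gen r) s) = eval_word f s.
Proof.
elim: s => [|x s IH]; first by rewrite !eval_nil.
by rewrite !eval_cons eval_homM IH; congr (_ * _); case: x => i [];
   rewrite /letter_value /= !eval_cons eval_nil mulg1.
Qed.

End FreeGroupEval.

(* A reduced word over [B] is detected in the free group on its letters. *)
Lemma basis_crit (G : groupType) (H B : set G) : Defs.generated B = H ->
  (forall n (f : G -> free_group n), exists2 r, morph_on H r & {in B, r =1 f}) ->
  is_basis H B.
Proof.
move=> gB univ; split=> // s sB rs s0 s1.
pose l := undup (map fst s).
have idx (x : G * bool) : x \in s -> (index x.1 l < size l)%N.
  by move=> xs; rewrite index_mem mem_undup map_f.
case: (posnP (size l)) => [l0|l_gt0].
  by case: (s) s0 idx => // x s' _ /(_ x (mem_head _ _)); rewrite l0.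
pose c (g : G) : 'I_(size l) :=
  if insub (index g l) is Some i then i else Ordinal l_gt0.
have [r rM rB] := univ _ (fun g => fg_gen (c g)).
have sH : is_subgroup H by rewrite -gB; apply: gen_subgroup.
have [||||_] := @eval_morph _ G _ id r H s (sgp1 sH).
- by move=> x /sB Bx; rewrite -gB; apply: sub_gen.
- by move=> a b; apply: sgpM.
- by move=> a; apply: sgpV.
- by [].
rewrite s1 (morph_on1 sH rM) => /esym.
rewrite (@eval_eq _ _ _ (fun g => fg_gen (c g))) => [|x /sB Bx]; last first.
  by rewrite /= rB //; apply/mem_set.
have -> : eval_word (fun g => fg_gen (c g)) s
        = eval_word (@fg_gen _) (map (fun x => (c x.1, x.2)) s).
  by rewrite /eval_word big_map.
move/(congr1 val); rewrite val_eval; first by case: (s) s0.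
have cval x : x \in s -> c x.1 = index x.1 l :> nat.
  by move=> xs; rewrite /c insubT ?idx.
rewrite /reduced sorted_map; apply: (sub_in_sorted (P := [in s])) rs; last exact/allP.
move=> x y xs ys /=; apply: contraNneq => -[exy ey2].
have /(congr1 (nth x.1 l)) : index y.1 l = index x.1 l.
  by rewrite -!cval // exy.
rewrite !nth_index ?mem_undup ?map_f // => eq1.
by rewrite /inv_letter -eq1 -ey2 -surjective_pairing.
Qed.

(** Freeness of the image is checked through [basis_crit]: a map on the image basis is pulled back
    to [B], extended there, and composed with the inverse of [f]. *)
Lemma basis_transport (G G' : groupType) (f : G -> G') (H B : set G) :
    is_subgroup H -> morph_on H f -> {in H &, injective f} ->
  is_basis H B -> is_basis (f @` H) (f @` B).
Proof.
move=> sH fM finj bB; have [gB free] := bB.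
have sfH : is_subgroup (f @` H).
  split.
  - by exists 1; [apply: sgp1|apply: morph_on1 fM].
  - by move=> _ _ [x Hx <-] [y Hy <-]; exists (x * y); rewrite ?fM //; apply: sgpM.
  - by move=> _ [x Hx <-]; exists x^-1; [apply: sgpV|apply: morph_onV fM _].
pose g y := xget 1 [set x | H x /\ f x = y].
have gK x : H x -> g (f x) = x.
  move=> Hx; rewrite /g; case: xgetP => [y _ [Hy fy]|/(_ x)]; last by case.
  by apply: finj fy; apply/mem_set.
apply: basis_crit.
  rewrite eqEsubset; split.
    by apply: gen_sub => // _ [b Bb <-]; exists b => //; rewrite -gB; apply: sub_gen.
  move=> _ [x Hx <-]; move: (Hx); rewrite -gB => gx.
  suff [] : [set x | H x /\ Defs.generated (f @` B) (f x)] x by [].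
  move: x gx {Hx}; apply: gen_sub => [|b Bb]; last first.
    by split; [rewrite -gB; apply: sub_gen|apply: sub_gen; exists b].
  have sg := gen_subgroup (f @` B).
  split=> [|x y [Hx gx] [Hy gy]|x [Hx gx]] /=.
  - by rewrite (morph_on1 sH fM); split; [apply: (sgp1 sH)|apply: (sgp1 sg)].
  - by rewrite fM //; split; [apply: (sgpM sH)|apply: (sgpM sg)].
  - by rewrite (morph_onV sH fM) //; split; [apply: (sgpV sH)|apply: (sgpV sg)].
move=> n c; have [r rM rB] := basis_ext (c \o f) bB.
exists (r \o g) => [_ _ [x Hx <-] [y Hy <-]|_ /set_mem [b Bb <-]] /=.
  by rewrite -fM // !gK ?rM //; apply: sgpM.
rewrite gK; last by rewrite -gB; apply: sub_gen.
by rewrite rB //; apply/mem_set.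
Qed.

End Words.

(** * Walks in Schreier graphs *)

Section Cocycle.
Local Open Scope group_scope.
Variables (r : nat) (G' : groupType) (t : free_group r -> 'I_r -> G').
Let F := free_group r.
Implicit Types (g h w : F) (x : 'I_r * bool) (s : seq ('I_r * bool)).
Let lv x : F := letter_value (@fg_gen r) x.

(** [t g i] is a value on the edge of the Cayley graph that leaves [g] along generator [i]. An
    inverse letter crosses backwards the edge starting at its endpoint, whence the shifted argument
    and the inverse. *)
Definition coc_letter g x : G' :=
  if x.2 then (t (g * (fg_gen x.1)^-1) x.1)^-1 else t g x.1.

Fixpoint coc_word g s : G' :=
  if s is x :: s' then coc_letter g x * coc_word (g * letter_value (@fg_gen r) x) s' else 1.

Definition cocycle g w := coc_word g (val w).

Lemma coc_letterV g x : coc_letter g x * coc_letter (g * lv x) (inv_letter x) = 1.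
Proof.
by case: x => i []; rewrite /coc_letter /lv /letter_value /= ?mulgK ?mulgV ?mulVg.
Qed.

Lemma coc_cons_letter g x s :
  coc_word g (cons_letter x s) = coc_letter g x * coc_word (g * lv x) s.
Proof.
case: s => [|y s] //=; case: eqP => [->|//].
by rewrite mulgA coc_letterV mul1g letter_valueV mulgK.
Qed.

Lemma cocycle1 g : cocycle g 1 = 1. Proof. by []. Qed.

Lemma cocycleM g v w : cocycle g (v * w) = cocycle g v * cocycle (g * v) w.
Proof.
rewrite /cocycle -{3}(eval_val v) /=.
elim: (fg_word v) g => [|x s IH] g; first by rewrite /= eval_nil mulg1 mul1g.
by rewrite /= coc_cons_letter IH mulgA eval_cons mulgA.
Qed.

Lemma cocycle_gen g i : cocycle g (fg_gen i) = t g i.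
Proof. by rewrite /cocycle /= mulg1. Qed.

Lemma cocycle_inv g h w : (forall g i, t (h * g) i = t g i) ->
  cocycle (h * g) w = cocycle g w.
Proof.
move=> th; rewrite /cocycle; elim: (val w) g => //= x s IH g.
rewrite -mulgA IH; congr (_ * _).
by rewrite /coc_letter -mulgA !th.
Qed.

End Cocycle.

Section Walk.
Local Open Scope group_scope.
Variables (r : nat) (x0 : 'I_r * bool).
Let F := free_group r.
Implicit Types (g h w : F) (x : 'I_r * bool) (s : seq ('I_r * bool)).

Definition pfx s i : F := eval_word (@fg_gen r) (take i s).
Definition lab s i := (nth x0 s i).1.
(** Step [i] joins positions i and i + 1. An inverse letter runs against its edge, so [src] and
    [tgt] are the ends of the edge oriented along the generator. *)
Definition src s i := if (nth x0 s i).2 then i.+1 else i.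
Definition tgt s i := if (nth x0 s i).2 then i else i.+1.

Lemma pfx0 s : pfx s 0 = 1. Proof. by rewrite /pfx take0 eval_nil. Qed.

Lemma pfxS s i : (i < size s)%N ->
  pfx s i.+1 = pfx s i * letter_value (@fg_gen r) (nth x0 s i).
Proof. by move=> ilt; rewrite /pfx (take_nth x0) // eval_rcons. Qed.

Lemma pfx_edge s i : (i < size s)%N ->
  pfx s (tgt s i) = pfx s (src s i) * fg_gen (lab s i).
Proof.
move=> ilt; rewrite /tgt /src /lab.
by case: ifP => e; rewrite pfxS // /letter_value e ?mulgVK.
Qed.

Lemma src_le s i : (i < size s)%N -> (src s i <= size s)%N.
Proof. by rewrite /src; case: ifP => // _ /ltnW. Qed.
Lemma tgt_le s i : (i < size s)%N -> (tgt s i <= size s)%N.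
Proof. by rewrite /tgt; case: ifP => // _ /ltnW. Qed.

Lemma pfx_cat s1 s2 i : (i <= size s1)%N -> pfx (s1 ++ s2) i = pfx s1 i.
Proof. by move=> ile; rewrite /pfx takel_cat. Qed.

Lemma pfx_catr s1 s2 i :
  pfx (s1 ++ s2) (size s1 + i) = eval_word (@fg_gen r) s1 * pfx s2 i.
Proof. by rewrite /pfx takeD take_size_cat // drop_size_cat // eval_cat. Qed.

Lemma lab_cat s1 s2 i : (i < size s1)%N -> lab (s1 ++ s2) i = lab s1 i.
Proof. by move=> ilt; rewrite /lab nth_cat ilt. Qed.
Lemma src_cat s1 s2 i : (i < size s1)%N -> src (s1 ++ s2) i = src s1 i.
Proof. by move=> ilt; rewrite /src nth_cat ilt. Qed.
Lemma tgt_cat s1 s2 i : (i < size s1)%N -> tgt (s1 ++ s2) i = tgt s1 i.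
Proof. by move=> ilt; rewrite /tgt nth_cat ilt. Qed.

Section InSubgroup.
Variables (H : set F).
Hypothesis sH : is_subgroup H.

(** Positions are identified when the walk, projected to the Schreier graph of right cosets of [H],
    is at the same vertex; steps are identified when they cross the same edge, in either
    direction. *)
Definition pos_rel s i j := `[< H (pfx s i * (pfx s j)^-1) >].
Definition edge_rel s i j := (lab s i == lab s j) && pos_rel s (src s i) (src s j).

Lemma pos_refl s i : pos_rel s i i.
Proof. by apply/asboolP; rewrite mulgV; apply: sgp1. Qed.
Lemma pos_sym s i j : pos_rel s i j = pos_rel s j i.
Proof.
by apply/asboolP/asboolP => h; apply/(sgpVE sH); rewrite invgM invgK.
Qed.
Lemma pos_trans s i j k : pos_rel s i j -> pos_rel s j k -> pos_rel s i k.
Proof.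
move=> /asboolP h1 /asboolP h2; apply/asboolP.
by rewrite -(mulgVK (pfx s j) (pfx s i)) -mulgA; apply: sgpM.
Qed.

Lemma edge_tgt s i j : (i < size s)%N -> (j < size s)%N -> lab s i = lab s j ->
  pos_rel s (tgt s i) (tgt s j) = pos_rel s (src s i) (src s j).
Proof.
by move=> ilt jlt eij; rewrite /pos_rel !pfx_edge // eij invgM mulgA mulgK.
Qed.

Lemma edge_sym s i j : edge_rel s i j = edge_rel s j i.
Proof. by rewrite /edge_rel eq_sym pos_sym. Qed.
Lemma pos_cat s1 s2 i j : (i <= size s1)%N -> (j <= size s1)%N ->
  pos_rel (s1 ++ s2) i j = pos_rel s1 i j.
Proof. by move=> ile jle; rewrite /pos_rel !pfx_cat. Qed.

Lemma edge_cat s1 s2 i j : (i < size s1)%N -> (j < size s1)%N ->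
  edge_rel (s1 ++ s2) i j = edge_rel s1 i j.
Proof.
by move=> ile jle; rewrite /edge_rel !lab_cat // !src_cat // pos_cat ?src_le.
Qed.

(* [E] is a potential on the walk [s], seen in the Schreier graph of [H]; its
   increments may depend only on the edge being traversed. *)
Lemma walk_realize (G' : groupType) s (E : nat -> G') : E 0%N = 1 ->
    (forall i j, (i < size s)%N -> (j < size s)%N -> edge_rel s i j ->
      (E (src s i))^-1 * E (tgt s i) = (E (src s j))^-1 * E (tgt s j)) ->
  exists2 p : F -> G', forall h g, H h -> p (h * g) = p h * p g &
    forall i, (i <= size s)%N -> p (pfx s i) = E i.
Proof.
move=> E0 Ewd.
pose P g i := [set k | [/\ (k < size s)%N, lab s k = i & H (g * (pfx s (src s k))^-1)]].
(* Any step crossing the edge of label [i] at the coset of [g] yields the increment; [size s] is out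
   of range and marks an edge never crossed. *)
pose t g i := let k := xget (size s) (P g i) in
  if (k < size s)%N then (E (src s k))^-1 * E (tgt s k) else 1.
have tH h g i : H h -> t (h * g) i = t g i.
  move=> Hh; rewrite /t; suff -> : P (h * g) i = P g i by [].
  by rewrite eqEsubset; split=> k [k1 k2 k3]; split=> //; move: k3;
     rewrite -mulgA => /(sgpMl sH _ Hh).
have tE i : (i < size s)%N ->
    t (pfx s (src s i)) (lab s i) = (E (src s i))^-1 * E (tgt s i).
  move=> ilt; rewrite /t.
  have [] : P (pfx s (src s i)) (lab s i) (xget (size s) (P (pfx s (src s i)) (lab s i))).
    by apply: xgetPex; exists i; split=> //; rewrite mulgV; apply: sgp1.
  move: (xget _ _) => k klt kl kH; rewrite klt; apply: Ewd => //.
  by rewrite edge_sym /edge_rel kl eqxx; apply/asboolP.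
(* Invariance of [t] under [H] makes this potential multiplicative for left factors in [H]. *)
exists (cocycle t 1) => [h g Hh|].
  by rewrite cocycleM mul1g -{2}(mulg1 h) cocycle_inv // => g' i; apply: tH.
elim=> [|i IH] ile; first by rewrite pfx0 cocycle1.
have {IH} IH := IH (ltnW ile); have te := tE i ile; move: te.
rewrite pfxS // cocycleM mul1g IH /src /tgt /lab /letter_value.
case: ifP => ei te.
  rewrite pfxS // /letter_value ei in te.
  have := cocycleM t (pfx s i * (fg_gen (nth x0 s i).1)^-1) (fg_gen (nth x0 s i).1)
            (fg_gen (nth x0 s i).1)^-1.
  rewrite mulgV cocycle1 cocycle_gen mulgVK te => /esym h.
  by apply: (@mulgI _ (E i.+1)^-1); rewrite mulgA h mulVg.
by rewrite cocycle_gen te mulVKg.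
Qed.

(** These elements generate the fundamental group, based at the trivial coset, of the part of the
    Schreier graph of [H] visited by [s]. *)
Definition walk_gens s :=
  [set g | exists i j, [/\ (i <= size s)%N, (j <= size s)%N,
     g = pfx s i * (pfx s j)^-1 & H g]].
Definition walk_group s := Defs.generated (walk_gens s).

Lemma walk_group_subgroup s : is_subgroup (walk_group s).
Proof. exact: gen_subgroup. Qed.

Lemma walk_group_sub s : walk_group s `<=` H.
Proof. by apply: gen_sub => // g [i [j []]]. Qed.

Lemma walk_group_mem s i j : (i <= size s)%N -> (j <= size s)%N ->
  pos_rel s i j -> walk_group s (pfx s i * (pfx s j)^-1).
Proof. by move=> ile jle /asboolP h; apply: sub_gen; exists i, j. Qed.

Lemma walk_group_cat s1 s2 : walk_group s1 `<=` walk_group (s1 ++ s2).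
Proof.
apply: gen_sub; first exact: gen_subgroup.
move=> g [i [j [ile jle -> h]]]; apply: sub_gen; exists i, j.
by rewrite !pfx_cat // size_cat !(leq_trans _ (leq_addr _ _)).
Qed.

(** Vertices and edges of the visited graph are counted at their first visit, so that appending a
    letter changes each count by at most one. *)
Definition vnew s i := all (fun j => ~~ pos_rel s i j) (iota 0 i).
Definition enew s i := all (fun j => ~~ edge_rel s i j) (iota 0 i).
Definition nvert s := count (vnew s) (iota 0 (size s).+1).
Definition nedge s := count (enew s) (iota 0 (size s)).

Definition coset_rep s i := find (fun j => pos_rel s j i) (iota 0 (size s).+1).

Lemma coset_repP s i : (i <= size s)%N ->
  [/\ (coset_rep s i <= i)%N & pos_rel s (coset_rep s i) i].
Proof.
move=> ile; have hasP : has (fun j => pos_rel s j i) (iota 0 (size s).+1).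
  by apply/hasP; exists i; rewrite ?mem_iota ?pos_refl.
have := nth_find 0%N hasP; rewrite nth_iota; last by move: hasP; rewrite has_find size_iota.
split=> //; rewrite leqNgt; apply/negP => lt.
have := before_find 0%N lt; rewrite nth_iota ?ltnS //.
by rewrite add0n pos_refl.
Qed.

Lemma coset_rep_eq s i j : pos_rel s i j -> coset_rep s i = coset_rep s j.
Proof.
move=> pij; apply: eq_find => k; apply/idP/idP => h.
  exact: pos_trans h pij.
by apply: pos_trans h _; rewrite pos_sym.
Qed.

Section Extend.
Variables (G' : groupType) (s : seq ('I_r * bool)) (p0 : F -> G').
Hypothesis p0M : morph_on (walk_group s) p0.
Let e i := pfx s i * (pfx s (coset_rep s i))^-1.

Let eW i : (i <= size s)%N -> walk_group s (e i).
Proof.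
move=> ile; have [le rel] := coset_repP ile; apply: walk_group_mem => //.
  exact: leq_trans ile.
by rewrite pos_sym.
Qed.

Let eWE i j : (i < size s)%N -> (j < size s)%N -> edge_rel s i j ->
  (p0 (e (src s i)))^-1 * p0 (e (tgt s i)) = (p0 (e (src s j)))^-1 * p0 (e (tgt s j)).
Proof.
have sW := walk_group_subgroup s.
move=> ilt jlt eij; have [/eqP lij pij] := andP eij.
have pij' : pos_rel s (tgt s i) (tgt s j) by rewrite edge_tgt.
have E k : (k < size s)%N -> (p0 (e (src s k)))^-1 * p0 (e (tgt s k)) =
    p0 (pfx s (coset_rep s (src s k)) * fg_gen (lab s k) * (pfx s (coset_rep s (tgt s k)))^-1).
  move=> klt; have We := eW (src_le klt); have Wt := eW (tgt_le klt).
  rewrite -(morph_onV sW p0M We) -(p0M (sgpV sW We) Wt).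
  congr p0; rewrite /e pfx_edge // invgM invgK !mulgA; congr (_ * _ * _).
  by rewrite mulgVK.
by rewrite !E // lij (coset_rep_eq pij) (coset_rep_eq pij').
Qed.

Let p0e i j : (i <= size s)%N -> (j <= size s)%N -> pos_rel s i j ->
  p0 (pfx s i * (pfx s j)^-1) = p0 (e i) * (p0 (e j))^-1.
Proof.
have sW := walk_group_subgroup s.
move=> ile jle pij; have Wi := eW ile; have Wj := eW jle.
rewrite -(morph_onV sW p0M Wj) -(p0M Wi (sgpV sW Wj)).
congr p0; rewrite /e (coset_rep_eq pij) invgM invgK mulgA.
by rewrite mulgVK.
Qed.

Let e0 : p0 (e 0) = 1.
Proof.
have [le _] := coset_repP (leq0n (size s)); move: le; rewrite leqn0 => /eqP le.
by rewrite /e le mulgV; apply: morph_on1 p0M; apply: walk_group_subgroup.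
Qed.

Let agree (p : F -> G') : (forall h g, H h -> p (h * g) = p h * p g) ->
  (forall i, (i <= size s)%N -> p (pfx s i) = p0 (e i)) ->
  {in walk_group s, p =1 p0}.
Proof.
move=> pM pE; apply: morph_on_gen_eq => [g h Wg _||g /set_mem [i [j [ile jle -> Hij]]]].
- by apply: pM; apply: walk_group_sub Wg.
- exact: p0M.
- rewrite p0e //; last exact/asboolP.
  apply: (@mulIg _ (p (pfx s j))); rewrite -pM // mulgVK !pE //.
  by rewrite mulgVK.
Qed.

(** The potential is [p0] of the loop comparing each position with the first visit of its vertex.
    Its increments depend only on the edge crossed, so [walk_realize] applies. *)
Lemma walk_extend : exists2 p : F -> G',
  forall h g, H h -> p (h * g) = p h * p g & {in walk_group s, p =1 p0}.
Proof.
have [p pM pE] := @walk_realize _ s (fun i => p0 (e i)) e0 eWE.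
by exists p => //; apply: agree.
Qed.

(** No earlier step constrains the increment along a new edge, so the potential at the end of the
    walk can be chosen to give the closing loop the value [y]. *)
Lemma walk_extend_edge x i (y : G') : (i <= size s)%N ->
    pos_rel (rcons s x) (size s).+1 i -> enew (rcons s x) (size s) ->
  exists p : F -> G', [/\ forall h g, H h -> p (h * g) = p h * p g,
    {in walk_group s, p =1 p0} &
    p (pfx (rcons s x) (size s).+1 * (pfx s i)^-1) = y].
Proof.
set s' := rcons s x => ile pni /allP new.
have s'E : s' = s ++ [:: x] by rewrite /s' cats1.
have sz : size s' = (size s).+1 by rewrite size_rcons.
pose E j := if (j <= size s)%N then p0 (e j) else y * p0 (e i).
have src' k : (k < size s)%N -> src s' k = src s k by move=> ?; rewrite s'E src_cat.
have tgt' k : (k < size s)%N -> tgt s' k = tgt s k by move=> ?; rewrite s'E tgt_cat.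
have [|a b alt blt ab|p pM pE] := @walk_realize _ s' E.
- by rewrite /E leq0n e0.
- rewrite sz !ltnS in alt blt; move: alt; rewrite leq_eqVlt => /predU1P[ea|alt];
    move: blt; rewrite leq_eqVlt => /predU1P[eb|blt].
  + by rewrite ea eb.
  + have := new b; rewrite mem_iota add0n blt /= => /(_ isT).
    by rewrite -ea ab.
  + have := new a; rewrite mem_iota add0n alt /= => /(_ isT).
    by rewrite -eb edge_sym ab.
  + rewrite !src' ?tgt' // /E !src_le ?tgt_le //; apply: eWE => //.
    by move: ab; rewrite s'E edge_cat.
exists p; split=> //.
  apply: agree => // j jle; rewrite -(pfx_cat [:: x]) // -s'E pE; last by rewrite sz ltnW.
  by rewrite /E jle.
have pfxi : pfx s' i = pfx s i by rewrite s'E pfx_cat.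
apply: (@mulIg _ (p (pfx s i))); rewrite -pM; last by rewrite -pfxi; apply/asboolP.
rewrite mulgVK pE ?sz // -pfxi pE; last by rewrite sz ltnW.
by rewrite /E ltnn ile.
Qed.

End Extend.

End InSubgroup.
End Walk.

(** * Bases of the groups traced by walks *)

Section WalkBasis.
Local Open Scope group_scope.
Variables (r : nat) (x0 : 'I_r * bool).
Let F := free_group r.
Implicit Types (g h w : F) (x : 'I_r * bool) (s : seq ('I_r * bool)).
Variables (H : set F).
Hypothesis sH : is_subgroup H.
Notation WG := (walk_group H).

Lemma walk_group_rcons s x i : (i <= size s)%N ->
    pos_rel H (rcons s x) (size s).+1 i ->
  WG (rcons s x) = Defs.generated (WG s `|` [set pfx (rcons s x) (size s).+1 * (pfx s i)^-1]).
Proof.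
move=> ile /asboolP Hi.
have sz : size (rcons s x) = (size s).+1 by rewrite size_rcons.
have pE j : (j <= size s)%N -> pfx (rcons s x) j = pfx s j.
  by move=> jle; rewrite -cats1 pfx_cat.
rewrite (pE i) // in Hi; set c := pfx (rcons s x) (size s).+1 * (pfx s i)^-1 in Hi *.
have sG := gen_subgroup (WG s `|` [set c]).
have Gc : Defs.generated (WG s `|` [set c]) c by apply: sub_gen; right.
have GW h : WG s h -> Defs.generated (WG s `|` [set c]) h by move=> ?; apply: sub_gen; left.
have last j : (j <= size s)%N -> H (pfx (rcons s x) (size s).+1 * (pfx s j)^-1) ->
   Defs.generated (WG s `|` [set c]) (pfx (rcons s x) (size s).+1 * (pfx s j)^-1).
  move=> jle Hj; rewrite -(mulgVK (pfx s i) (pfx _ _.+1)) -mulgA; apply: (sgpM sG) => //.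
  apply: GW; apply: walk_group_mem => //; apply/asboolP.
  by move: Hj; rewrite -(mulgVK (pfx s i) (pfx _ _.+1)) -mulgA => /(sgpMl sH _ Hi).
rewrite eqEsubset; split.
  apply: gen_sub => // g [a [b [ale ble -> Hab]]]; rewrite sz in ale ble.
  move: ale Hab; rewrite leq_eqVlt => /predU1P[->|];
    move: ble; rewrite leq_eqVlt => /predU1P[->|]; rewrite ?ltnS.
  - by rewrite mulgV => _; apply: sgp1 sG.
  - by move=> ble; rewrite (pE b) //; apply: last.
  - move=> ale; rewrite (pE a) // => Hab; rewrite -[_ * _]invgK; apply: (sgpV sG).
    by rewrite invgM invgK; apply: last => //; rewrite -[_ * _]invgK invgM invgK; apply: (sgpV sH).
  - move=> ble ale; rewrite !pE // => Hab; apply: GW; apply: walk_group_mem => //; exact/asboolP.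
apply: gen_sub; first exact: gen_subgroup.
move=> g [|->]; first by rewrite -cats1; apply: walk_group_cat.
rewrite /c -(pE i ile); apply: walk_group_mem; rewrite ?sz //.
  exact: leqW.
by apply/asboolP; rewrite (pE i ile).
Qed.

Lemma walk_group_vnew s x : vnew H (rcons s x) (size s).+1 -> WG (rcons s x) = WG s.
Proof.
move=> /allP new; rewrite eqEsubset; split; last by rewrite -cats1; apply: walk_group_cat.
have sz : size (rcons s x) = (size s).+1 by rewrite size_rcons.
have pE j : (j <= size s)%N -> pfx (rcons s x) j = pfx s j.
  by move=> jle; rewrite -cats1 pfx_cat.
have no j : (j <= size s)%N -> ~ H (pfx (rcons s x) (size s).+1 * (pfx s j)^-1).
  move=> jle Hj; have := new j; rewrite mem_iota add0n ltnS jle => /(_ isT) /negP; apply.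
  by apply/asboolP; rewrite (pE j).
apply: gen_sub; first exact: gen_subgroup.
move=> g [a [b [ale ble -> Hab]]]; rewrite sz in ale ble.
move: ale Hab; rewrite leq_eqVlt => /predU1P[->|];
    move: ble; rewrite leq_eqVlt => /predU1P[->|]; rewrite ?ltnS.
- by rewrite mulgV => _; apply: sgp1; apply: gen_subgroup.
- by move=> ble; rewrite (pE b) // => /no; case.
- move=> ale; rewrite (pE a) // => Hab; case: (no a) => //.
  by rewrite -[_ * _]invgK invgM invgK; apply: (sgpV sH).
- move=> ble ale; rewrite !pE // => Hab; apply: walk_group_mem => //; exact/asboolP.
Qed.

(** Extending the trivial homomorphism by a nontrivial value at [c] shows that [c] is new; extending
    an arbitrary one by an arbitrary value at [c] is the universal property of the enlarged
    basis. *)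
Lemma walk_basis_new s x B i : is_basis (WG s) B -> (i <= size s)%N ->
    pos_rel H (rcons s x) (size s).+1 i -> enew x0 H (rcons s x) (size s) ->
  let c := pfx (rcons s x) (size s).+1 * (pfx s i)^-1 in
  ~ WG s c /\ is_basis (WG (rcons s x)) (B `|` [set c]).
Proof.
move=> bB ile pi new c.
have sW := walk_group_subgroup H s.
have Hc : H c by move: pi => /asboolP; rewrite /c -(pfx_cat [:: x] ile) cats1.
split.
  move=> Wc; pose z : free_group 1 := fg_gen ord0.
  have triv : morph_on (WG s) (fun _ => 1 : free_group 1) by move=> *; rewrite mulg1.
  have [p [pM p0 pc]] := walk_extend_edge sH triv z ile pi new.
  by have := p0 c; rewrite pc => /(_ (mem_set Wc)) /(congr1 val).
apply: basis_crit.
  have [gB _] := bB; rewrite (walk_group_rcons ile pi) -gB -/c eqEsubset; split.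
    apply: gen_mono => g [Bg|->]; apply: sub_gen; [left|by right].
    exact: sub_gen.
  apply: gen_mono => g [|->]; last by apply: sub_gen; right.
  by apply: gen_mono => b Bb; apply: sub_gen; left.
move=> n f; have [p0 p0M p0B] := basis_ext f bB.
have [p [pM pp0 pc]] := walk_extend_edge sH p0M (f c) ile pi new.
exists p => [a b Wa _|b /set_mem [Bb|->] //].
  by apply: pM; apply: walk_group_sub Wa.
have Wb : WG s b by have [<- _] := bB; apply: sub_gen.
by rewrite pp0 ?p0B //; apply/mem_set.
Qed.

Lemma vnew_cat s1 s2 i : (i <= size s1)%N -> vnew H (s1 ++ s2) i = vnew H s1 i.
Proof.
move=> ile; apply: eq_in_all => j; rewrite mem_iota => /= jlt.
by rewrite pos_cat // (leq_trans (ltnW jlt)).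
Qed.

Lemma enew_cat s1 s2 i : (i < size s1)%N -> enew x0 H (s1 ++ s2) i = enew x0 H s1 i.
Proof.
move=> ile; apply: eq_in_all => j; rewrite mem_iota => /= jlt.
by rewrite edge_cat // (ltn_trans jlt).
Qed.

Lemma nvert_rcons s x : nvert H (rcons s x) = (nvert H s + vnew H (rcons s x) (size s).+1)%N.
Proof.
rewrite /nvert size_rcons -[(size s).+2]addn1 iotaD count_cat add0n.
congr (_ + _)%N; last by rewrite /= addn0.
apply: eq_in_count => i; rewrite mem_iota ltnS => /= ile.
by rewrite -cats1 vnew_cat.
Qed.

Lemma nedge_rcons s x :
  nedge x0 H (rcons s x) = (nedge x0 H s + enew x0 H (rcons s x) (size s))%N.
Proof.
rewrite /nedge size_rcons -[(size s).+1]addn1 iotaD count_cat add0n.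
congr (_ + _)%N; last by rewrite /= addn0.
apply: eq_in_count => i; rewrite mem_iota => /= ile.
by rewrite -cats1 enew_cat.
Qed.

(** Two crossings of one edge differ by the same group element at both of its ends, so the loop
    closed by the repeated step is already visible at the end visited before. *)
Lemma not_enew s x : ~~ enew x0 H (rcons s x) (size s) ->
  exists i, [/\ (i <= size s)%N, pos_rel H (rcons s x) (size s).+1 i &
    WG s (pfx (rcons s x) (size s).+1 * (pfx s i)^-1)].
Proof.
move=> /allPn [j]; rewrite mem_iota add0n => /= jlt; rewrite negbK.
have s'E : rcons s x = s ++ [:: x] by rewrite cats1.
have sz : size (rcons s x) = (size s).+1 by rewrite size_rcons.
have pE k : (k <= size s)%N -> pfx (rcons s x) k = pfx s k.
  by move=> kle; rewrite s'E pfx_cat.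
set s' := rcons s x => /andP[/eqP ll rr].
have jlt' : (j < size s')%N by rewrite sz ltnW.
have tt : pos_rel H s' (tgt x0 s' (size s)) (tgt x0 s' j).
  by rewrite edge_tgt // sz.
have e : pfx s' (tgt x0 s' (size s)) * (pfx s' (tgt x0 s' j))^-1
       = pfx s' (src x0 s' (size s)) * (pfx s' (src x0 s' j))^-1.
  by rewrite !(pfx_edge x0) // ?sz // ll invgM mulgA mulgK.
have srcj : (src x0 s' j <= size s)%N by rewrite /s' s'E src_cat ?src_le.
have tgtj : (tgt x0 s' j <= size s)%N by rewrite /s' s'E tgt_cat ?tgt_le.
have mem a : (a <= size s)%N -> pos_rel H s' (size s) a ->
    WG s (pfx s' (size s) * (pfx s' a)^-1).
  move=> ale pa; rewrite !pE //; apply: walk_group_mem => //.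
  by move: pa; rewrite /s' s'E pos_cat.
have tgtn : tgt x0 s' (size s) = if (nth x0 s' (size s)).2 then size s else (size s).+1 by [].
have srcn : src x0 s' (size s) = if (nth x0 s' (size s)).2 then (size s).+1 else size s by [].
case: ifP tgtn srcn => _ tgtn srcn; rewrite tgtn srcn in e tt rr.
- exists (src x0 s' j); split=> //.
  by rewrite -(pE _ srcj) -e; apply: mem.
- exists (tgt x0 s' j); split=> //.
  by rewrite -(pE _ tgtj) e; apply: mem.
Qed.

(** An old edge changes nothing, a new edge to a new vertex adds no loop, a new edge to an old
    vertex adds one free generator. The equation records the Euler characteristic. *)
Lemma walk_basis_step s x B : is_basis (WG s) B ->
  exists l : seq F, [/\ uniq l, forall g, g \in l -> ~ WG s g,
    is_basis (WG (rcons s x)) (B `|` [set` l]) &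
    (size l + nvert H (rcons s x) + nedge x0 H s
      = nedge x0 H (rcons s x) + nvert H s)%N].
Proof.
move=> bB; rewrite nvert_rcons nedge_rcons.
case: (boolP (enew x0 H (rcons s x) (size s))) => en; last first.
  have [i [ile pi Wi]] := not_enew en.
  have -> : vnew H (rcons s x) (size s).+1 = false.
    by apply/negbTE/allPn; exists i; rewrite ?mem_iota ?add0n ?ltnS // negbK.
  exists [::]; split=> //; last by rewrite /= !addn0 add0n addnC.
  rewrite set_nil setU0 (walk_group_rcons ile pi) setUidl => [|_ ->//].
  by rewrite gen_id //; apply: walk_group_subgroup.
case: (boolP (vnew H (rcons s x) (size s).+1)) => vn.
  exists [::]; split=> //; last by rewrite /=; lia.
  by rewrite set_nil setU0 walk_group_vnew.
have /allPn [i] := vn; rewrite mem_iota add0n ltnS negbK => /= ile pi.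
have [nW bc] := walk_basis_new bB ile pi en.
exists [:: pfx (rcons s x) (size s).+1 * (pfx s i)^-1]; split=> //.
- by move=> g; rewrite inE => /eqP->.
- by rewrite set_cons1.
- by rewrite /=; lia.
Qed.

Lemma walk_basis_cat s1 s2 B : is_basis (WG s1) B ->
  exists l : seq F, [/\ uniq l, forall g, g \in l -> ~ WG s1 g,
    is_basis (WG (s1 ++ s2)) (B `|` [set` l]) &
    (size l + nvert H (s1 ++ s2) + nedge x0 H s1
      = nedge x0 H (s1 ++ s2) + nvert H s1)%N].
Proof.
elim/last_ind: s2 => [|s2 x IH] bB.
  exists [::]; rewrite cats0 set_nil setU0; split=> //.
  by rewrite addnC.
have [l [ul nl bl el]] := IH bB.
have [l' [ul' nl' bl' el']] := walk_basis_step x bl.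
exists (l ++ l'); rewrite -rcons_cat; split.
- rewrite cat_uniq ul ul' andbT /=; apply/hasPn => g gl'; apply/negP => gl.
  apply: (nl' g gl'); have [<- _] := bl; apply: sub_gen; right; exact: gl.
- move=> g; rewrite mem_cat => /orP[/nl //|/nl'] nW W; apply: nW.
  exact: walk_group_cat.
- suff -> : [set` l ++ l'] = [set` l] `|` [set` l'] by rewrite setUA.
  rewrite eqEsubset; split=> g /=; first by rewrite mem_cat => /orP[]; [left|right].
  by rewrite mem_cat => -[->|->]; rewrite ?orbT.
- by rewrite size_cat; lia.
Qed.

Lemma walk_group_nil : WG [::] = [set 1].
Proof.
rewrite eqEsubset; split; last by move=> _ ->; apply: sgp1; apply: gen_subgroup.
apply: gen_sub; first by split=> [//|x y -> ->|x ->] /=; rewrite ?mulg1 ?invg1.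
by move=> g [i [j [ile jle -> _]]]; rewrite /pfx /= eval_nil mulgV.
Qed.

Lemma basis_trivial (G : groupType) : is_basis [set 1 : G] set0.
Proof.
split.
  rewrite eqEsubset; split; last by move=> _ ->; apply: sgp1; apply: gen_subgroup.
  by apply: gen_sub => //; split=> [//|x y -> ->|x ->] /=; rewrite ?mulg1 ?invg1.
by case=> [//|x s] sB; have := sB x (mem_head _ _).
Qed.

Lemma walk_basis s : exists l : seq F, [/\ uniq l,
  is_basis (WG s) [set` l] & (size l + nvert H s = (nedge x0 H s).+1)%N].
Proof.
have := @walk_basis_cat [::] s set0; rewrite walk_group_nil.
case=> [|l [ul _ bl el]]; first exact: basis_trivial.
exists l; split=> //; first by rewrite set0U in bl.
have e1 : nvert H [::] = 1%N by [].
have e2 : nedge x0 H [::] = 0%N by [].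
by move: el; rewrite e1 e2 /= addn0 addn1.
Qed.

(** The group traced by an initial part of a walk is a free factor of the group traced by the
    whole. *)
Lemma primitive_walk_cat s1 s2 g :
  primitive_in (WG s1) g -> primitive_in (WG (s1 ++ s2)) g.
Proof.
move=> [B bB Bg]; have [l [_ _ bl _]] := walk_basis_cat s2 bB.
by exists (B `|` [set` l]) => //; left.
Qed.

Lemma walk_group_closed s : H (eval_word (@fg_gen r) s) -> WG s (eval_word (@fg_gen r) s).
Proof.
move=> Hs; have := @walk_group_mem _ H s (size s) 0 (leqnn _) isT.
rewrite pfx0 invg1 mulg1 /pfx take_size; apply; apply/asboolP.
by rewrite pfx0 invg1 mulg1 /pfx take_size.
Qed.

Lemma walk_group_catr s1 s2 : H (eval_word (@fg_gen r) s1) ->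
  WG s2 `<=` WG (s1 ++ s2).
Proof.
move=> H1; have sW := walk_group_subgroup H (s1 ++ s2).
have W1 : WG (s1 ++ s2) (eval_word (@fg_gen r) s1).
  by apply: walk_group_cat; apply: walk_group_closed.
apply: gen_sub => // g [i [j [ile jle -> Hij]]].
set a := eval_word _ s1 in H1 W1.
have -> : pfx s2 i * (pfx s2 j)^-1
   = a^-1 * (pfx (s1 ++ s2) (size s1 + i) * (pfx (s1 ++ s2) (size s1 + j))^-1) * a.
  by rewrite !pfx_catr invgM !mulgA mulgVK mulVg mul1g.
apply: (sgpM sW) => //; apply: (sgpM sW); first exact: (sgpV sW).
apply: walk_group_mem; rewrite ?size_cat ?leq_add2l //; apply/asboolP.
rewrite !pfx_catr invgM !mulgA; apply: (sgpM sH); last exact: (sgpV sH).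
by rewrite -mulgA; apply: (sgpM sH).
Qed.

(** Closed walks spelling the elements of [l] are appended one after another; closedness keeps each
    of them based at the trivial coset. *)
Lemma walk_of_gens s (l : seq F) : H (eval_word (@fg_gen r) s) ->
    (forall g, g \in l -> H g) ->
  exists s', [/\ H (eval_word (@fg_gen r) (s ++ s')) &
     forall g, g \in l -> WG (s ++ s') g].
Proof.
elim: l s => [|g l IH] s Hs Hl; first by exists [::]; rewrite cats0.
have Hg : H g by apply: Hl; rewrite mem_head.
have [||s' [Hs' Ws']] := IH (s ++ val g).
- by rewrite eval_cat eval_val; apply: (sgpM sH).
- by move=> h hl; apply: Hl; rewrite inE hl orbT.
exists (val g ++ s'); rewrite catA; split=> // h; rewrite inE => /predU1P[->|/Ws' //].
apply: walk_group_cat; apply: walk_group_catr => //.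
by rewrite -{2}(eval_val g); apply: walk_group_closed; rewrite eval_val.
Qed.

Lemma walk_of_fg s (l : seq F) : H (eval_word (@fg_gen r) s) ->
    H = Defs.generated [set` l] -> exists s', WG (s ++ s') = H.
Proof.
move=> Hs Hl; have [|s' [_ Ws']] := @walk_of_gens s l Hs.
  by move=> g gl; rewrite Hl; apply: sub_gen.
exists s'; rewrite eqEsubset; split; first exact: walk_group_sub.
by rewrite {1}Hl; apply: gen_sub; [apply: walk_group_subgroup|].
Qed.

End WalkBasis.

Section WalkGroupRel.
Local Open Scope group_scope.
Variables (r : nat) (x0 : 'I_r * bool).
Let F := free_group r.
Variables (H : set F).
Hypothesis sH : is_subgroup H.

Lemma walk_group_idem s i j : (i <= size s)%N -> (j <= size s)%N ->
  pos_rel (walk_group H s) s i j = pos_rel H s i j.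
Proof.
move=> ile jle; apply/asboolP/idP => [/walk_group_sub h|]; last exact: walk_group_mem.
by apply/asboolP; apply: h.
Qed.

(** Passing to the traced subgroup keeps every coincidence along the walk, which allows [H] to be
    replaced by a group that the walk fills. *)
Lemma walk_group_self s : walk_group (walk_group H s) s = walk_group H s.
Proof.
rewrite eqEsubset; split; first by apply: walk_group_sub; apply: walk_group_subgroup.
apply: gen_mono => g [i [j [ile jle -> Hij]]]; apply: walk_group_mem => //.
by rewrite walk_group_idem //; apply/asboolP.
Qed.

End WalkGroupRel.

(** * Primitivity, finite quotients and the Hopf property *)

Section Primitivity.
Local Open Scope group_scope.
Variables (r : nat).
Let F := free_group r.
Implicit Types (g h w : F) (x : 'I_r * bool) (s : seq ('I_r * bool)).

Section InSubgroup.
Variables (x0 : 'I_r * bool) (H : set F).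
Hypothesis sH : is_subgroup H.

Lemma pfx_nseq i k j : (j <= k)%N -> pfx (nseq k (i, false)) j = (fg_gen i : F) ^+ j.
Proof.
move=> jle; rewrite /pfx take_nseq //; elim: j {jle} => [|j IH]; first by rewrite eval_nil.
by rewrite /= eval_cons IH expgS.
Qed.

(** Minimality of [k] makes the first [k] steps along the generator a simple cycle of the Schreier
    graph. Its loop is a basis of the group traced so far, which is a free factor of [H]. *)
Lemma gen_power_primitive i k (l : seq F) : H = Defs.generated [set` l] ->
    (0 < k)%N -> H (fg_gen i ^+ k) -> (forall j, (0 < j < k)%N -> ~ H (fg_gen i ^+ j)) ->
  primitive_in H (fg_gen i ^+ k).
Proof.
case: k => // k Hl _ Hk Hmin.
have pE a b : (a <= k.+1)%N -> (b <= k.+1)%N -> (b < a)%N ->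
    pos_rel H (nseq k.+1 (i, false)) a b -> (b = 0%N /\ a = k.+1).
  move=> ale ble ba /asboolP; rewrite !pfx_nseq // -expgnFr 1?ltnW // => Hab.
  have := Hmin (a - b)%N; have [lt|ge] := ltnP (a - b) k.+1; last by lia.
  by move=> /(_ _ Hab); case; lia.
have nseqE : nseq k.+1 (i, false) = rcons (nseq k (i, false)) (i, false).
  by rewrite -cats1 -[[:: _]]/(nseq 1 _) -nseqD addn1.
pose s := nseq k (i, false).
have W1 : walk_group H s = [set 1].
  rewrite -(walk_group_nil H) eqEsubset; split; last exact: walk_group_cat [::] s.
  apply: gen_sub => [|g [a [b [ale ble -> Hab]]]]; first exact: walk_group_subgroup.
  rewrite size_nseq in ale ble.
  suff -> : a = b by rewrite mulgV; apply: sgp1; apply: walk_group_subgroup.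
  have Hab' : pos_rel H (nseq k.+1 (i, false)) a b.
    by apply/asboolP; move: Hab; rewrite !pfx_nseq // ltnW.
  case: (ltngtP a b) => // lt.
    by have [] := pE b a (leqW ble) (leqW ale) lt _; [rewrite pos_sym|lia].
  by have [] := pE a b (leqW ale) (leqW ble) lt Hab'; lia.
have b1 : is_basis (walk_group H s) set0 by rewrite W1; apply: basis_trivial.
have szs : size s = k by rewrite size_nseq.
have rel : pos_rel H (rcons s (i, false)) (size s).+1 0.
  by apply/asboolP; rewrite -nseqE pfx0 invg1 mulg1 szs pfx_nseq.
have en : enew x0 H (rcons s (i, false)) (size s).
  apply/allP => j; rewrite mem_iota add0n szs /= => jlt; apply/negP => /andP[_].
  rewrite -nseqE /src !nth_nseq !ltnS leqnn (ltnW jlt) /= => h.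
  by have := pE k j (leqnSn _) (leqW (ltnW jlt)) jlt h; lia.
have [_] := walk_basis_new sH b1 (leq0n _) rel en.
rewrite pfx0 invg1 mulg1 set0U -nseqE szs pfx_nseq // => bc.
have pc : primitive_in (walk_group H (nseq k.+1 (i, false))) (fg_gen i ^+ k.+1).
  by exists [set fg_gen i ^+ k.+1].
have ev : eval_word (@fg_gen r) (nseq k.+1 (i, false)) = fg_gen i ^+ k.+1.
  by rewrite -[nseq _ _](take_size) size_nseq -[LHS]/(pfx _ _) pfx_nseq.
have [|s' <-] := walk_of_fg sH (s := nseq k.+1 (i, false)) _ Hl; first by rewrite ev.
exact: primitive_walk_cat.
Qed.

(** Explicit lists of the Cayley graph edges crossed allow walks to be cut, reversed and translated
    while their edges are compared. *)
Fixpoint edges g s : seq (F * 'I_r) :=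
  if s is x :: s' then
    ((if x.2 then g * (fg_gen x.1)^-1 else g), x.1)
      :: edges (g * letter_value (@fg_gen r) x) s'
  else [::].

Lemma size_edges g s : size (edges g s) = size s.
Proof. by elim: s g => //= x s IH g; rewrite IH. Qed.

Lemma edges_cat g s1 s2 :
  edges g (s1 ++ s2) = edges g s1 ++ edges (g * eval_word (@fg_gen r) s1) s2.
Proof.
elim: s1 g => [|x s1 IH] g; first by rewrite /= eval_nil mulg1.
by rewrite /= IH eval_cons mulgA.
Qed.

Lemma edges_mul h g s : edges (h * g) s = [seq (h * e.1, e.2) | e <- edges g s].
Proof.
elim: s g => //= x s IH g; rewrite -(mulgA h g (letter_value _ _)) IH; congr ((_, _) :: _).
by case: ifP; rewrite ?mulgA.
Qed.

Lemma nth_edges d g s i : (i < size s)%N ->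
  nth d (edges g s) i = (g * pfx s (src x0 s i), lab x0 s i).
Proof.
elim: s g i => // x s IH g [_|i ilt].
  rewrite /= /lab /src /=; congr (_, _); case: ifP => e.
    by rewrite /pfx /= take0 eval_cons eval_nil mulg1 /letter_value e.
  by rewrite pfx0 mulg1.
rewrite /= IH // /lab /src /=; congr (_, _); rewrite -mulgA; congr (_ * _).
by case: ifP => _; rewrite /pfx /= eval_cons.
Qed.

Lemma mem_edges_inv e g s : e \in edges g (inv_word s) ->
  e \in edges (g * (eval_word (@fg_gen r) s)^-1) s.
Proof.
elim: s => [|x s IH]; first by [].
have -> : inv_word (x :: s) = inv_word s ++ [:: inv_letter x].
  by rewrite /inv_word map_cons rev_cons cats1.
rewrite edges_cat mem_cat eval_inv eval_cons invgM mulgA /= mulgVK !inE orbC.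
move=> /orP[/eqP->|/IH ->]; last by rewrite orbT.
apply/orP; left; apply/eqP; congr (_, _).
by case: (x) => i []; rewrite /letter_value /= ?invgK ?mulgK //.
Qed.

Definition erel (e1 e2 : F * 'I_r) := (e1.2 == e2.2) && `[< H (e1.1 * e2.1^-1) >].

Lemma edge_relE d s i j : (i < size s)%N -> (j < size s)%N ->
  edge_rel x0 H s i j = erel (nth d (edges 1 s) i) (nth d (edges 1 s) j).
Proof. by move=> ilt jlt; rewrite !nth_edges // /erel /= !mul1g. Qed.

(** Cut the word as s1 x s2 at the edge crossed only once. A walk avoiding this edge reaches both of
    its ends, and crossing it then closes a loop that spells the whole word: a new basis element. *)
Lemma edge_once_primitive s q : walk_group H s = H -> H (eval_word (@fg_gen r) s) -> (q < size s)%N ->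
    (forall j, (j < size s)%N -> j != q -> ~~ edge_rel x0 H s q j) ->
  primitive_in H (eval_word (@fg_gen r) s).
Proof.
move=> HE Hs qlt once; set d : F * 'I_r := (1, x0.1).
pose s1 := take q s; pose s2 := drop q.+1 s; pose x := nth x0 s q.
have sE : s = s1 ++ x :: s2 by rewrite -(drop_nth x0) // cat_take_drop.
have sz1 : size s1 = q by rewrite size_take qlt.
(* Backwards along [s2] from the base point, which visits the far end of the edge, back again, and
   then along [s1] to its near end. *)
pose w := inv_word s2 ++ s2 ++ s1.
pose ev t : F := eval_word (@fg_gen r) t.
have evs : ev s = ev s1 * letter_value (@fg_gen r) x * ev s2.
  by rewrite sE /ev eval_cat eval_cons mulgA.
have evw : ev w = ev s1 by rewrite /ev !eval_cat eval_inv mulKg.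
have wx : rcons w x = w ++ [:: x] by rewrite cats1.
have ex : nth d (edges 1 (rcons w x)) (size w) = nth d (edges 1 s) q.
  rewrite wx edges_cat nth_cat size_edges ltnn subnn /= [in RHS]sE edges_cat nth_cat.
  by rewrite size_edges sz1 ltnn subnn /= -[eval_word _ w]/(ev w) evw.
have en : enew x0 H (rcons w x) (size w).
  apply/allP => j; rewrite mem_iota add0n /= => jlt.
  rewrite (edge_relE d) ?size_rcons ?ltnS ?(ltnW jlt) // ex.
  have : nth d (edges 1 (rcons w x)) j \in edges 1 w.
    by rewrite wx edges_cat nth_cat size_edges jlt mem_nth // size_edges.
  move: (nth d (edges 1 (rcons w x)) j) => e.
  rewrite /w !edges_cat !mem_cat eval_inv !mul1g mulVg => he.
  have {he} : e \in edges (ev s2)^-1 s2 \/ e \in edges 1 s1.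
    case/orP: he => [/mem_edges_inv|/orP[]]; rewrite ?mul1g.
    - by left.
    - by left.
    - by right.
  case=> [he|he].
    have : (ev s * e.1, e.2) \in edges (ev s1 * letter_value (@fg_gen r) x) s2.
      have -> : ev s1 * letter_value (@fg_gen r) x = ev s * (ev s2)^-1.
        by rewrite evs mulgK.
      by rewrite edges_mul; apply/mapP; exists e.
    move=> /(nthP d) [a]; rewrite size_edges => alt ea.
    have lt' : (q.+1 + a < size s)%N.
      by rewrite sE size_cat sz1 /=; lia.
    have ne : (q.+1 + a)%N != q by apply/eqP; lia.
    have := once _ lt' ne; rewrite (edge_relE d) //.
    have -> : nth d (edges 1 s) (q.+1 + a) = (ev s * e.1, e.2).
      rewrite -ea sE edges_cat nth_cat size_edges sz1 ifF; last by lia.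
      have -> : (q.+1 + a - q = a.+1)%N by lia.
      by rewrite /= mul1g.
    move=> /negP h; apply/negP => /andP[e1 /asboolP e2]; apply: h.
    rewrite /erel /= e1; apply/asboolP; rewrite invgM mulgA.
    by apply: (sgpM sH) => //; apply: (sgpV sH).
  have /(nthP d) [a] := he; rewrite size_edges sz1 => alt ea.
  have := once a (ltn_trans alt qlt); rewrite (edge_relE d) ?(ltn_trans alt) //.
  have -> : nth d (edges 1 s) a = e.
    by rewrite -ea {1}sE edges_cat nth_cat size_edges sz1 alt.
  by apply; rewrite ltn_eqF.
have [l [_ bl _]] := walk_basis x0 sH w.
have ile : (size s2 <= size w)%N.
  by rewrite /w !size_cat size_rev size_map leq_addr.
have pw2 : pfx w (size s2) = (ev s2)^-1.
  rewrite /w pfx_cat ?size_rev ?size_map //.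
  by rewrite -(@eval_inv _ _ _ s2) /pfx take_oversize // size_rev size_map.
have pwl : pfx (rcons w x) (size w).+1 = ev s1 * letter_value (@fg_gen r) x.
  by rewrite /pfx take_oversize ?size_rcons // eval_rcons -/(ev w) evw.
have rel : pos_rel H (rcons w x) (size w).+1 (size s2).
  apply/asboolP; rewrite pwl {1}wx pfx_cat // pw2 invgK -evs; exact: Hs.
have [_] := walk_basis_new sH bl ile rel en.
rewrite pwl pw2 invgK -evs => bs.
have pr : primitive_in (walk_group H (rcons w x)) (ev s).
  by exists ([set` l] `|` [set ev s]) => //; right.
have evw2 : ev (rcons w x ++ s2) = ev s.
  by rewrite /ev eval_cat eval_rcons -/(ev w) evw -evs.
(* After a further [s2] the walk is closed, so another copy of [s] makes it fill [H]. *)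
have := @primitive_walk_cat _ x0 _ sH _ (s2 ++ s) _ pr; rewrite catA.
suff -> : walk_group H ((rcons w x ++ s2) ++ s) = H by [].
rewrite eqEsubset; split; first exact: walk_group_sub.
by rewrite -{1}HE; apply: walk_group_catr; rewrite // -/(ev _) evw2.
Qed.

End InSubgroup.

Lemma gen_basis (G : groupType) (H B : set G) : is_basis H B -> Defs.generated B = H.
Proof. by case. Qed.

Lemma perm_extend (T : finType) (A : seq (T * T)) :
    {in A &, forall p q, p.1 = q.1 <-> p.2 = q.2} ->
  exists s : {perm T}, {in A, forall p, s p.1 = p.2}.
Proof.
elim: A => [|[y z] A IH] inj; first by exists 1%g.
have [|s sA] := IH; first by move=> p q pA qA; apply: inj; rewrite inE ?pA ?qA orbT.
exists (s * tperm (s y) z) => p; rewrite inE => /predU1P[->|pA]; rewrite permM.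
  by rewrite tpermL.
have := inj p (y, z); rewrite !inE eqxx pA orbT => /(_ isT isT) /= pyz.
rewrite sA //; case: (eqVneq p.1 y) => [e|ne].
  by rewrite -e sA // tpermL; apply/esym/pyz.
have ne2 : p.2 != z by apply: contraNneq ne => /pyz ->.
rewrite tpermD 1?eq_sym //; apply: contraNneq ne => e.
by apply/eqP; apply: (@perm_inj _ s); rewrite sA.
Qed.

(** [v] sends positions to points of a finite set; the hypothesis makes every letter act there as a
    partial injection, which extends to a permutation. *)
Lemma walk_perm (x0 : 'I_r * bool) (N : nat) s (v : nat -> 'I_N) :
    (forall i j, (i < size s)%N -> (j < size s)%N -> lab x0 s i = lab x0 s j ->
      v (src x0 s i) = v (src x0 s j) <-> v (tgt x0 s i) = v (tgt x0 s j)) ->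
  exists f : 'I_r -> 'S_N,
    forall j, (j <= size s)%N -> eval_word f (take j s) (v 0%N) = v j.
Proof.
move=> folded.
have ex (c : 'I_r) : exists p : 'S_N, forall i, (i < size s)%N -> lab x0 s i = c ->
    p (v (src x0 s i)) = v (tgt x0 s i).
  have [|p pA] := @perm_extend _ [seq (v (src x0 s i), v (tgt x0 s i)) |
                      i <- iota 0 (size s) & lab x0 s i == c].
    move=> _ _ /mapP[i + ->] /mapP[j + ->]; rewrite !mem_filter !mem_iota !add0n /=.
    move=> /andP[/eqP li ilt] /andP[/eqP lj jlt]; apply: folded => //.
    by rewrite li lj.
  exists p => i ilt li; apply: (pA (v (src x0 s i), v (tgt x0 s i))).
  by apply/mapP; exists i => //; rewrite mem_filter li eqxx mem_iota.
have /choice [f fP] := ex.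
exists f; elim=> [|j IH] jle; first by rewrite take0 eval_nil perm1.
rewrite (take_nth x0) // eval_rcons permM IH ?(ltnW jle) //.
have := fP _ j jle erefl; rewrite /src /tgt /lab /letter_value.
by case: ifP => _ //= <-; rewrite permK.
Qed.

(** The positions along the word serve as distinct points. Reducedness makes each letter a partial
    injection on them, and the word carries the first point to the last. *)
Lemma free_residually_finite s : reduced s -> s <> [::] ->
  exists N (f : 'I_r -> 'S_N), eval_word f s <> 1.
Proof.
case: s => // x0 s'; set s := x0 :: s' => red _.
exists (size s).+1; have adj j : (j.+1 < size s)%N ->
    nth x0 s j.+1 != inv_letter (nth x0 s j).
  by move=> jlt; have /(sortedP x0) := red; apply.
have [|f fP] := @walk_perm x0 (size s).+1 s inord.
  have inordE a b : (a <= size s)%N -> (b <= size s)%N ->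
      (inord a : 'I_(size s).+1) = inord b -> a = b.
    by move=> ale ble /(congr1 val); rewrite /= !inordK ?ltnS.
  have key a b : (a < size s)%N -> (b < size s)%N -> lab x0 s a = lab x0 s b ->
      src x0 s a = src x0 s b \/ tgt x0 s a = tgt x0 s b -> a = b.
    move=> alt blt; rewrite /lab /src /tgt => lab_eq.
    have no c : (c.+1 < size s)%N -> (nth x0 s c.+1).1 = (nth x0 s c).1 ->
        (nth x0 s c.+1).2 = ~~ (nth x0 s c).2 -> False.
      move=> clt e1 e2; have /negP := adj c clt; apply.
      by rewrite /inv_letter -e1 -e2 -surjective_pairing.
    case ea: (nth x0 s a).2; case eb: (nth x0 s b).2 => -[] //.
    - by case.
    - by move=> e; case: (no a); rewrite ?e ?lab_eq ?ea ?eb // -?e.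
    - by move=> e; case: (no b); rewrite -?e ?lab_eq ?ea ?eb // ?e.
    - by move=> e; case: (no b); rewrite ?e -?lab_eq ?ea ?eb // -?e.
    - by move=> e; case: (no a); rewrite -?e ?lab_eq ?ea ?eb // ?e.
    - by case.
  move=> i j ilt jlt lij; split=> /inordE e.
    by rewrite (key i j) //; left; apply: e; apply: src_le.
  by rewrite (key i j) //; right; apply: e; apply: tgt_le.
exists f => f1; have := fP _ (leqnn _); rewrite take_size f1 perm1.
by move/(congr1 val); rewrite /= !inordK.
Qed.

End Primitivity.

(** * Rank, generating sets of minimal size, and the Hopf property *)

Section Rank.
Local Open Scope card_scope.
Local Open Scope group_scope.
Variable G : groupType.
Implicit Types (H B : set G) (b l : seq G).

Section Counting.
Variables (H : set G) (b l : seq G) (d : G).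
Hypotheses (ub : uniq b) (bB : is_basis H [set` b]) (gl : Defs.generated [set` l] = H).

Let ext (K : finGroupType) : exists p : {ffun 'I_(size b) -> K} -> G -> K,
  forall f, morph_on H (p f) /\ forall i : 'I_(size b), p f (nth d b i) = f i.
Proof.
suff /choice [p pP] : forall f : {ffun 'I_(size b) -> K}, exists p : G -> K,
    morph_on H p /\ forall i : 'I_(size b), p (nth d b i) = f i by exists p.
move=> f; pose c g := if insub (index g b) is Some i then f i else 1.
have [p pM pB] := basis_ext c bB; exists p; split=> // i.
rewrite pB; last by apply/mem_set => /=; apply: mem_nth.
rewrite /c insubT /=; first by rewrite index_uniq.
by move=> h; congr (f _); apply: val_inj; rewrite /= index_uniq.
Qed.

(** A homomorphism to [K] may be prescribed freely on [b], and is determined by its values on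
    [l]. *)
Let gens_inj (K : finGroupType) : exists p : {ffun 'I_(size b) -> K} -> G -> K,
  (forall f, morph_on H (p f)) /\
  injective (fun f => [ffun i : 'I_(size l) => p f (nth d l i)]).
Proof.
have [p pP] := ext K; exists p; split=> [f|f1 f2 /ffunP eq12]; first by case: (pP f).
have [m1 e1] := pP f1; have [m2 e2] := pP f2.
apply/ffunP => i; rewrite -e1 -e2.
have := @morph_on_gen_eq _ _ [set` l] (p f1) (p f2).
rewrite gl => /(_ m1 m2) h; apply: h; last first.
  apply/mem_set; rewrite -(gen_basis bB); apply: sub_gen => /=; exact: mem_nth.
move=> g /set_mem /= gl'; have ilt : (index g l < size l)%N by rewrite index_mem.
by have := eq12 (Ordinal ilt); rewrite !ffunE /= nth_index.
Qed.

(** Homomorphisms to a group of order two are counted. *)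
Lemma basis_size_le : (size b <= size l)%N.
Proof.
have [p [_ /leq_card]] := gens_inj 'S_2.
by rewrite !card_ffun !card_ord card_Sn leq_exp2l.
Qed.

Hypothesis szl : (size l <= size b)%N.

(** Once the sizes agree, the injection of [gens_inj] joins finite sets of equal cardinality and is
    therefore onto. *)
Lemma gens_univ (K : finGroupType) (x : 'I_(size l) -> K) :
  exists2 p : G -> K, morph_on H p & forall i : 'I_(size l), p (nth d l i) = x i.
Proof.
have [p [pM pinj]] := gens_inj K.
have sz : size b = size l by apply/eqP; rewrite eqn_leq szl basis_size_le.
have [|g _ gK] := inj_card_bij pinj; first by rewrite !card_ffun !card_ord sz.
exists (p (g (finfun x))) => // i.
by have /ffunP/(_ i) := gK (finfun x); rewrite !ffunE.
Qed.

Lemma gens_uniq : uniq l.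
Proof.
apply/(uniqP d) => i j ilt jlt e; apply/eqP; apply: contraT => ne.
have [p _ pE] := @gens_univ {perm bool}
  (fun k => if val k == i then tperm true false else 1).
have := pE (Ordinal ilt); have := pE (Ordinal jlt).
rewrite /= eqxx eq_sym (negbTE ne) e => -> /(congr1 (fun s : {perm bool} => s true)).
by rewrite perm1 tpermL.
Qed.

(* A free group of finite rank is Hopfian; here because finite quotients
   see all of it. *)
Lemma gens_basis : is_basis H [set` l].
Proof.
split=> // s sl rs s0 s1.
have sH : is_subgroup H by rewrite -gl; apply: gen_subgroup.
have l0 : (0 < size l)%N.
  case: (l) sl => [|//]; case: (s) s0 => // x s' _ /(_ x (mem_head _ _)) //.
pose c (g : G) : 'I_(size l) := if insub (index g l) is Some i then i else Ordinal l0.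
have cE g : g \in l -> nth d l (c g) = g.
  by move=> gl'; rewrite /c insubT ?index_mem //= => ?; rewrite nth_index.
pose t := [seq (c x.1, x.2) | x <- s].
have rt : reduced t.
  rewrite /reduced sorted_map; apply: (sub_in_sorted (P := [in s])) rs; last exact/allP.
  move=> x y xs ys /=; apply: contraNneq => -[exy ey2].
  rewrite /inv_letter -ey2 -(cE x.1) -?exy ?cE -?surjective_pairing //; exact: sl.
have [|N [f fN]] := free_residually_finite rt; first by rewrite /t; case: (s) s0.
have [p pM pE] := gens_univ f; apply: fN.
have [||||_] := @eval_morph _ G _ id p H s (sgp1 sH).
- by move=> x /sl xl; rewrite -gl; apply: sub_gen.
- by move=> a a'; apply: sgpM.
- by move=> a; apply: sgpV.
- by [].
rewrite s1 (morph_on1 sH pM) => ->.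
rewrite /eval_word big_map; apply: eq_big_seq => x xs /=.
by rewrite -pE cE //; apply: sl.
Qed.

End Counting.

Lemma card_eq_seq B k : B #= `I_k -> exists b, [/\ uniq b, size b = k & B = [set` b]].
Proof.
move=> Bk; have finB : finite_set B by exists k.
exists (fset_set B); split; first exact: fset_uniq.
- exact: card_fset_set Bk.
- by rewrite -[LHS](fset_setK finB).
Qed.

Lemma seq_card_eq (b : seq G) : uniq b -> [set` b] #= `I_(size b).
Proof.
move=> ub; have -> : [set` b] = [set` [fset x in b]%fset].
  by rewrite eqEsubset; split=> x /=; rewrite !inE.
by apply/card_eq_fsetP; rewrite card_fseq undup_id.
Qed.

Lemma basis_size_eq H b b' : uniq b -> is_basis H [set` b] ->
  uniq b' -> is_basis H [set` b'] -> size b = size b'.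
Proof.
move=> ub bB ub' bB'; apply/eqP; rewrite eqn_leq.
by rewrite (basis_size_le 1 ub bB (gen_basis bB')) (basis_size_le 1 ub' bB' (gen_basis bB)).
Qed.

Lemma rk_basis H b : uniq b -> is_basis H [set` b] -> rk H = Some (size b).
Proof.
move=> ub bB; rewrite /rk /least; case: pselect => [exP|nex]; last first.
  case: nex; exists (size b); apply/asboolP; exists [set` b] => //.
  exact: seq_card_eq.
congr Some; case: ex_minnP => m /asboolP [B BB Bm] _.
have [b' [ub' <- eB]] := card_eq_seq Bm.
by apply: basis_size_eq bB => //; rewrite -eB.
Qed.

Lemma rk_some H k : rk H = Some k -> exists b, [/\ uniq b, size b = k & is_basis H [set` b]].
Proof.
rewrite /rk /least; case: pselect => // exP [<-].
case: ex_minnP => m /asboolP [B BB Bm] _.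
by have [b [ub sb eB]] := card_eq_seq Bm; exists b; rewrite -eB.
Qed.

End Rank.

(** * A bi-invariant order on the free group *)

Section Magnus.
Variable r : nat.
Local Open Scope int_scope.
Let series := seq 'I_r -> int.
Implicit Types (f g h : seq 'I_r -> int) (t : 'I_r) (I J : seq 'I_r).
Implicit Types (x : 'I_r * bool) (s : seq ('I_r * bool)).

(** A series in noncommuting variables is given by its coefficients, indexed by monomials. [mulX t]
    is left multiplication by 1 + X_t and [divX t] its inverse, so that [magnus] is the Magnus
    expansion. *)
Definition mulX t f : series := fun I =>
  f I + (if I is j :: I' then (if j == t then f I' else 0) else 0).

Fixpoint divX t f I : int :=
  f I - (if I is j :: I' then (if j == t then divX t f I' else 0) else 0).

Lemma divXE t f I : divX t f I =
  f I - (if I is j :: I' then (if j == t then divX t f I' else 0) else 0).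
Proof. by case: I. Qed.

Lemma divXK t f : mulX t (divX t f) = f.
Proof. by apply/funext => I; rewrite /mulX divXE subrK. Qed.

Lemma mulXK t f : divX t (mulX t f) = f.
Proof.
apply/funext; elim=> [|j I IH]; first by rewrite /= /mulX addr0 subr0.
by rewrite /= IH /mulX addrK.
Qed.

Definition mulL x f : series := if x.2 then divX x.1 f else mulX x.1 f.

Lemma mulLV x f : mulL x (mulL (inv_letter x) f) = f.
Proof. by case: x => t []; rewrite /mulL /= ?mulXK ?divXK. Qed.

Definition mulW s f : series := foldr mulL f s.

Lemma mulW_cons_letter x s f : mulW (cons_letter x s) f = mulL x (mulW s f).
Proof.
case: s => [|y s] //=; case: eqP => [->|//].
by rewrite mulLV.
Qed.

Lemma mulW_mul s1 s2 f : mulW (mul_word s1 s2) f = mulW s1 (mulW s2 f).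
Proof. by elim: s1 => //= x s1 IH; rewrite mulW_cons_letter IH. Qed.

Definition unitS : series := fun I => (I == [::])%:R.
Definition magnus (w : free_group r) : series := mulW (val w) unitS.

Lemma magnusM v w : magnus (v * w)%g = mulW (val v) (magnus w).
Proof. exact: mulW_mul. Qed.

(** The product of two series: the sum over all splittings of the monomial [I] in two, by recursion
    on the left part. *)
Fixpoint conv h f I : int :=
  h [::] * f I + (if I is j :: I' then conv (fun K => h (j :: K)) f I' else 0).

Lemma convE h f I : conv h f I =
  h [::] * f I + (if I is j :: I' then conv (fun K => h (j :: K)) f I' else 0).
Proof. by case: I. Qed.

Lemma convD h g f I : conv (fun K => h K + g K) f I = conv h f I + conv g f I.
Proof.
elim: I h g => [|j I IH] h g /=; first by rewrite !addr0 mulrDl.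
by rewrite IH mulrDl addrACA.
Qed.

Lemma conv0 f I : conv (fun=> 0) f I = 0.
Proof. by elim: I => [|j I IH] /=; rewrite mul0r ?IH addr0. Qed.

Lemma conv1 f I : conv unitS f I = f I.
Proof.
rewrite convE /unitS eqxx mul1r; case: I => [|j I]; rewrite ?addr0 //.
by rewrite (_ : (fun K => _) = fun=> 0) ?conv0 ?addr0 //; apply/funext.
Qed.

Lemma mulX_conv t h f : mulX t (conv h f) = conv (mulX t h) f.
Proof.
apply/funext => I; rewrite /mulX; case: I => [|j I]; first by rewrite /= !addr0.
rewrite [RHS]/= [conv h f (_ :: _)]/= addr0 -addrA; congr (_ + _).
by rewrite convD; congr (_ + _); case: eqP => // _; rewrite conv0.
Qed.

Lemma mulL_conv x h f : mulL x (conv h f) = conv (mulL x h) f.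
Proof.
rewrite /mulL; case: ifP => _; last exact: mulX_conv.
by rewrite -{1}(divXK x.1 h) -mulX_conv mulXK.
Qed.

Lemma mulW_conv s f : mulW s f = conv (mulW s unitS) f.
Proof.
elim: s => [|x s IH]; first by apply/funext => I; rewrite /= conv1.
by rewrite /= IH mulL_conv.
Qed.

Lemma magnus_nil w : magnus w [::] = 1.
Proof.
rewrite /magnus; elim: (val w) => [|x s IH] //=.
by rewrite /mulL; case: ifP => _; rewrite ?divXE /mulX ?subr0 ?addr0.
Qed.

Section Leading.
Variables (f g : series) (n : nat).
Hypothesis fg : forall J, (size J < n)%N -> f J = g J.

(** A factor with constant term 1 does not change the lowest degree part of a difference of two
    series. *)
Lemma mulL_lead x J : (size J <= n)%N -> mulL x f J - mulL x g J = f J - g J.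
Proof.
rewrite /mulL; case: ifP => _.
  elim: J => [|j J IH] Jn; first by rewrite /= !subr0.
  rewrite /=; case: eqP => _; last by rewrite !subr0.
  have := IH (ltnW Jn); rewrite (fg Jn) subrr => /subr0_eq ->.
  by rewrite opprD opprK addrACA addNr addr0.
rewrite /mulX; case: J => [|j J] Jn; first by rewrite !addr0.
by case: eqP => _; rewrite ?addr0 // (fg Jn) opprD addrACA subrr addr0.
Qed.

Lemma conv_lead h J : (size J <= n)%N -> conv f h J - conv g h J = (f J - g J) * h [::].
Proof.
elim: J n f g fg => [|j J IH] m f' g' fg' Jm; first by rewrite /= !addr0 mulrBl.
rewrite /= (fg' [::]) ?(leq_ltn_trans _ Jm) // opprD addrACA subrr add0r.
by rewrite (IH m.-1) // => [K Km|]; [apply: fg' => /=; lia|rewrite /= in Jm; lia].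
Qed.

End Leading.

Lemma mulW_lead s f g n : (forall J, (size J < n)%N -> f J = g J) ->
  forall J, (size J <= n)%N -> mulW s f J - mulW s g J = f J - g J.
Proof.
move=> fg; elim: s => //= x s IH J Jn.
rewrite (@mulL_lead _ _ n) ?IH // => K Kn.
by apply/subr0_eq; rewrite (IH _ (ltnW Kn)) (fg _ Kn) subrr.
Qed.

Definition alternating I := sorted (fun a b : 'I_r => a != b) I.
Definition not_head t I := if I is j :: _ then j != t else true.

(** In the expansion of a power of 1 + X, of either sign, the terms from X^2 on only reach monomials
    that begin with a repeated letter; on the others only 1 and the linear term are seen. *)
Lemma mulW_nseq e x f :
  (forall J, not_head x.1 J -> mulW (nseq e x) f J = f J) /\
  (forall J, not_head x.1 J -> mulW (nseq e x) f (x.1 :: J)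
     = f (x.1 :: J) + (-1) ^+ x.2 * e%:R * f J).
Proof.
elim: e => [|e [IH1 IH2]]; first by split=> J _ //; rewrite mulr0 mul0r addr0.
have step J : not_head x.1 J -> forall g, mulL x g J = g J.
  rewrite /mulL /mulX; case: J => [|j J] /= nt g.
    by case: ifP => _ /=; rewrite ?subr0 ?addr0.
  by case: ifP => _ /=; rewrite (negbTE nt) ?subr0 ?addr0.
split=> J nt; first by rewrite /= step ?IH1.
rewrite /= {1}/mulL /mulX /=; case e2: x.2 (step J nt) IH2 => stp IH2.
  rewrite /= eqxx; have := stp (mulW (nseq e x) f); rewrite /mulL e2 => ->.
  by rewrite (IH2 J nt) (IH1 J nt) -natr1; ring.
by rewrite /= eqxx (IH2 J nt) (IH1 J nt) -natr1; ring.
Qed.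

(** Group the word into syllables, maximal powers of one generator. Among the alternating monomials
    the longest one to occur lists the syllables, and its coefficient is the product of their
    nonzero exponents. *)
Lemma magnus_word_nonzero e x s : reduced (nseq e.+1 x ++ s) ->
  exists I, [/\ alternating (x.1 :: I), mulW (nseq e.+1 x ++ s) unitS (x.1 :: I) != 0 &
    forall J, alternating J -> (size (x.1 :: I) < size J)%N ->
      mulW (nseq e.+1 x ++ s) unitS J = 0].
Proof.
have core (e' : nat) (y : 'I_r * bool) (f : series) I :
    alternating I -> not_head y.1 I -> f I != 0 ->
    (forall J, alternating J -> (size I < size J)%N -> f J = 0) ->
    [/\ alternating (y.1 :: I), mulW (nseq e'.+1 y) f (y.1 :: I) != 0 &
      forall J, alternating J -> (size (y.1 :: I) < size J)%N -> mulW (nseq e'.+1 y) f J = 0].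
  move=> aI nI fI fJ; have [p1 p2] := mulW_nseq e'.+1 y f.
  have aI' : alternating (y.1 :: I).
    by case: (I) aI nI => //= j I' aI'; rewrite eq_sym => ->.
  split=> //.
    rewrite p2 // fJ // add0r mulf_neq0 // mulf_neq0 ?pnatr_eq0 //.
    by rewrite signr_eq0.
  move=> [//|j J] aJ Jlt; have [e1|ne] := eqVneq j y.1; last first.
    by rewrite p1 // fJ // (ltn_trans _ Jlt).
  rewrite e1 p2; last first.
    by case: (J) aJ => //= k K /andP[]; rewrite e1 eq_sym.
  rewrite !fJ ?mulr0 ?addr0 //; first exact: (path_sorted aJ).
    by rewrite -e1.
  by rewrite (ltn_trans _ Jlt).
elim: s e x => [|y s IH] e x red.
  exists [::]; rewrite cats0; apply: core => //.
  by move=> [|].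
have [exy|nexy] := eqVneq y.1 x.1.
  have yx : y = x.
    move: red; rewrite /reduced /= cat_path /= => /and3P[_ + _].
    have -> : last x (nseq e x) = x by elim: (e).
    rewrite /inv_letter; move: (y) (x) exy => [a b] [c d] /= ->.
    by rewrite xpair_eqE eqxx /=; case: b; case: d.
  have nE : nseq e.+1 x ++ y :: s = nseq e.+2 x ++ s.
    by rewrite yx -cat_rcons -cats1 -[[:: x]]/(nseq 1 x) -nseqD addn1.
  by rewrite nE; apply: IH; rewrite -nE.
have redy : reduced (nseq 1 y ++ s).
  by move: red; rewrite /reduced /= cat_path => /andP[_] /=; case/andP.
have [I [aI nI zI]] := IH 0%N y redy.
exists (y.1 :: I); rewrite /mulW foldr_cat; exact: core.
Qed.

Lemma magnus_inj : injective magnus.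
Proof.
move=> v w vw; suff e : (v^-1 * w = 1)%g by rewrite -(mulKVg v w) e mulg1.
have : magnus (v^-1 * w)%g = unitS.
  by rewrite magnusM -vw -magnusM mulVg.
move: (v^-1 * w)%g => u uE; apply: val_inj.
move: uE (fg_reduced u); rewrite /magnus /=.
case: (fg_word u) => [//|x s] uE red; have [I [_ /negP nz _]] := @magnus_word_nonzero 0 x s red.
by case: nz; rewrite -[nseq 1 x ++ s]/(x :: s) uE.
Qed.

(** Degree comes first, so that agreement before a monomial includes agreement in all lower degrees,
    as [mulL_lead] and [conv_lead] demand; [pickle] orders monomials of equal degree. *)
Definition before J I :=
  (size J < size I)%N || ((size J == size I) && (pickle J < pickle I)%N).

(* A total order on the free group, invariant under translations on both sides:
   compare the first coefficients at which the Magnus expansions differ. *)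
Definition fg_lt (v w : free_group r) := exists I,
  magnus v I < magnus w I /\ forall J, before J I -> magnus v J = magnus w J.

Lemma before_trans I J K : before I J -> before J K -> before I K.
Proof.
rewrite /before => /orP[h1|/andP[/eqP e1 h1]] /orP[h2|/andP[/eqP e2 h2]].
- by rewrite (ltn_trans h1 h2).
- by rewrite -e2 h1.
- by rewrite e1 h2.
- by rewrite e1 e2 eqxx (ltn_trans h1 h2) orbT.
Qed.

Lemma before_total I J : I <> J -> before I J \/ before J I.
Proof.
move=> nIJ; rewrite /before; case: (ltngtP (size I) (size J)) => _ /=; rewrite ?orbT; auto.
case: ltngtP => // e; auto.
by case: nIJ; apply: (pcan_inj pickleK).
Qed.

Lemma fg_lt_irr v : ~ fg_lt v v.
Proof. by move=> [I []]; rewrite ltxx. Qed.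

Lemma fg_lt_trans u v w : fg_lt u v -> fg_lt v w -> fg_lt u w.
Proof.
move=> [I [lI eI]] [J [lJ eJ]]; have [e|/before_total [h|h]] := pselect (I = J).
- exists I; split; first by apply: lt_trans lI _; rewrite e.
  by move=> K KI; rewrite eI // eJ // -e.
- exists I; split; first by rewrite -eJ.
  by move=> K KI; rewrite eI // eJ //; apply: before_trans h.
- exists J; split; first by rewrite eI.
  by move=> K KJ; rewrite eI ?eJ //; apply: before_trans h.
Qed.

Lemma fg_lt_total v w : v <> w -> fg_lt v w \/ fg_lt w v.
Proof.
move=> nvw.
have exI : exists I, magnus v I <> magnus w I.
  apply: contrapT => h; apply: nvw; apply: magnus_inj; apply/funext => I.
  by apply: contrapT => ne; apply: h; exists I.
have exn : exists n, `[< exists I, size I = n /\ magnus v I <> magnus w I >].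
  by have [I nI] := exI; exists (size I); apply/asboolP; exists I.
case: (ex_minnP exn) => n /asboolP [I0 [sI0 nI0]] nmin.
have exk : exists k, `[< exists I, [/\ size I = n, pickle I = k & magnus v I <> magnus w I] >].
  by exists (pickle I0); apply/asboolP; exists I0.
case: (ex_minnP exk) => k /asboolP [I [sI pI nI]] kmin.
have bI J : before J I -> magnus v J = magnus w J.
  move=> /orP[lt|/andP[/eqP e lt]]; apply: contrapT => ne.
    have := nmin (size J); rewrite -sI leqNgt lt => h.
    by have : false by apply: h; apply/asboolP; exists J.
  have := kmin (pickle J); rewrite -pI leqNgt lt => h.
  by have : false by apply: h; apply/asboolP; exists J; rewrite e.
case: (ltgtP (magnus v I) (magnus w I)) => // lt; [left|right]; exists I; split=> //.
by move=> J /bI.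
Qed.

Lemma fg_lt_mull u v w : fg_lt v w -> fg_lt (u * v)%g (u * w)%g.
Proof.
move=> [I [lI eI]].
have eI' J : (size J < size I)%N -> magnus v J = magnus w J.
  by move=> lt; apply: eI; rewrite /before lt.
have d J : (size J <= size I)%N ->
    magnus (u * v)%g J - magnus (u * w)%g J = magnus v J - magnus w J.
  by rewrite !magnusM; apply: mulW_lead.
exists I; split; first by rewrite -subr_lt0 d // subr_lt0.
move=> J JI; apply/subr0_eq; rewrite d ?eI ?subrr //.
by move: JI => /orP[/ltnW //|/andP[/eqP->]].
Qed.

Lemma fg_lt_mulr u v w : fg_lt v w -> fg_lt (v * u)%g (w * u)%g.
Proof.
move=> [I [lI eI]].
have eI' J : (size J < size I)%N -> magnus v J = magnus w J.
  by move=> lt; apply: eI; rewrite /before lt.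
have d J : (size J <= size I)%N ->
    magnus (v * u)%g J - magnus (w * u)%g J = magnus v J - magnus w J.
  move=> Jle; rewrite !magnusM [mulW (val v) _]mulW_conv [mulW (val w) _]mulW_conv.
  by rewrite (conv_lead eI') // magnus_nil mulr1.
exists I; split; first by rewrite -subr_lt0 d // subr_lt0.
move=> J JI; apply/subr0_eq; rewrite d ?eI ?subrr //.
by move: JI => /orP[/ltnW //|/andP[/eqP->]].
Qed.

Lemma fg_torsion_free (u : free_group r) n : u <> 1%g -> (0 < n)%N -> (u ^+ n)%g <> 1%g.
Proof.
move=> u1 n0 un.
have pos : forall v : free_group r, fg_lt 1%g v -> (v ^+ n)%g <> 1%g.
  move=> v v1; suff : fg_lt 1%g (v ^+ n)%g by move=> h e; rewrite e in h; apply: fg_lt_irr h.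
  case: (n) n0 => // m _; elim: m => [|m IH]; first by rewrite expg1.
  rewrite expgS; apply: fg_lt_trans v1 _.
  by rewrite -{1}(mulg1 v); apply: fg_lt_mull.
have [//|h|h] := @fg_lt_total 1%g u; first by move=> e; apply: u1.
  exact: pos h un.
apply: (pos u^-1%g).
  by rewrite -(mulVg u) -{2}(mulg1 u^-1%g); apply: fg_lt_mull.
by rewrite expVgn un invg1.
Qed.

End Magnus.

(** * Stackings and adjunction of roots *)

Section ClassMatrix.
Variables (K : fieldType) (n : nat).
Implicit Types e : rel 'I_n.

(** The row space consists of the functions constant on the classes of [e], so two relations can be
    compared through sums and intersections of subspaces. *)
Definition class_mx e : 'M[K]_n := \matrix_(i, j) (e i j)%:R.
Definition reps e := [set i : 'I_n | [forall j : 'I_n, (j < i)%N ==> ~~ e i j]]%SET.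

Definition is_equiv (T : Type) (e : rel T) := [/\ reflexive e, symmetric e & transitive e].

Lemma repsP e (i : 'I_n) : reflect (forall j : 'I_n, (j < i)%N -> ~~ e i j) (i \in reps e).
Proof.
rewrite inE; apply: (iffP forallP) => h j; first exact/implyP.
by apply/implyP; apply: h.
Qed.

Lemma rep_exists e i : is_equiv e -> exists2 j, j \in reps e & e i j.
Proof.
move=> [er es et]; have [j eij jmin] := @arg_minnP _ i (e i) val (er i).
exists j => //; apply/repsP => l lj; apply/negP => ejl.
by have := jmin l (et _ _ _ eij ejl); rewrite leqNgt lj.
Qed.

Lemma reps_inj e i j : is_equiv e -> i \in reps e -> j \in reps e -> e i j -> i = j.
Proof.
move=> [er es et] /repsP hi /repsP hj eij; apply/val_inj.
case: (ltngtP i j) => // lt; first by have := hj i lt; rewrite es eij.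
by have := hi j lt; rewrite eij.
Qed.

Lemma class_mx_sub e (v : 'rV[K]_n) : is_equiv e ->
  (forall i j, e i j -> v 0 i = v 0 j) -> (v <= class_mx e)%MS.
Proof.
move=> ee vc; have [er es et] := ee; apply/submxP.
exists (\row_i if i \in reps e then v 0 i else 0).
apply/rowP => j; rewrite mxE; have [i ri eji] := rep_exists j ee.
rewrite (bigD1 i) //= !mxE ri es eji mulr1 big1 ?addr0; first exact: vc.
move=> l nli; rewrite !mxE; case: ifP => rl; last by rewrite mul0r.
case elj: (e l j); rewrite ?mulr0 //.
by case/eqP: nli; apply: (reps_inj ee) => //; apply: et elj eji.
Qed.

Lemma class_mx_const e (v : 'rV[K]_n) i j : is_equiv e ->
  (v <= class_mx e)%MS -> e i j -> v 0 i = v 0 j.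
Proof.
move=> [er es et] /submxP [w ->] eij; rewrite !mxE; apply: eq_bigr => l _.
rewrite !mxE; congr (_ * _%:R); congr nat_of_bool; apply/idP/idP => h.
  exact: et h eij.
by apply: et h _; rewrite es.
Qed.

Lemma rank_class_mx e : is_equiv e -> \rank (class_mx e) = #|reps e|.
Proof.
move=> ee; have [er es et] := ee; apply/eqP; rewrite eqn_leq; apply/andP; split.
  pose A : 'M[K]_(#|reps e|, n) := rowsub enum_val (class_mx e).
  apply: leq_trans (rank_leq_row A); apply: mxrankS.
  apply/row_subP => i; have [j rj eij] := rep_exists i ee.
  suff -> : row i (class_mx e) = row (enum_rank_in rj j) A by apply: row_sub.
  apply/rowP => l; rewrite !mxE enum_rankK_in //.
  congr (_%:R); congr nat_of_bool; apply/idP/idP => h; last exact: et eij h.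
  by apply: et h; rewrite es.
pose f : 'I_#|reps e| -> 'I_n := enum_val.
have <- : \rank (mxsub f f (class_mx e)) = #|reps e|.
  suff -> : mxsub f f (class_mx e) = 1%:M by rewrite mxrank1.
  apply/matrixP => a b; rewrite !mxE.
  have [->|ne] := eqVneq a b; first by rewrite er.
  case eab: (e _ _) => //; case/eqP: ne; apply: enum_val_inj.
  by apply: (reps_inj ee) eab; apply: enum_valP.
rewrite mxsubrc; apply: leq_trans (mxrankS (rowsub_sub _ _)) _.
have -> : colsub f (class_mx e) = class_mx e *m colsub f 1%:M.
  by rewrite mulmx_colsub mulmx1.
exact: mxrankM_maxl.
Qed.

(** This kernel is the orthogonal complement of the sum of the two spaces of class functions. *)
Lemma kermx_classP e1 e2 (z : 'rV[K]_n) :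
  reflect (forall i, \sum_(j | e1 i j) z 0 j = 0 /\ \sum_(j | e2 i j) z 0 j = 0)
    (z <= kermx (class_mx e1 + class_mx e2)%MS^T)%MS.
Proof.
have sumE e i : (class_mx e *m z^T) i 0 = \sum_(j | e i j) z 0 j.
  rewrite mxE [RHS]big_mkcond; apply: eq_bigr => j _; rewrite !mxE.
  by case: ifP; rewrite ?mul1r ?mul0r.
have zE e : (class_mx e <= kermx z^T)%MS = (class_mx e *m z^T == 0).
  by apply/sub_kermxP/eqP.
have -> : (z <= kermx (class_mx e1 + class_mx e2)%MS^T)%MS
    = (class_mx e1 *m z^T == 0) && (class_mx e2 *m z^T == 0).
  rewrite -!zE -addsmx_sub; apply/sub_kermxP/sub_kermxP => h.
    by apply: trmx_inj; rewrite trmx_mul trmxK h trmx0.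
  by apply: trmx_inj; rewrite trmx_mul trmxK h trmx0.
apply: (iffP andP) => [[/eqP z1 /eqP z2] i|h].
  by rewrite -!sumE z1 z2 !mxE.
by split; apply/eqP/matrixP => i j; rewrite ord1 sumE mxE; case: (h i).
Qed.

End ClassMatrix.

(** * Rank bounds from pivot positions *)

Section Pivots.
Variables (K : fieldType) (n : nat).

(** Projection onto the coordinates in [P] is injective on the row space. *)
Lemma rank_le_pivots m (Z : 'M[K]_(m, n)) (P : {set 'I_n}) :
  (forall z : 'rV_n, (z <= Z)%MS -> z != 0 -> exists2 i, i \in P & z 0 i != 0) ->
  (\rank Z <= #|P|)%N.
Proof.
move=> hP; pose f : 'I_#|P| -> 'I_n := enum_val.
pose C : 'M[K]_(n, #|P|) := colsub f 1%:M.
suff <- : \rank (Z *m C) = \rank Z by apply: rank_leq_col.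
apply/mxrank_injP; rewrite -submx0; apply/row_subP => i.
set z := row i _; have : (z <= Z :&: kermx C)%MS by apply: row_sub.
rewrite sub_capmx => /andP[zZ /sub_kermxP zC]; rewrite submx0.
apply: contraT => z0; have [j jP] := hP z zZ z0.
have := congr1 (fun A : 'rV_ _ => A 0 (enum_rank_in jP j)) zC.
rewrite mulmx_colsub mulmx1 !mxE /f enum_rankK_in // => ->.
by rewrite eqxx.
Qed.

(** The chosen vectors are triangular with respect to [key], hence independent. *)
Lemma rank_ge_pivots m (Z : 'M[K]_(m, n)) (S : {set 'I_n}) (key : 'I_n -> nat) :
    injective key ->
    (forall i, i \in S -> exists2 z : 'rV_n, (z <= Z)%MS &
       z 0 i != 0 /\ forall j, (key i < key j)%N -> z 0 j = 0) ->
  (#|S| <= \rank Z)%N.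
Proof.
move=> keyI hS; pose f : 'I_#|S| -> 'I_n := enum_val.
have /choice [z zP] : forall a : 'I_#|S|, exists z : 'rV_n, (z <= Z)%MS /\
    (z 0 (f a) != 0 /\ forall j, (key (f a) < key j)%N -> z 0 j = 0).
  by move=> a; have [z zZ h] := hS _ (enum_valP a); exists z.
pose A : 'M[K]_(#|S|, n) := \matrix_a z a.
have AZ : (A <= Z)%MS by apply/row_subP => a; rewrite rowK; case: (zP a).
apply: leq_trans (mxrankS AZ).
suff /eqP -> : row_free A by [].
rewrite -kermx_eq0; apply/eqP/row_matrixP => b; rewrite row0.
set v := row b _; have /sub_kermxP vA : (v <= kermx A)%MS by apply: row_sub.
clearbody v.
apply/eqP; apply: contraT => /rV0Pn [a0 va0].
have [a va amax] := @arg_maxnP _ a0 (fun a => v 0 a != 0) (fun a => key (f a)) va0.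
have := congr1 (fun B : 'rV_n => B 0 (f a)) vA; rewrite !mxE (bigD1 a) //= mxE big1.
  rewrite addr0 => /eqP; rewrite mulf_eq0 (negbTE va) /=.
  by case: (zP a) => _ [/negbTE ->].
move=> c nca; rewrite mxE; case: (eqVneq (v 0 c) 0) => [->|vc]; first by rewrite mul0r.
have := amax c vc; rewrite /= /geq /= leq_eqVlt => /predU1P[e|lt].
  by case/eqP: nca; apply: enum_val_inj; apply: keyI.
by have [_ [_ ->]] := zP c; rewrite ?mulr0.
Qed.

End Pivots.

(** * The rank inequality for two stacked quotients of a cycle *)

Section Stacking.
Variables (F : fieldType) (n : nat) (L : eqType) (lab : 'I_n -> L).
Variables (src tgt : 'I_n -> 'I_n) (K R : rel 'I_n) (j0 : 'I_n) (key : 'I_n -> nat).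
(** Step [i] joins position i to its cyclic successor. [K] identifies positions and [Ed] the steps
    accordingly, while [R] serves for both, a step being named by its first position. [key] is a
    height, compared only among ends of steps of one label and monotone along steps away from the
    class of [j0]. *)
Let Ed i j := (lab i == lab j) && K (src i) (src j).
Hypotheses (eK : is_equiv K) (eR : is_equiv R).
Hypothesis src_tgt : forall i,
  (src i = i /\ tgt i = ordS i) \/ (src i = ordS i /\ tgt i = i).
Hypothesis labK : forall i j, lab i = lab j -> K (src i) (src j) = K (tgt i) (tgt j).
Hypothesis R_edge : forall i j, R i j ->
  [/\ lab i = lab j, R (src i) (src j) & R (tgt i) (tgt j)].
Hypothesis R_src : forall i j, lab i = lab j -> R (src i) (src j) -> R i j.
Hypothesis R_tgt : forall i j, lab i = lab j -> R (tgt i) (tgt j) -> R i j.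
Hypothesis EdR : forall i j, Ed i j -> R i j -> i = j.
Hypothesis keyI : injective key.
Hypothesis key_edge : forall i j, ~~ R i j0 -> lab i = lab j ->
  (key (tgt i) < key (tgt j))%N -> (key (src i) < key (src j))%N.
Hypothesis key_low : forall i j, R i j0 -> lab i = lab j -> ~~ R i j ->
  (key (src i) < key (src j))%N.
Hypothesis Ed2 : forall i, exists2 j, j != i & Ed i j.
Hypothesis R2 : forall i, exists2 j, j != i & R i j.

Lemma edge_equiv : is_equiv Ed.
Proof.
have [kr ks kt] := eK; split.
- by move=> i; rewrite /Ed eqxx kr.
- by move=> i j; rewrite /Ed eq_sym ks.
- move=> j i k /andP[/eqP l1 k1] /andP[/eqP l2 k2].
  by rewrite /Ed l1 l2 eqxx; apply: kt k1 k2.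
Qed.

Let ZV := kermx (class_mx F K + class_mx F R)%MS^T.
Let ZE := kermx (class_mx F Ed + class_mx F R)%MS^T.

(** Pivots are the steps that are highest within their label in the support of some vector of
    [ZE]. *)
Let pivot i := exists2 z : 'rV[F]_n, (z <= ZE)%MS & z 0 i != 0 /\
  forall j, lab j = lab i -> (key (src i) < key (src j))%N -> z 0 j = 0.
Let P := [set i : 'I_n | `[< pivot i >]]%SET.

Let src_inj i j : lab i = lab j -> src i = src j -> i = j.
Proof.
have [kr _ _] := eK; have [rr _ _] := eR => lij sij.
by apply: EdR; [rewrite /Ed lij sij eqxx kr|apply: R_src => //; rewrite sij].
Qed.

Let tgt_inj i j : lab i = lab j -> tgt i = tgt j -> i = j.
Proof.
have [kr _ _] := eK; have [rr _ _] := eR => lij tij.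
by apply: EdR; [rewrite /Ed lij labK // tij eqxx kr|apply: R_tgt => //; rewrite tij].
Qed.

Let rank_ZE : (\rank ZE <= #|P|)%N.
Proof.
apply: rank_le_pivots => z zZ /rV0Pn [i zi].
have hi : (lab i == lab i) && (z 0 i != 0) by rewrite eqxx.
have [j /andP[/eqP lj zj] jmax] := @arg_maxnP _ i
  (fun j => (lab j == lab i) && (z 0 j != 0)) (fun j => key (src j)) hi.
exists j => //; rewrite inE; apply/asboolP; exists z => //; split=> // l ll lt.
apply/eqP; apply: contraT => zl.
by have := jmax l; rewrite ll lj eqxx zl /geq /= leqNgt lt => /(_ isT).
Qed.

(** The part of [z] of label [t] is moved from the steps to one of their ends; fixing the label is
    what keeps heights comparable. *)
Let push (phi : 'I_n -> 'I_n) t (z : 'rV[F]_n) : 'rV[F]_n :=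
  \row_j \sum_(e | (lab e == t) && (phi e == j)) z 0 e.

(** The steps of label [t] with the chosen end in a given class are none or form one full class of
    steps, over which [z] sums to zero. *)
Let push_ZV (phi : 'I_n -> 'I_n) t z :
    (forall i j, lab i = lab j -> K (phi i) (phi j) = K (src i) (src j)) ->
    (forall i j, lab i = lab j -> R (phi i) (phi j) = R i j) ->
  (z <= ZE)%MS -> (push phi t z <= ZV)%MS.
Proof.
move=> phiK phiR /kermx_classP zE; apply/kermx_classP => a.
have sumE (Q : rel 'I_n) : \sum_(j | Q a j) push phi t z 0 j
    = \sum_(e | (lab e == t) && Q a (phi e)) z 0 e.
  rewrite [RHS](partition_big phi (Q a)) /=; last by move=> e /andP[].
  apply: eq_bigr => j Qj; rewrite mxE; apply: eq_bigl => e.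
  by case: (phi e =P j) => [->|]; rewrite ?andbF ?andbT // Qj andbT.
have [kr ks kt] := eK; have [rr rs rt] := eR.
split; rewrite sumE.
  case: (pickP (fun e => (lab e == t) && K a (phi e))) => [e0 /andP[/eqP l0 k0]|no].
    have [h0 _] := zE e0; rewrite -[RHS]h0; apply: eq_bigl => e; rewrite /Ed l0 eq_sym.
    case: eqP => //= le; rewrite -(phiK e0 e) ?l0 //; apply/idP/idP => h.
      by apply: kt h; rewrite ks.
    exact: kt k0 h.
  by rewrite big_pred0.
case: (pickP (fun e => (lab e == t) && R a (phi e))) => [e0 /andP[/eqP l0 k0]|no].
  have [_ h0] := zE e0; rewrite -[RHS]h0; apply: eq_bigl => e; case: eqP => /= le.
    rewrite -(phiR e0 e) ?l0 //; apply/idP/idP => h; last exact: rt k0 h.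
    by apply: rt h; rewrite rs.
  by apply/esym/negP => /R_edge [l1 _ _]; apply: le; rewrite -l1.
by rewrite big_pred0.
Qed.

Let push_at (phi : 'I_n -> 'I_n) z i : (forall a b, lab a = lab b -> phi a = phi b -> a = b) ->
  push phi (lab i) z 0 (phi i) = z 0 i.
Proof.
move=> inj; rewrite mxE (big_pred1 i) // => e; apply/andP/eqP => [[/eqP l /eqP p]|->//].
exact: inj.
Qed.

(** The other steps in the [Ed] class of a lowest step lie above it, by [EdR] and [key_low]. A pivot
    vector vanishes on them, so its zero sum over the class would be a single nonzero entry. *)
Let no_low i : R i j0 -> i \notin P.
Proof.
move=> ij0; rewrite inE; apply/negP => /asboolP [z zE [zi zhi]].
have [er es et] := edge_equiv.
have [s0 _] := kermx_classP _ _ _ zE i; move: s0.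
rewrite (bigD1 i) ?er //= big1 ?addr0 => [e|j /andP[eij nji]]; first by rewrite e eqxx in zi.
have [/eqP lij _] := andP eij; apply: zhi => //; apply: key_low => //.
by apply: contra nji => rij; rewrite (EdR eij rij).
Qed.

(** Both ends of a pivot step are highest in the support of a pushed vector; for the target this
    uses [key_edge], available since [no_low] keeps pivots away from [j0]. *)
Let rank_ZV : (#|P :|: (@ordS n) @: P| <= \rank ZV)%N.
Proof.
apply: (rank_ge_pivots keyI) => v hv.
have [i iP iv] : exists2 i, i \in P & v = src i \/ v = tgt i.
  case/setUP: hv => [vP|/imsetP [i iP ->]]; [exists v|exists i] => //.
    by case: (src_tgt v) => -[e1 e2]; [left|right].
  by case: (src_tgt i) => -[e1 e2]; [right|left].
have nlow : ~~ R i j0 by apply: contraL iP; apply: no_low.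
move: iP; rewrite inE => /asboolP [z zE [zi zhi]].
case: iv => ->.
  exists (push src (lab i) z); first by apply: push_ZV => // a b ab; apply/idP/idP;
    [apply: R_src|move=> /R_edge []].
  split=> [|j ij]; first by rewrite push_at //; apply: src_inj.
  rewrite mxE big1 // => e /andP[/eqP le /eqP pe]; apply: zhi => //.
  by rewrite pe.
exists (push tgt (lab i) z).
  apply: push_ZV => // a b ab; first by rewrite labK.
  by apply/idP/idP; [apply: R_tgt|move=> /R_edge []].
split=> [|j ij]; first by rewrite push_at //; apply: tgt_inj.
rewrite mxE big1 // => e /andP[/eqP le /eqP pe]; apply: zhi => //.
by apply: key_edge => //; rewrite pe.
Qed.

Let half (e : rel 'I_n) : is_equiv e -> (forall i, exists2 j, j != i & e i j) ->
  (#|reps e|.*2 <= n)%N.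
Proof.
move=> ee e2; have [er es et] := ee.
have /choice [g gP] : forall i, exists j, j != i /\ e i j.
  by move=> i; have [j] := e2 i; exists j.
have sub : g @: reps e \subset ~: reps e.
  apply/fintype.subsetP => _ /imsetP [i ri ->]; rewrite inE; apply/negP => rg.
  have [ne eg] := gP i; case/eqP: ne; apply/esym; exact: (reps_inj ee) eg.
have := subset_leq_card sub; rewrite card_in_imset; last first.
  move=> i j ri rj gij; apply: (reps_inj ee) => //.
  have [_ e1] := gP i; have [_ e2'] := gP j; apply: et e1 _.
  by rewrite gij es.
have := finset.cardsC (reps e); rewrite card_ord; lia.
Qed.

(** Classes with at least two elements number at most half of [n] for each relation, and the
    constants lie in both spaces; so their sum is not the whole space and [ZE] is nonzero. *)
Let P_nonempty : (0 < #|P|)%N.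
Proof.
have : (0 < \rank ZE)%N.
  rewrite mxrank_ker mxrank_tr subn_gt0.
  have := mxrank_sum_cap (class_mx F Ed) (class_mx F R).
  rewrite !rank_class_mx //; last exact: edge_equiv.
  have c1 : (0 < \rank (class_mx F Ed :&: class_mx F R)%MS)%N.
    rewrite lt0n mxrank_eq0; apply: contraTneq isT => c0.
    have : ((const_mx 1 : 'rV[F]_n) <= class_mx F Ed :&: class_mx F R)%MS.
      by rewrite sub_capmx (class_mx_sub edge_equiv) ?(class_mx_sub eR) // => i j _; rewrite !mxE.
    rewrite c0 submx0 => /eqP/rowP/(_ j0)/eqP; rewrite !mxE.
    by rewrite oner_eq0.
  have := half edge_equiv Ed2; have := half eR R2; lia.
by move=> h; apply: leq_trans h rank_ZE.
Qed.

(** Were the pivots stable under the cyclic successor they would fill the cycle, [j0] included. So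
    the ends of pivot steps outnumber the pivots, and orthogonal complements reverse the
    inequality. *)
Lemma stacking_rank : (\rank (class_mx F K + class_mx F R)%MS
                        < \rank (class_mx F Ed + class_mx F R)%MS)%N.
Proof.
have lt : (#|P| < #|P :|: (@ordS n) @: P|)%N.
  rewrite proper_card // finset.properEneq finset.subsetUl andbT; apply/eqP => e.
  have closed i : i \in P -> ordS i \in P.
    by move=> iP; rewrite e inE imset_f ?orbT.
  have /card_gt0P [i0 i0P] := P_nonempty.
  have iterP m : iter m (@ordS n) i0 \in P by elim: m => //= m IH; apply: closed.
  have [rr _ _] := eR; have := no_low (rr j0); rewrite (_ : j0 = iter (n - i0 + j0) (@ordS n) i0).
    by rewrite iterP.
  have itE m : iter m (@ordS n) i0 = ((i0 + m) %% n)%N :> nat.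
    elim: m => [|m IH]; first by rewrite addn0 modn_small.
    by rewrite /= IH -[((i0 + m) %% n).+1]addn1 modnDml addn1 addnS.
  apply: val_inj; rewrite /= itE addnA subnKC; last exact: ltnW.
  by rewrite modnDl modn_small.
have h : (\rank ZE < \rank ZV)%N by apply: leq_ltn_trans rank_ZE (leq_trans lt rank_ZV).
move: h; rewrite !mxrank_ker !mxrank_tr.
by have := rank_leq_col (class_mx F K + class_mx F R)%MS; lia.
Qed.

End Stacking.

(** * Finite parts of a basis and powers of primitive elements *)

Section BasisHom.
Local Open Scope group_scope.
Variable G : groupType.
Implicit Types (H J B : set G) (b l : seq G).

Lemma sub_basis J B (C : set G) : is_basis J B -> C `<=` B -> is_basis (Defs.generated C) C.
Proof. by move=> [_ free] CB; split=> // s sC; apply: free => x /sC /CB. Qed.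

Section Hom.
Variables (J : set G) (b : seq G).
Hypotheses (ub : uniq b) (bB : is_basis J [set` b]).
Let f (w : free_group (size b)) : G := eval_word (fun i : 'I_(size b) => nth 1 b i) w.

Lemma basis_homM v w : f (v * w) = f v * f w.
Proof. exact: eval_homM. Qed.

Lemma basis_hom_gen i : f (fg_gen i) = nth 1 b i.
Proof. by rewrite /f /= eval_cons eval_nil mulg1. Qed.

Lemma basis_hom_inj : injective f.
Proof.
have f1 : f 1 = 1 by rewrite /f /= eval_nil.
have fV w : f w^-1 = (f w)^-1.
  by apply: (@mulgI _ (f w)); rewrite -basis_homM !mulgV f1.
have ker w : f w = 1 -> w = 1.
  move=> fw; apply: val_inj => /=; apply: contrapT => nw.
  have [_ free] := bB.
  apply: (free [seq (nth 1 b (x : 'I__ * bool).1, x.2) | x <- val w]).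
  - by move=> _ /mapP[[i e] _ ->] /=; apply: mem_nth.
  - rewrite /reduced sorted_map; apply: sub_sorted (fg_reduced w) => x y /=.
    apply: contraNneq => -[/eqP]; rewrite nth_uniq // => /eqP/val_inj e1 e2.
    by rewrite /inv_letter -e1 -e2 -surjective_pairing.
  - by move: nw; rewrite /=; case: (fg_word w).
  - by rewrite /eval_word big_map; exact: fw.
move=> v w fvw; rewrite -(mulKVg v w) (ker (v^-1 * w)) ?mulg1 //.
by rewrite basis_homM fV fvw mulVg.
Qed.

Lemma basis_hom_surj : f @` setT = J.
Proof.
have [gB _] := bB; have sJ : is_subgroup J by rewrite -gB; apply: gen_subgroup.
rewrite eqEsubset; split.
  move=> _ [w _ <-]; rewrite /f.
  have [||||//] := @eval_morph _ G G (fun i : 'I_(size b) => nth 1 b i) id J w (sgp1 sJ).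
  - by move=> x _; rewrite -gB; apply: sub_gen; apply: mem_nth.
  - by move=> x y; apply: (sgpM sJ).
  - by move=> x; apply: (sgpV sJ).
  - by [].
rewrite -gB; apply: gen_sub.
  split; first by exists 1 => //; rewrite /f /= eval_nil.
    by move=> _ _ [v _ <-] [w _ <-]; exists (v * w) => //; rewrite basis_homM.
  move=> _ [v _ <-]; exists v^-1 => //; apply: (@mulgI _ (f v)).
  by rewrite -basis_homM !mulgV /f /= eval_nil.
move=> g /= gb; have ig : (index g b < size b)%N by rewrite index_mem.
by exists (fg_gen (Ordinal ig)) => //; rewrite basis_hom_gen /= nth_index.
Qed.

End Hom.

(** [B] may be infinite, but finitely many words involve finitely many of its elements. *)
Lemma finite_support J B l : is_basis J B -> (forall g, g \in l -> J g) ->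
  exists b, [/\ uniq b, forall g, g \in b -> B g &
    forall g, g \in l -> Defs.generated [set` b] g].
Proof.
move=> bB; elim: l => [|g l IH] lJ; first by exists [::].
have [|b [ub bsub bl]] := IH; first by move=> h hl; apply: lJ; rewrite inE hl orbT.
have : Defs.generated B g by have [-> _] := bB; apply: lJ; rewrite mem_head.
move=> /gen_word [s [rs sB sg]].
exists (undup ([seq x.1 | x <- s] ++ b)); rewrite undup_uniq; split=> //.
  by move=> h; rewrite mem_undup mem_cat => /orP[/mapP[x /sB xB ->]|/bsub].
move=> h; rewrite inE => /predU1P[->|/bl].
  rewrite -sg; apply: gen_eval => x xs /=.
  by rewrite mem_undup mem_cat map_f.
by apply: gen_mono => x /= xb; apply: sub_gen; rewrite /= mem_undup mem_cat xb orbT.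
Qed.

(** A finite part of the basis that contains [u] and expresses [l] spans a free group with [u] as a
    generator, where [gen_power_primitive] applies. *)
Lemma primitive_power_sub J H u k l : primitive_in J u -> is_subgroup H -> H `<=` J ->
    H = Defs.generated [set` l] -> (0 < k)%N -> H (u ^+ k) ->
    (forall j, (0 < j < k)%N -> ~ H (u ^+ j)) -> primitive_in H (u ^+ k).
Proof.
move=> [B bB Bu] sH HJ Hl k0 Huk Hmin.
have [gB _] := bB.
have [|b0 [_ b0sub b0l]] := @finite_support J B l bB.
  by move=> g gl; apply: HJ; rewrite Hl; apply: sub_gen.
pose b := undup (u :: b0); have ub : uniq b by apply: undup_uniq.
have ub' : u \in b by rewrite mem_undup mem_head.
have bl g : g \in l -> Defs.generated [set` b] g.
  move=> /b0l; apply: gen_mono => x /= xb; apply: sub_gen.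
  by rewrite /= mem_undup inE xb orbT.
have bb : is_basis (Defs.generated [set` b]) [set` b].
  apply: sub_basis bB _ => x /=; rewrite mem_undup inE => /predU1P[->//|].
  exact: b0sub.
pose f (w : free_group (size b)) : G := eval_word (fun i : 'I_(size b) => nth 1 b i) w.
have fM v w : f (v * w) = f v * f w by apply: basis_homM.
have finj : injective f := basis_hom_inj ub bb.
have f1 : f 1 = 1 by rewrite /f /= eval_nil.
have fV w : f w^-1 = (f w)^-1.
  by apply: (@mulgI _ (f w)); rewrite -fM !mulgV f1.
have fX w m : f (w ^+ m) = f w ^+ m by apply: eval_homX.
have fsurj g : Defs.generated [set` b] g -> exists w, f w = g.
  by rewrite -(basis_hom_surj bb) => -[w _ <-]; exists w.
have ui : (index u b < size b)%N by rewrite index_mem.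
pose i := Ordinal ui; have fi : f (fg_gen i) = u by rewrite /f basis_hom_gen nth_index.
pose H' := f @^-1` H.
have sH' : is_subgroup H'.
  split; first by rewrite /H' /= f1; apply: sgp1.
  - by move=> x y; rewrite /H' /= fM; apply: sgpM.
  - by move=> x; rewrite /H' /= fV; apply: sgpV.
have /choice [h hP] : forall g, exists w, g \in l -> f w = g.
  move=> g; have [gl|ngl] := boolP (g \in l); last by exists 1.
  by have [w fw] := fsurj g (bl g gl); exists w.
have HfH g : H g -> exists2 w, Defs.generated [set` map h l] w & f w = g.
  have sM := gen_subgroup [set` map h l].
  rewrite Hl; move: g; apply: gen_sub.
    split; first by exists 1 => //; apply: (sgp1 sM).
      move=> x y [v Mv <-] [w Mw <-]; exists (v * w); rewrite ?fM //.
      exact: (sgpM sM).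
    by move=> x [v Mv <-]; exists v^-1; rewrite ?fV //; apply: (sgpV sM).
  move=> g /= gl; exists (h g); last exact: hP.
  by apply: sub_gen; apply: map_f.
have H'gen : H' = Defs.generated [set` map h l].
  rewrite eqEsubset; split.
    by move=> w Hw; have [w' Mw' /finj <-] := HfH _ Hw.
  apply: gen_sub => // _ /mapP[g gl ->]; rewrite /H' /= hP // Hl.
  exact: sub_gen.
have HH' j : H' (fg_gen i ^+ j) = H (u ^+ j) by rewrite /H' /= fX fi.
have [|j /Hmin|B' bB' Bi] := gen_power_primitive (i, false) sH' H'gen k0 (i := i).
- by rewrite HH'.
- by rewrite HH'.
exists (f @` B'); last by exists (fg_gen i ^+ k) => //; rewrite fX fi.
suff <- : f @` H' = H.
  by apply: basis_transport => // x y _ _ /finj.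
rewrite eqEsubset; split; first by move=> _ [w Hw <-].
move=> g Hg; have [w _ fw] := HfH g Hg; exists w => //.
by rewrite /H' /= fw.
Qed.

Lemma basis_conj H B g : is_subgroup H -> is_basis H B ->
  is_basis ((fun x => x ^ g) @` H) ((fun x => x ^ g) @` B).
Proof.
move=> sH; apply: basis_transport => // [x y _ _|x y _ _]; first exact: conjMg.
exact: conjg_inj.
Qed.

End BasisHom.

(** * Periods and cyclic reduction of words *)

Section Rotation.
Variable T : choiceType.
Implicit Types s v : seq T.

Lemma nth_flatten_nseq (x0 : T) v q a : (a < q * size v)%N ->
  nth x0 (flatten (nseq q v)) a = nth x0 v (a %% size v).
Proof.
elim: q a => [//|q IH] a; rewrite mulSn /= nth_cat => alt.
case: ltnP => [lt|ge]; first by rewrite modn_small.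
by rewrite IH ?ltn_subLR // -{2}(subnK ge) modnDr.
Qed.

Lemma size_flatten_nseq v q : size (flatten (nseq q v)) = (q * size v)%N.
Proof. by rewrite size_flatten /shape map_nseq sumn_nseq mulnC. Qed.

(** The cyclic word has periods j - i and [size s], hence by Bezout also their gcd, a proper divisor
    of the length. *)
Lemma rot_eq_power s i j : (i < j < size s)%N -> rot i s = rot j s ->
  exists v q, (2 <= q)%N /\ s = flatten (nseq q v).
Proof.
case: s => [|x0 s']; first by rewrite ltn0 andbF.
set s := x0 :: s' => /andP[ij jl] e; set l := size s in jl *.
have l0 : (0 < l)%N by [].
pose f a := nth x0 s (a %% l).
have frot m a : (m < l)%N -> (a < l)%N -> nth x0 (rot m s) a = f (a + m)%N.
  move=> ml al; rewrite /rot nth_cat size_drop nth_drop /f -/l.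
  case: ltnP => h; first by rewrite modn_small addnC //; lia.
  rewrite nth_take; last by lia.
  have -> : (a + m = (a - (l - m)) + l)%N by lia.
  by rewrite modnDr modn_small //; lia.
pose m := (j - i)%N.
have fm a : f (a + m)%N = f a.
  have fmod b : f (b %% l)%N = f b by rewrite /f modn_mod.
  pose b := ((a + (l - i)) %% l)%N; have bl : (b < l)%N by rewrite ltn_mod.
  have il : (i < l)%N by apply: ltn_trans ij jl.
  have := congr1 (fun t => nth x0 t b) e; rewrite !frot //.
  have mods c : f (b + c)%N = f (a + (l - i) + c)%N.
    by rewrite -[in RHS]fmod -modnDml fmod.
  rewrite !mods -addnA subnK 1?ltnW // -addnA.
  have -> : (l - i + j = m + l)%N by rewrite /m; lia.
  by rewrite addnA /f !modnDr.
have fx x a : f (a + x * m)%N = f a.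
  by elim: x => [|x IH]; rewrite ?addn0 // mulSn addnCA addnC fm.
pose g := gcdn m l.
have m0 : (0 < m)%N by rewrite subn_gt0.
have fg a : f (a + g)%N = f a.
  have [x y exy _] := egcdnP l m0.
  rewrite -/g in exy.
  have -> : f (a + g)%N = f (a + g + y * l)%N.
    by rewrite /f [in RHS]addnC modnMDl.
  by rewrite -addnA [(g + _)%N]addnC -exy fx.
have fgx x a : f (a + x * g)%N = f a.
  by elim: x => [|x IH]; rewrite ?addn0 // mulSn addnCA addnC fg.
have gl : (g %| l)%N by apply: dvdn_gcdr.
have gm : (g <= m)%N by apply: dvdn_leq; rewrite ?dvdn_gcdl.
have g0 : (0 < g)%N by rewrite gcdn_gt0 m0.
have ql : (l %/ g * g = l)%N by rewrite divnK.
exists (take g s), (l %/ g)%N; split.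
  have : (g < l)%N by apply: leq_ltn_trans gm _; rewrite /m; lia.
  by rewrite -{1}ql -{1}[g]mul1n ltn_pmul2r.
have szg : size (take g s) = g.
  by rewrite size_takel // -/l; apply: dvdn_leq.
apply: (@eq_from_nth _ x0); first by rewrite size_flatten_nseq szg ql.
move=> a al; rewrite nth_flatten_nseq szg ?ql // nth_take ?ltn_mod //.
have -> : nth x0 s a = f a by rewrite /f modn_small.
rewrite {1}(divn_eq a g) addnC fgx /f modn_small //.
by apply: leq_trans (ltn_pmod a g0) _; apply: dvdn_leq.
Qed.

End Rotation.

Section CyclicReduction.
Local Open Scope group_scope.
Variable r : nat.
Let F := free_group r.

Lemma reduced_cat1 (s t : seq ('I_r * bool)) : reduced (s ++ t) -> reduced s.
Proof. by rewrite /reduced; case: s => //= x s; rewrite cat_path => /andP[]. Qed.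

Lemma reduced_cat2 (s t : seq ('I_r * bool)) : reduced (s ++ t) -> reduced t.
Proof.
by elim: s => //= x s IH; rewrite /reduced => /path_sorted.
Qed.

(** Cancelling letters at the two ends are stripped by conjugation; reducedness of the doubled word
    says that none are left. *)
Lemma cyclic_reduction (u : F) : u <> 1 ->
  exists g c : F, [/\ u = c ^ g, c <> 1 & reduced (val c ++ val c)].
Proof.
have [n] := ubnP (size (val u)); elim: n u => // n IH u; rewrite ltnS => le u1.
have [red|nred] := boolP (reduced (val u ++ val u)).
  by exists 1, u; rewrite conjg1.
case us : (val u) nred le => [|x s] nred le; first by [].
have red : reduced (x :: s) by rewrite -us; apply: fg_reduced.
have ex : x = inv_letter (last x s).
  apply/eqP; apply: contraNT nred => nx.
  move: red; rewrite /reduced /= cat_path /= => ->.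
  by rewrite nx.
case/lastP: s us nred le red ex => [|s y] us nred le red.
  by rewrite /= => /esym/eqP; case: (x) => a []; rewrite xpair_eqE andbF.
rewrite last_rcons => ex.
have reds : reduced s.
  by have := reduced_behead red; rewrite -cats1; apply: reduced_cat1.
pose v : F := FreeGroup reds.
pose a : F := letter_value (@fg_gen r) x.
have uE : u = v ^ (a^-1).
  rewrite -(eval_val u) us eval_cons eval_rcons /conjg invgK -/a.
  rewrite -[eval_word _ s]/(eval_word _ (val v)) eval_val.
  by congr (_ * (_ * _)); rewrite /a ex letter_valueV invgK.
have [||g [c [vc c1 cc]]] := IH v.
- by move: le; rewrite /= size_rcons; lia.
- by move=> v1; apply: u1; rewrite uE v1 conj1g.
by exists (g * a^-1), c; rewrite uE vc conjgM.
Qed.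

End CyclicReduction.

Lemma count_iota_card n (p : pred nat) : #|[set i : 'I_n | p i]%SET| = count p (iota 0 n).
Proof.
rewrite -sum1_card (eq_bigl (fun i : 'I_n => p i)) => [|i]; last by rewrite inE.
by rewrite -(big_mkord p (fun=> 1%N)) /index_iota subn0 sum1_count.
Qed.

(** The key is the number of predecessors. *)
Lemma strict_order_key (T : finType) (lt : rel T) :
    irreflexive lt -> transitive lt ->
  exists key : T -> nat, forall x y, lt x y -> (key x < key y)%N.
Proof.
move=> irr tr; exists (fun x => #|[set z | lt z x]%SET|) => x y xy.
apply: proper_card; apply/properP; split; last by exists x; rewrite !inE ?xy ?irr.
by apply/fintype.subsetP => z; rewrite !inE => zx; apply: tr zx xy.
Qed.

Section PeriodicWalk.
Local Open Scope group_scope.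
Variables (r : nat) (x0 : 'I_r * bool) (c : seq ('I_r * bool)).
Let F := free_group r.
Let l := size c.
Let u : F := eval_word (@fg_gen r) c.
Definition power_word k := flatten (nseq k c).

Lemma power_wordD a b : power_word (a + b) = power_word a ++ power_word b.
Proof. by rewrite /power_word nseqD flatten_cat. Qed.

Lemma size_power_word k : size (power_word k) = (k * l)%N.
Proof. exact: size_flatten_nseq. Qed.

Lemma eval_power_word k : eval_word (@fg_gen r) (power_word k) = u ^+ k.
Proof. by elim: k => [|k IH]; rewrite ?eval_nil // eval_cat IH expgS. Qed.

Lemma pfx_power k q a : (q * l + a <= k * l)%N ->
  pfx (power_word k) (q * l + a) = u ^+ q * pfx (power_word k) a.
Proof.
move=> le; have [l0|l0] := posnP l.
  have c0 : c = [::] by apply/eqP; rewrite -size_eq0 -/l l0.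
  have -> : power_word k = [::] by rewrite /power_word c0; elim: (k).
  by rewrite /pfx /u c0 /= eval_nil expg1n mul1g.
have qk : (q <= k)%N by rewrite -(leq_pmul2r l0); apply: leq_trans le; apply: leq_addr.
have e1 : power_word k = power_word q ++ power_word (k - q).
  by rewrite -power_wordD subnKC.
have e2 : power_word k = power_word (k - q) ++ power_word q.
  by rewrite -power_wordD subnK.
rewrite {1}e1 -(size_power_word q) pfx_catr eval_power_word e2 pfx_cat //.
by rewrite size_power_word mulnBl; lia.
Qed.

Lemma nth_power k i : (i < k * l)%N -> nth x0 (power_word k) i = nth x0 c (i %% l).
Proof. exact: nth_flatten_nseq. Qed.

End PeriodicWalk.

(** * Adjoining a root, for a cyclically reduced root *)

Section RootDrop.
Local Open Scope group_scope.
Variables (r : nat) (x0 : 'I_r * bool) (c : seq ('I_r * bool)) (k : nat).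
Let F := free_group r.
Let l := size c.
Let u : F := eval_word (@fg_gen r) c.
Let s := power_word c k.
Let n := (k * l)%N.
Variable H : set F.
Hypotheses (c0 : c != [::]) (cyc : reduced (c ++ c)) (npu : non_power u).
Hypotheses (k2 : (2 <= k)%N) (sH : is_subgroup H) (HE : walk_group H s = H).
Hypotheses (Huk : H (u ^+ k)) (Hmin : forall j, (0 < j < k)%N -> ~ H (u ^+ j)).
Hypothesis nprim : ~ primitive_in H (u ^+ k).

Let l_gt0 : (0 < l)%N. Proof. by rewrite lt0n size_eq0. Qed.
Let n_gt0 : (0 < n)%N. Proof. by rewrite muln_gt0 l_gt0; lia. Qed.
Let sz : size s = n. Proof. exact: size_power_word. Qed.
Let ev_s : eval_word (@fg_gen r) s = u ^+ k. Proof. exact: eval_power_word. Qed.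
Let ln : (l %| n)%N. Proof. exact: dvdn_mull. Qed.

Let pfx_n : pfx s n = u ^+ k. Proof. by rewrite -ev_s /pfx -sz take_size. Qed.

Let pfx_split a : (a <= n)%N -> pfx s a = u ^+ (a %/ l) * pfx s (a %% l).
Proof. by move=> an; rewrite {1}(divn_eq a l) pfx_power // -divn_eq. Qed.

(** Positions are read modulo [n], position n being position 0 because the k-th power of [u] is in
    [H]. [K] maps the cycle to the graph of [H], and [R] wraps it k times around the cycle that
    reads [u]. *)
Let dir i := (nth x0 s i).2.
Let sr (i : 'I_n) : 'I_n := if dir i then ordS i else i.
Let tg (i : 'I_n) : 'I_n := if dir i then i else ordS i.
Let K (i j : 'I_n) := pos_rel H s i j.
Let R (i j : 'I_n) := (i %% l == j %% l)%N.
Let lb (i : 'I_n) := lab x0 s i.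

Let dir_mod i : (i < n)%N -> dir i = (nth x0 c (i %% l)).2.
Proof. by move=> lt; rewrite /dir nth_power. Qed.
Let lab_mod i : (i < n)%N -> lab x0 s i = (nth x0 c (i %% l)).1.
Proof. by move=> lt; rewrite /lab nth_power. Qed.

Let equivK : is_equiv K.
Proof.
split=> [i|i j|j i m]; first exact: pos_refl.
- exact: pos_sym.
- exact: pos_trans.
Qed.

Let equivR : is_equiv R.
Proof.
split=> [i|i j|j i m]; first exact: eqxx.
- exact: eq_sym.
- by rewrite /R => /eqP ->.
Qed.

Let pos_mod a b : (a <= n)%N -> (b <= n)%N -> pos_rel H s (a %% n) (b %% n) = pos_rel H s a b.
Proof.
have md d : (d <= n)%N -> pos_rel H s (d %% n) d.
  rewrite leq_eqVlt => /predU1P[->|dn]; last by rewrite modn_small // pos_refl.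
  rewrite modnn; apply/asboolP; rewrite pfx0 mul1g pfx_n; exact: sgpV.
move=> an bn; apply/idP/idP => h.
  by apply: (pos_trans sH) (md b bn); apply: (pos_trans sH) h; rewrite pos_sym // md.
by apply: (pos_trans sH) (md a an) _; apply: (pos_trans sH) h _; rewrite pos_sym // md.
Qed.

Let srE i : sr i = (src x0 s i %% n)%N :> nat.
Proof. by rewrite /sr /src /dir; case: ifP => // _; rewrite modn_small. Qed.
Let tgE i : tg i = (tgt x0 s i %% n)%N :> nat.
Proof. by rewrite /tg /tgt /dir; case: ifP => // _; rewrite modn_small. Qed.
Let src_n i : (i < n)%N -> (src x0 s i <= n)%N.
Proof. by rewrite -sz; apply: src_le. Qed.
Let tgt_n i : (i < n)%N -> (tgt x0 s i <= n)%N.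
Proof. by rewrite -sz; apply: tgt_le. Qed.

Let Ksr i j : K (sr i) (sr j) = pos_rel H s (src x0 s i) (src x0 s j).
Proof. by rewrite /K !srE pos_mod ?src_n. Qed.
Let Ktg i j : K (tg i) (tg j) = pos_rel H s (tgt x0 s i) (tgt x0 s j).
Proof. by rewrite /K !tgE pos_mod ?tgt_n. Qed.

Let Ed i j := (lb i == lb j) && K (sr i) (sr j).
Let EdE i j : Ed i j = edge_rel x0 H s i j.
Proof. by rewrite /Ed Ksr. Qed.

Let labK i j : lb i = lb j -> K (sr i) (sr j) = K (tg i) (tg j).
Proof. by move=> e; rewrite Ksr Ktg edge_tgt // sz. Qed.

Let sr_tg i : (sr i = i /\ tg i = ordS i) \/ (sr i = ordS i /\ tg i = i).
Proof. by rewrite /sr /tg; case: ifP; [right|left]. Qed.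

Let R_ordS i j : R (ordS i) (ordS j) = R i j.
Proof.
rewrite /R /= !modn_dvdm // -(addn1 i) -(addn1 j).
by rewrite eqn_modDr.
Qed.

Let R_dir i j : R i j -> dir i = dir j.
Proof. by move=> /eqP e; rewrite !dir_mod // e. Qed.

Let R_edge i j : R i j -> [/\ lb i = lb j, R (sr i) (sr j) & R (tg i) (tg j)].
Proof.
move=> rij; have d := R_dir rij; split.
- by rewrite /lb !lab_mod // (eqP rij).
- by rewrite /sr d; case: ifP => _; rewrite ?R_ordS.
- by rewrite /tg d; case: ifP => _; rewrite ?R_ordS.
Qed.

Let cyc_adj a b : (b %% l = a.+1 %% l)%N -> nth x0 c (b %% l) != inv_letter (nth x0 c (a %% l)).
Proof.
move=> ->; have lt : ((a %% l).+1 < size (c ++ c))%N.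
  by rewrite size_cat -/l; have := ltn_pmod a l_gt0; lia.
have /(sortedP x0)/(_ _ lt) := cyc.
have nthcc d : (d <= l)%N -> nth x0 (c ++ c) d = nth x0 c (d %% l).
  rewrite nth_cat -/l leq_eqVlt => /predU1P[->|dl]; last by rewrite dl modn_small.
  by rewrite ltnn subnn modnn.
rewrite !nthcc ?ltn_pmod //; last by rewrite ltnW ?ltn_pmod.
by rewrite modn_mod -[(a %% l).+1]addn1 modnDml addn1.
Qed.

(** Two opposite steps of one label at neighbouring residues would be a cancellation in the cyclic
    word. *)
Let no_fold i j : lb i = lb j -> dir i = ~~ dir j -> R i (ordS j) -> False.
Proof.
rewrite /lb /R /= modn_dvdm // !lab_mod // !dir_mod // => e1 e2 /eqP e.
have /negP := cyc_adj e; apply; rewrite /inv_letter -e1 -e2.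
by rewrite -surjective_pairing.
Qed.

Let R_src i j : lb i = lb j -> R (sr i) (sr j) -> R i j.
Proof.
have [_ rs _] := equivR.
move=> e; rewrite /sr; case di: (dir i); case dj: (dir j); rewrite ?R_ordS //.
- by rewrite rs => /no_fold; rewrite di dj e => /(_ erefl erefl).
- by move=> /no_fold; rewrite di dj e => /(_ erefl erefl).
Qed.

Let R_tgt i j : lb i = lb j -> R (tg i) (tg j) -> R i j.
Proof.
have [_ rs _] := equivR.
move=> e; rewrite /tg; case di: (dir i); case dj: (dir j); rewrite ?R_ordS //.
- by move=> /no_fold; rewrite di dj e => /(_ erefl erefl).
- by rewrite rs => /no_fold; rewrite di dj e => /(_ erefl erefl).
Qed.

(** Positions with equal residue differ by a power of [u] with exponent below [k], which by
    minimality lies in [H] only when trivial. *)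
Let K_R (i j : 'I_n) : R i j -> K i j -> i = j.
Proof.
wlog ba : i j / (j <= i)%N => [hw rij kij|].
  case: (leqP j i) => [/hw|/ltnW /hw] hw'; first exact: hw'.
  have [_ rs _] := equivR; have [_ ks _] := equivK.
  by apply/esym/hw'; rewrite 1?rs 1?ks.
move=> /eqP e /asboolP; rewrite (pfx_split (ltnW (ltn_ord i))) (pfx_split (ltnW (ltn_ord j))).
rewrite e invgM mulgA mulgK -expgnFr ?leq_div2r // => h; apply: val_inj.
have ik : (i %/ l < k)%N by rewrite ltn_divLR.
rewrite [LHS]/= (divn_eq i l) e [RHS]/= {2}(divn_eq j l); congr (_ * _ + _)%N.
have [|q0] := posnP (i %/ l - j %/ l)%N; first by have := leq_div2r l ba; lia.
case: (@Hmin (i %/ l - j %/ l)%N _ h); rewrite q0 /=; apply: leq_ltn_trans ik; exact: leq_subr.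
Qed.

Let EdR i j : Ed i j -> R i j -> i = j.
Proof.
move=> /andP[/eqP lij kij] rij; apply: K_R => //; move: kij.
have d := R_dir rij.
case di: (dir i); last by rewrite /sr -d di.
by rewrite labK // /tg -d di.
Qed.

(** An edge crossed only once would make the k-th power of [u] primitive in [H]. *)
Let Ed2 i : exists2 j, j != i & Ed i j.
Proof.
apply: contrapT => h; apply: nprim; rewrite -ev_s.
apply: (edge_once_primitive sH HE _ (q := i)); rewrite ?ev_s ?sz //.
move=> j jn ne; apply/negP => eij; apply: h.
exists (Ordinal jn); first exact: ne.
by rewrite EdE; exact: eij.
Qed.

Let R2 i : exists2 j, j != i & R i j.
Proof.
have ln2 : (l + l <= n)%N by rewrite addnn -mul2n leq_mul2r k2 orbT.
have jn : ((i + l) %% n < n)%N by rewrite ltn_mod.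
exists (Ordinal jn); last by rewrite /R /= modn_dvdm // modnDr.
rewrite -val_eqE /=; have [lt|ge] := ltnP (i + l) n.
  by rewrite modn_small //; lia.
have -> : (i + l = (i + l - n) + n)%N by rewrite subnK.
rewrite modnDr modn_small; have := ltn_ord i; lia.
Qed.

(** Heights are the cyclic conjugates of [u]. Crossing an edge conjugates them by its generator, an
    operation that preserves the bi-invariant order. *)
Let ht (i : nat) : F := (pfx s i)^-1 * u * pfx s i.

Let ht_mod i : (i <= n)%N -> ht i = ht (i %% l).
Proof.
move=> le; rewrite /ht (pfx_split le) invgM !mulgA; congr (_ * _).
rewrite -!mulgA; congr (_ * _).
apply: (@mulgI _ (u ^+ (i %/ l))); rewrite mulVKg -expgS -expgSr //.
Qed.

Let ht_R (i j : 'I_n) : R i j -> ht i = ht j.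
Proof. by move=> /eqP e; rewrite !(ht_mod (ltnW (ltn_ord _))) e. Qed.

Let ht_edge i : ht (tg i) = (fg_gen (lb i))^-1 * ht (sr i) * fg_gen (lb i).
Proof.
have ht_n a : (a <= n)%N -> ht (a %% n) = ht a.
  move=> an; rewrite (ht_mod (ltnW (ltn_pmod a n_gt0))) modn_dvdm // -ht_mod //.
rewrite srE tgE !ht_n ?src_n ?tgt_n // /ht (pfx_edge x0) ?sz //.
by rewrite invgM !mulgA.
Qed.

Let ht_val (i : nat) : (i < l)%N -> val (ht i) = rot i c.
Proof.
move=> il; have cE : take i s = take i c.
  have -> : s = c ++ power_word c k.-1.
    by rewrite /s -{1}(prednK (ltnW k2)).
  by rewrite takel_cat // ltnW.
have -> : ht i = eval_word (@fg_gen r) (rot i c).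
  rewrite /ht /pfx cE /rot eval_cat; congr (_ * _).
  by rewrite /u -{2}(cat_take_drop i c) eval_cat mulKg.
rewrite val_eval //; have cc : c ++ c = take i c ++ (rot i c ++ drop i c).
  by rewrite /rot !catA cat_take_drop -catA cat_take_drop.
by move: cyc; rewrite cc => /reduced_cat2 /reduced_cat1.
Qed.

(** Equal conjugates are equal rotations of the cyclically reduced word, and those exist only for a
    proper power. *)
Let ht_inj (i j : 'I_n) : ht i = ht j -> R i j.
Proof.
rewrite !(ht_mod (ltnW (ltn_ord _))) => /(congr1 val).
rewrite !ht_val ?ltn_mod // /R.
have nopow a b : (a < b < l)%N -> rot a c = rot b c -> False.
  move=> ab e; have [v [q [q2 cv]]] := rot_eq_power ab e.
  apply: npu; exists (eval_word (@fg_gen r) v), q; split=> //.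
  by rewrite /u cv -/(power_word v q) eval_power_word.
case: (ltngtP (i %% l)%N (j %% l)%N) => // lt e.
  by case: (nopow _ _ _ e); rewrite lt ltn_mod.
by case: (nopow _ _ _ (esym e)); rewrite lt ltn_mod.
Qed.

Let hlt (i j : 'I_n) := `[< fg_lt (ht i) (ht j) >].
Let hlt_irr : irreflexive hlt.
Proof. by move=> i; apply/asboolP; apply: fg_lt_irr. Qed.
Let hlt_trans : transitive hlt.
Proof. by move=> j i m /asboolP h1 /asboolP h2; apply/asboolP; apply: fg_lt_trans h1 h2. Qed.

Let hlt_total i j : ~~ R i j -> hlt i j || hlt j i.
Proof.
move=> nr; have [e|h|h] := @fg_lt_total _ (ht i) (ht j).
- by move: nr; rewrite ht_inj.
- by apply/orP; left; apply/asboolP.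
- by apply/orP; right; apply/asboolP.
Qed.

Let hlt_edge i j : lb i = lb j -> hlt (tg i) (tg j) -> hlt (sr i) (sr j).
Proof.
move=> e /asboolP; rewrite !ht_edge e => h; apply/asboolP.
have := fg_lt_mull (fg_gen (lb j)) (fg_lt_mulr (fg_gen (lb j))^-1 h).
by rewrite !mulgA !mulgK !mulgV !mul1g.
Qed.

Let hlt_Rl i i' j : R i i' -> hlt i j = hlt i' j.
Proof. by move=> rii; rewrite /hlt (ht_R rii). Qed.
(** Heights order positions with distinct residues; the k positions over one residue are separated
    by numbering the sheets of the k-fold cover, which needs a cut. *)
Lemma stacked_rank : (\rank (class_mx 'F_2 K + class_mx 'F_2 R)%MS
                        < \rank (class_mx 'F_2 Ed + class_mx 'F_2 R)%MS)%N.
Proof.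
have [hkey hkeyP] := strict_order_key hlt_irr hlt_trans.
pose i0 := Ordinal n_gt0.
(* The cut is made at a lowest step among those with the label of step 0, so that the sheets are
   never compared across it. *)
have [j0 /eqP lj0 j0min] := @arg_minnP _ i0 (fun j => lb j == lb i0) (fun j => hkey (sr j)) (eqxx _).
have low j : lb j = lb j0 -> ~~ R j0 j -> hlt (sr j0) (sr j).
  move=> lj nr; have /hlt_total : ~~ R (sr j0) (sr j).
    by apply: contra nr => /R_src; apply.
  case/orP => // /hkeyP; rewrite ltnNge j0min //.
  by rewrite lj lj0.
(* Positions are shifted so that counting begins just after [j0]; the sheet number [lift] then
   changes only across steps over the class of [j0]. *)
pose C := (n - j0.+1)%N.
pose lift (i : 'I_n) := (((i + C) %% n) %/ l)%N.
have lift_inj i j : R i j -> lift i = lift j -> i = j.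
  move=> /eqP rij e; have : ((i + C) %% n = (j + C) %% n)%N.
    rewrite (divn_eq ((i + C) %% n) l) (divn_eq ((j + C) %% n) l) -/(lift i) -/(lift j) e.
    by congr (_ + _)%N; rewrite !modn_dvdm // -modnDml rij modnDml.
  move/eqP; rewrite eqn_modDr !modn_small // => /eqP; exact: val_inj.
have lift_ordS i : ~~ R i j0 -> lift (ordS i) = lift i.
  move=> nr; rewrite /lift /= modnDml addSn.
  set w := ((i + C) %% n)%N; have wn : (w < n)%N by rewrite ltn_mod.
  have -> : ((i + C).+1 %% n = w.+1 %% n)%N by rewrite /w -[(_ %% n).+1]addn1 modnDml addn1.
  have wl : (w %% l).+1 <> l.
    move=> e; case/negP: nr; rewrite /R.
    have : ((i + C).+1 = 0 %[mod l])%N.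
      rewrite -[(i + C).+1]addn1 -modnDml -(modn_dvdm (i + C) ln) -/w addn1 e modnn mod0n.
      by [].
    move=> e2; have : (i + n = j0 %[mod l])%N.
      have -> : (i + n = (i + C).+1 + j0)%N by rewrite /C; have := ltn_ord j0; lia.
      by rewrite -modnDml e2 mod0n.
    by move=> e3; apply/eqP; rewrite -e3 -modnDmr (eqP ln) addn0.
  have wd : (w.+1 %/ l = w %/ l)%N.
    have := ltn_pmod w l_gt0; rewrite leq_eqVlt => /predU1P[//|lt].
    have e : (w.+1 = w %/ l * l + (w %% l).+1)%N by rewrite addnS -divn_eq.
    by rewrite e divnMDl // (divn_small lt) addn0.
  suff w1 : (w.+1 < n)%N by rewrite modn_small.
  rewrite ltn_neqAle wn andbT; apply/eqP => e; apply: wl.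
  have : (w.+1 %% l = 0)%N by rewrite e (eqP ln).
  have := ltn_pmod w l_gt0; rewrite leq_eqVlt => /predU1P[//|lt].
  rewrite -[w.+1]addn1 -modnDml modn_small; last by rewrite addn1.
  by rewrite addn1.
(* Lexicographic: height first, then the sheet. *)
pose vlt i j := hlt i j || (R i j && (lift i < lift j)%N).
have vlt_irr : irreflexive vlt by move=> i; rewrite /vlt hlt_irr ltnn andbF.
have [rr rs rt] := equivR.
have hlt_Rr i j j' : R j j' -> hlt i j = hlt i j' by move=> h; rewrite /hlt (ht_R h).
have vlt_trans : transitive vlt.
  move=> j i m /orP[h1|/andP[r1 h1]] /orP[h2|/andP[r2 h2]]; rewrite /vlt.
  - by rewrite (hlt_trans h1 h2).
  - by rewrite -(hlt_Rr _ _ _ r2) h1.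
  - by rewrite (hlt_Rl _ r1) h2.
  - by rewrite (rt _ _ _ r1 r2) (ltn_trans h1 h2) orbT.
have vlt_total i j : i <> j -> vlt i j || vlt j i.
  move=> ne; have [rij|nr] := boolP (R i j); last first.
    by case/orP: (hlt_total nr) => h; rewrite /vlt h ?orbT.
  rewrite /vlt [R j i]rs rij /=; case: (ltngtP (lift i) (lift j)); rewrite ?orbT //.
  by move/lift_inj => /(_ rij).
have [key keyP] := strict_order_key vlt_irr vlt_trans.
have keyE i j : (key i < key j)%N -> vlt i j.
  move=> lt; have /vlt_total/orP[//|/keyP] : i <> j by move=> e; rewrite e ltnn in lt.
  by rewrite ltnNge (ltnW lt).
apply: (@stacking_rank _ n _ lb sr tg K R j0 key) => //.
- move=> i j e; apply: contrapT => /vlt_total /orP[] /keyP; by rewrite e ltnn.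
- move=> i j nr lij /keyE /orP[h|/andP[rtg hl]]; apply: keyP; rewrite /vlt.
    by rewrite hlt_edge.
  have rij : R i j by apply: R_tgt.
  have [_ -> _] := R_edge rij.
  have nrj : ~~ R j j0 by apply: contra nr; apply: rt.
  have ls a : ~~ R a j0 -> lift (sr a) = lift (tg a).
    by move=> na; rewrite /sr /tg; case: ifP; rewrite lift_ordS.
  by rewrite !ls // hl orbT.
- move=> i j rij0 lij nr; apply: keyP; rewrite /vlt.
  have [l1 r1 _] := R_edge rij0.
  rewrite (hlt_Rl _ r1) low -?l1 //.
  by apply: contra nr; apply: rt.
Qed.

Let J := Defs.generated (H `|` [set u]).
Let sJ : is_subgroup J. Proof. exact: gen_subgroup. Qed.
Let HJ : H `<=` J. Proof. by move=> g Hg; apply: sub_gen; left. Qed.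
Let Ju : J u. Proof. by apply: sub_gen; right. Qed.

Let WJ : walk_group J s = J.
Proof.
rewrite eqEsubset; split; first exact: walk_group_sub.
have sW := walk_group_subgroup J s; apply: gen_sub => // g [|->].
  rewrite -{1}HE; apply: gen_mono => h [a [b [an bn -> Hab]]]; apply: walk_group_mem => //.
  by apply/asboolP; apply: HJ.
have pl : pfx s l = u.
  have -> : s = c ++ power_word c k.-1 by rewrite /s -{1}(prednK (ltnW k2)).
  by rewrite pfx_cat // /pfx take_size.
have le : (l <= size s)%N by rewrite sz -{1}(mul1n l) leq_mul2r ltnW ?orbT.
have := walk_group_mem le (leq0n (size s)) (H := J).
rewrite pl pfx0 invg1 mulg1; apply; apply/asboolP.
by rewrite pl pfx0 invg1 mulg1.
Qed.

Let AK := class_mx 'F_2 K.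
Let AR := class_mx 'F_2 R.
Let AE := class_mx 'F_2 Ed.
Let equivE : is_equiv Ed := edge_equiv lb sr equivK.

(* A homomorphism [J -> Z/2] gives a 1-cocycle of the pushout of the graph of
   [H] along the [k]-fold cover of the circle [u]; coboundaries correspond to
   functions constant on the classes of [K] and [R]. *)
Let hom_count (b : seq F) : uniq b -> is_basis J [set` b] ->
  (size b + \rank (AK :&: AR)%MS <= (\rank (AE :&: AR)%MS).+1)%N.
Proof.
move=> ub bB.
(* The homomorphisms dual to the basis [b], extended to all prefixes by [walk_extend]. *)
have /choice [th thP] : forall q : 'I_(size b), exists p : F -> 'F_2,
    (forall h g, J h -> p (h * g) = (p h + p g)%R) /\
    forall q' : 'I_(size b), p (nth 1 b q') = ((q == q')%:R)%R.
  move=> q; pose f (g : F) : 'F_2 := ((g == nth 1%g b q)%:R)%R.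
  have [p0 p0M p0B] := basis_ext f bB.
  have p0M' : morph_on (walk_group J s) p0 by rewrite WJ.
  have [p pM pE] := walk_extend x0 sJ p0M'.
  exists p; split=> [h g Jh|q']; first exact: pM.
  rewrite pE; last by apply/mem_set; rewrite WJ -(gen_basis bB); apply: sub_gen; apply: mem_nth.
  rewrite p0B; last by apply/mem_set; apply: mem_nth.
  by rewrite /f nth_uniq // eq_sym.
pose B : 'M['F_2]_(size b, n) := \matrix_(q, i)
  (th q (pfx s (tgt x0 s i)) - th q (pfx s (src x0 s i)))%R.
pose D : 'M['F_2]_n := \matrix_(j, i) ((j == tg i)%:R - (j == sr i)%:R)%R.
pose NV := row_base (AK :&: AR)%MS.
have Dmul m (A : 'M['F_2]_(m, n)) a i : (A *m D)%R a i = (A a (tg i) - A a (sr i))%R.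
  rewrite mxE (eq_bigr (fun j => A a j * (j == tg i)%:R - A a j * (j == sr i)%:R))%R; last first.
    by move=> j _; rewrite mxE mulrBr.
  rewrite sumrB; congr (_ - _)%R.
    by rewrite (bigD1 (tg i)) //= eqxx mulr1 big1 ?addr0 // => j /negbTE->; rewrite mulr0.
  by rewrite (bigD1 (sr i)) //= eqxx mulr1 big1 ?addr0 // => j /negbTE->; rewrite mulr0.
have NVrow a : (row a NV <= AK :&: AR)%MS.
  by rewrite (submx_trans (row_sub a _)) // eq_row_base.
have th_edge q (i j : 'I_n) : lb i = lb j ->
    J (pfx s (src x0 s i) * (pfx s (src x0 s j))^-1) ->
    (th q (pfx s (tgt x0 s i)) - th q (pfx s (src x0 s i))
      = th q (pfx s (tgt x0 s j)) - th q (pfx s (src x0 s j)))%R.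
  move=> lij; set h := _ * _ => Jh; have [thM _] := thP q.
  have e1 : pfx s (src x0 s i) = h * pfx s (src x0 s j) by rewrite /h mulgVK.
  have e2 : pfx s (tgt x0 s i) = h * pfx s (tgt x0 s j).
    by rewrite !(pfx_edge x0) ?sz // -/(lb i) lij e1 mulgA.
  by clearbody h; rewrite e1 e2 !thM // opprD addrACA subrr add0r.
pose M := col_mx B (NV *m D)%R.
have MN : (\rank M <= \rank (AE :&: AR)%MS)%N.
  apply: mxrankS; rewrite col_mx_sub; apply/andP; split.
    apply/row_subP => q; rewrite sub_capmx; apply/andP; split.
      apply: class_mx_sub => // i j; rewrite EdE => /andP[/eqP lij /asboolP hij].
      by rewrite !mxE; apply: th_edge => //; apply: HJ.
    apply: class_mx_sub => // i j rij; have [lij rs _] := R_edge rij.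
    rewrite !mxE; apply: th_edge => //.
    have e : (src x0 s i %% l = src x0 s j %% l)%N.
      by move/eqP: rs; rewrite !srE !modn_dvdm.
    rewrite (pfx_split (src_n (ltn_ord i))) (pfx_split (src_n (ltn_ord j))) e invgM mulgA mulgK.
    by apply: (sgpM sJ); [|apply: (sgpV sJ)]; apply: (sgpX sJ).
  apply/row_subP => a; have := NVrow a; rewrite sub_capmx => /andP[nK nR].
  rewrite sub_capmx; apply/andP; split; apply: class_mx_sub => // i j.
    move=> /andP[/eqP lij kij]; rewrite mxE [RHS]mxE !Dmul.
    have := class_mx_const equivK nK kij; rewrite labK // in kij.
    have := class_mx_const equivK nK kij; by rewrite !mxE => -> ->.
  move=> /R_edge [_ rs rt]; rewrite mxE [RHS]mxE !Dmul.
  have := class_mx_const equivR nR rs; have := class_mx_const equivR nR rt.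
  by rewrite !mxE => -> ->.
pose E0 : 'M['F_2]_(size b + \rank (AK :&: AR)%MS, n) := col_mx 0 NV.
(* A relation between the rows of [M] makes the homomorphism plus [nu] constant along the cycle. As
   [nu] agrees on classes of [K] and [R], the homomorphism vanishes on [H] and on [u], hence on [J],
   and [nu] is constant. *)
have kerP (v : 'rV['F_2]_(size b + \rank (AK :&: AR)%MS)) : (v <= kermx M)%MS ->
    lsubmx v = 0%R /\ forall i, (v *m E0)%R 0%R i = (v *m E0)%R 0%R (Ordinal n_gt0).
  move=> /sub_kermxP; rewrite -{1}[v]hsubmxK mul_row_col.
  have -> : (v *m E0 = rsubmx v *m NV)%R.
    by rewrite -{1}[v]hsubmxK mul_row_col mulmx0 add0r.
  set v1 := lsubmx v; set nu := (rsubmx v *m NV)%R; rewrite mulmxA -/nu => vM.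
  have nuN : (nu <= AK :&: AR)%MS.
    by rewrite (submx_trans (submxMl _ _)) // eq_row_base.
  move: nuN; rewrite sub_capmx => /andP[nK nR].
  pose thv (g : F) : 'F_2 := (\sum_(q < size b) v1 0 q * th q g)%R.
  have thvM h g : J h -> thv (h * g) = (thv h + thv g)%R.
    move=> Jh; rewrite /thv -big_split; apply: eq_bigr => q _ /=.
    by have [-> //] := thP q; rewrite mulrDr.
  have eqi (i : 'I_n) : (thv (pfx s (tgt x0 s i)) - thv (pfx s (src x0 s i))
      + (nu 0 (tg i) - nu 0 (sr i)) = 0)%R.
    have := congr1 (fun A : 'rV_n => A 0%R i) vM.
    rewrite [LHS]mxE [RHS]mxE Dmul => e; rewrite -[RHS]e; congr (_ + _)%R.
    by rewrite mxE /thv -sumrB; apply: eq_bigr => q _; rewrite [B _ _]mxE mulrBr.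
  pose md a : 'I_n := Ordinal (ltn_pmod a n_gt0).
  pose cc a := (thv (pfx s a) + nu 0 (md a))%R.
  have ccS a : (a <= n)%N -> cc a = cc 0%N.
    elim: a => // a IH lt; rewrite -IH; last exact: ltnW.
    have := eqi (Ordinal lt).
    have -> : tg (Ordinal lt) = md (tgt x0 s a) by apply: val_inj; rewrite /= tgE.
    have -> : sr (Ordinal lt) = md (src x0 s a) by apply: val_inj; rewrite /= srE.
    move/eqP; rewrite addrACA -opprD subr_eq0 => /eqP.
    by rewrite -/(cc _) -/(cc _) /= /tgt /src; case: ifP.
  have thv_pos a a' : (a <= n)%N -> (a' <= n)%N -> J (pfx s a * (pfx s a')^-1) ->
      nu 0 (md a) = nu 0 (md a') -> thv (pfx s a * (pfx s a')^-1) = 0%R.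
    move=> an an' Jaa nuE; have := ccS a an; rewrite -(ccS a' an') /cc nuE.
    rewrite -{1}(mulgVK (pfx s a') (pfx s a)) thvM // => /addIr.
    by rewrite -{2}[thv (pfx s a')]add0r => /addIr.
  have thvJ g : J g -> thv g = 0%R.
    suff sub : J `<=` [set g | J g /\ thv g = 0%R] by move=> /sub [].
    have thv1 : thv 1 = 0%R.
      have := thvM 1 1 (sgp1 sJ); rewrite mulg1 -{1}[thv 1]add0r => /addIr //.
    have sT : is_subgroup [set g | J g /\ thv g = 0%R].
      split; first by split; [apply: (sgp1 sJ)|].
      - move=> x y [Jx tx] [Jy ty]; split; first exact: (sgpM sJ).
        by rewrite thvM // tx ty addr0.
      - move=> x [Jx tx]; split; first exact: (sgpV sJ).
        by have := thvM x x^-1 Jx; rewrite mulgV thv1 tx add0r.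
    apply: gen_sub => // g1 [Hg|->].
      suff subH : walk_group H s `<=` [set g | J g /\ thv g = 0%R] by apply: subH; rewrite HE.
      apply: gen_sub => // _ [a [a' [an an' -> Haa]]].
      rewrite sz in an an'; split; first exact: HJ.
      apply: thv_pos => //; first exact: HJ.
      by apply: class_mx_const equivK nK _; rewrite /K /= pos_mod //; apply/asboolP.
    split=> //; have pl : pfx s l = u.
      have -> : s = c ++ power_word c k.-1 by rewrite /s -{1}(prednK (ltnW k2)).
      by rewrite pfx_cat // /pfx take_size.
    have le : (l <= n)%N by rewrite -{1}(mul1n l) leq_mul2r ltnW ?orbT.
    have := thv_pos l 0%N le (leq0n _); rewrite pl pfx0 invg1 mulg1; apply=> //.
    by apply: class_mx_const equivR nR _; rewrite /R /= !modn_dvdm // modnn mod0n.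
  have v10 : v1 = 0%R.
    apply/rowP => q; rewrite [RHS]mxE.
    have Jb : J (nth 1 b q) by rewrite -(gen_basis bB); apply: sub_gen; apply: mem_nth.
    have := thvJ _ Jb; rewrite /thv (bigD1 q) //= big1 => [|q' ne].
      by have [_ ->] := thP q; rewrite eqxx mulr1 addr0.
    by have [_ ->] := thP q'; rewrite (negbTE ne) mulr0.
  split=> // i; have thv0 g : thv g = 0%R.
    by rewrite /thv big1 // => q _; rewrite v10 mxE mul0r.
  have := ccS i (ltnW (ltn_ord i)); rewrite /cc !thv0 !add0r.
  have -> : md i = i by apply: val_inj; rewrite /= modn_small.
  have -> // : md 0%N = Ordinal n_gt0 by apply: val_inj; rewrite /= mod0n.
have k1 : (\rank (kermx M *m E0)%R <= 1)%N.
  have : (kermx M *m E0 <= (const_mx 1%R : 'rV['F_2]_n))%MS.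
    apply/row_subP => a; have [_ h] := kerP (row a (kermx M)) (row_sub _ _).
    apply/submxP; exists (((row a (kermx M) *m E0) 0 (Ordinal n_gt0))%:M)%R.
    apply/rowP => i; rewrite mul_scalar_mx row_mul [RHS]mxE [const_mx _ _ _]mxE mulr1.
    exact: h.
  by move/mxrankS => /leq_trans; apply; apply: rank_leq_row.
have inj : \rank (kermx M *m E0)%R = \rank (kermx M).
  apply/mxrank_injP; rewrite -submx0; apply/row_subP => a.
  set v := row a _; have : (v <= kermx M :&: kermx E0)%MS by apply: row_sub.
  rewrite sub_capmx => /andP[vM /sub_kermxP vE].
  have [v1 _] := kerP v vM; rewrite submx0 -[v]hsubmxK v1.
  move: vE; rewrite -{1}[v]hsubmxK v1 mul_row_col mul0mx add0r => /eqP.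
  by rewrite mulmx_free_eq0 ?row_base_free // => /eqP ->; rewrite row_mx0.
move: k1; rewrite inj mxrank_ker; move: MN; lia.
Qed.

(** [hom_count] bounds the rank of [J] by edges minus vertices plus one in the pushout. The
    dimension formula for sums and intersections shows that this falls below the same count for [H]
    by the gap in [stacked_rank]. *)
Lemma root_drop_core : exists J', [/\ is_subgroup J', J' u, ~ primitive_in J' u &
  exists a b, [/\ rk J' = Some a, rk H = Some b & (a < b)%N]].
Proof.
exists J; split=> //.
  move=> pJ; have [lH [_ bH _]] := walk_basis x0 sH s; rewrite HE in bH.
  apply: nprim; apply: (@primitive_power_sub _ J H u k lH pJ) => //; last by lia.
  by rewrite (gen_basis bH).
have [lH [uH bH eH]] := walk_basis x0 sH s; rewrite HE in bH.
have [lJ [uJ bJ _]] := walk_basis x0 sJ s; rewrite WJ in bJ.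
exists (size lJ), (size lH); split; [exact: rk_basis|exact: rk_basis|].
have hc := hom_count uJ bJ.
have rV := mxrank_sum_cap AK AR; have rE := mxrank_sum_cap AE AR.
have rk_lt : (\rank (AK + AR)%MS < \rank (AE + AR)%MS)%N := stacked_rank.
have nE : \rank AE = nedge x0 H s.
  rewrite /AE rank_class_mx; last exact: equivE.
  rewrite /nedge sz -count_iota_card; apply: eq_card => i; rewrite !inE.
  apply/forallP/allP => [h j|h j].
    rewrite mem_iota add0n => /= ji.
    have := h (Ordinal (ltn_trans ji (ltn_ord i))).
    by rewrite /= ji /= EdE.
  by apply/implyP => ji; rewrite EdE h // mem_iota.
have nV : \rank AK = nvert H s.
  rewrite /AK rank_class_mx; last exact: equivK.
  rewrite /nvert sz -[n.+1]addn1 iotaD count_cat add0n.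
  have -> : count (vnew H s) (iota n 1) = 0%N.
    rewrite /= addn0; apply/eqP; rewrite eqb0; apply/allPn; exists 0%N.
      by rewrite mem_iota add0n.
    rewrite negbK; apply/asboolP; rewrite pfx0 invg1 mulg1 pfx_n; exact: Huk.
  rewrite addn0 -count_iota_card; apply: eq_card => i; rewrite !inE.
  apply/forallP/allP => [h j|h j].
    rewrite mem_iota add0n => /= ji.
    by have := h (Ordinal (ltn_trans ji (ltn_ord i))); rewrite /= ji.
  by apply/implyP => ji; apply: h; rewrite mem_iota.
rewrite nE in rE; rewrite nV in rV; move: hc rV rE rk_lt eH.
have arith a b c' d e f g h i : (a + b <= c'.+1 -> d + b = e + f -> g + c' = h + f ->
  d < g -> i + e = h.+1 -> a < i)%N by lia.
exact: arith.
Qed.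

End RootDrop.

(** * Adjoining a root, general case *)

Section RootDropGeneral.
Local Open Scope group_scope.
Variable r : nat.
Let F := free_group r.
Implicit Types (u g : F) (H : set F).

Lemma conj_subgroup H g : is_subgroup H -> is_subgroup ((fun x => x ^ g) @` H).
Proof.
move=> sH; split.
- by exists 1; [exact: sgp1|rewrite conj1g].
- by move=> _ _ [x Hx <-] [y Hy <-]; exists (x * y); [exact: sgpM|rewrite conjMg].
- by move=> _ [x Hx <-]; exists x^-1; [exact: sgpV|rewrite conjVg].
Qed.

Lemma conj_setK H g : (fun x => x ^ g^-1) @` ((fun x => x ^ g) @` H) = H.
Proof.
rewrite image_comp eqEsubset; split=> [_ [x Hx <-]|x Hx]; first by rewrite /= conjgK.
by exists x => //=; rewrite conjgK.
Qed.

Lemma conj_mem H g u : ((fun x => x ^ g) @` H) (u ^ g) <-> H u.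
Proof. by split=> [[x Hx /conjg_inj <-]|Hu] //; exists u. Qed.

Lemma conj_primitive H g u : is_subgroup H -> primitive_in H u ->
  primitive_in ((fun x => x ^ g) @` H) (u ^ g).
Proof.
move=> sH [B bB Bu]; exists ((fun x => x ^ g) @` B); last by exists u.
exact: basis_conj.
Qed.

Lemma conj_rk H g k : is_subgroup H -> rk H = Some k -> rk ((fun x => x ^ g) @` H) = Some k.
Proof.
move=> sH /rk_some [b [ub <- bb]].
have -> : size b = size (map (fun x => x ^ g) b) by rewrite size_map.
apply: rk_basis; first by rewrite map_inj_uniq //; apply: conjg_inj.
have := basis_conj g sH bb; suff -> : (fun x => x ^ g) @` [set` b] = [set` map (fun x => x ^ g) b] by [].
rewrite eqEsubset; split=> [_ [x xb <-]|_ /mapP [x xb ->]] /=; last by exists x.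
exact: map_f.
Qed.

Lemma non_power_conj u g : non_power (u ^ g) -> non_power u.
Proof.
move=> np [v [m [m2 e]]]; apply: np; exists (v ^ g), m; split=> //.
by rewrite e conjXg.
Qed.

(* A proper power that is imprimitive in a subgroup not containing its root is
   never critical: adjoining the root drops the rank
   (G. Baumslag; the argument is the one of Louder and Wilton via stackings). *)
Lemma root_drop u H k n : u <> 1 -> non_power u -> (2 <= k)%N -> is_subgroup H ->
    rk H = Some n -> H (u ^+ k) -> (forall j, (0 < j < k)%N -> ~ H (u ^+ j)) ->
    ~ primitive_in H (u ^+ k) ->
  exists J m, [/\ is_subgroup J, J u, ~ primitive_in J u, rk J = Some m & (m < n)%N].
Proof.
move=> u1 npu k2 sH rkH Huk Hmin nprim.
have [g [c [uc c1 cyc]]] := cyclic_reduction u1.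
case cE : (val c) => [|x0 c'].
  by case: c1; apply: val_inj; rewrite cE.
have cF : eval_word (@fg_gen r) (val c) = c by rewrite eval_val.
pose H1 := (fun x => x ^ g^-1) @` H.
have sH1 : is_subgroup H1 by apply: conj_subgroup.
have npc : non_power c by apply: (@non_power_conj _ g); rewrite -uc.
have cu : c = u ^ g^-1 by rewrite uc conjgK.
have H1E j : H1 (c ^+ j) <-> H (u ^+ j) by rewrite cu -conjXg; apply: conj_mem.
pose s := power_word (val c) k.
have evs : eval_word (@fg_gen r) s = c ^+ k by rewrite eval_power_word cF.
(* [H0] is a free factor of the conjugate [H1]: its rank is at most [n], and what is primitive in
   [H0] is primitive in [H1]. *)
pose H0 := walk_group H1 s.
have H0c : H0 (c ^+ k) by rewrite -evs; apply: walk_group_closed => //; rewrite evs; apply/H1E.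
have rkH1 : rk H1 = Some n by apply: conj_rk.
have [b [ub sb bb]] := rk_some rkH1.
have [s' Ws'] : exists s', walk_group H1 (s ++ s') = H1.
  apply: (walk_of_fg sH1 (l := b)); last by rewrite (gen_basis bb).
  by rewrite evs; apply/H1E.
have [l0 [ul0 bl0 _]] := walk_basis x0 sH1 s.
have [l1 [ul1 nl1 bl1 _]] := walk_basis_cat x0 sH1 s' bl0.
have le : (size l0 <= n)%N.
  have u01 : uniq (l0 ++ l1).
    rewrite cat_uniq ul0 ul1 andbT /=; apply/hasPn => y yl1; apply/negP => yl0.
    by apply: (nl1 y yl1); rewrite -(gen_basis bl0); apply: sub_gen.
  rewrite Ws' in bl1.
  have b01 : is_basis H1 [set` l0 ++ l1].
    suff -> : [set` l0 ++ l1] = [set` l0] `|` [set` l1] by [].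
    rewrite eqEsubset; split=> y /=; first by rewrite mem_cat => /orP[]; [left|right].
    by rewrite mem_cat => -[->|->]; rewrite ?orbT.
  by rewrite -sb (basis_size_eq ub bb u01 b01) size_cat leq_addr.
have sH0 : is_subgroup H0 by apply: walk_group_subgroup.
have [|||||||||J [sJ Jc nJ [a [b' [rJ rH0 lt]]]]] := @root_drop_core r x0 (val c) k H0.
- by rewrite cE.
- exact: cyc.
- by rewrite cF.
- exact: k2.
- exact: sH0.
- exact: walk_group_self.
- by rewrite cF.
- by move=> j jk; rewrite cF => /(walk_group_sub sH1) /H1E; apply: Hmin.
- rewrite cF => pr; apply: nprim.
  have := primitive_walk_cat x0 sH1 s' pr; rewrite Ws' => /(conj_primitive g sH1).
  rewrite cu -conjXg conjgKV /H1.
  by have := conj_setK H g^-1; rewrite invgK => ->.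
rewrite cF in Jc nJ; exists ((fun x => x ^ g) @` J), a; split.
- exact: conj_subgroup.
- by rewrite uc; apply/conj_mem.
- move=> pr; apply: nJ; have := conj_primitive g^-1 (conj_subgroup g sJ) pr.
  by rewrite conj_setK uc conjgK.
- exact: conj_rk.
- apply: leq_trans lt _; move: rH0; rewrite (rk_basis ul0 bl0) => -[<-].
  exact: le.
Qed.

End RootDropGeneral.

Section ClassRep.
Variables (m : nat) (e : rel 'I_m).
Hypothesis ee : is_equiv e.
Definition class_rep (a : 'I_m) : 'I_m := [arg min_(b < a | e a b) b].

Lemma class_repP a : e a (class_rep a).
Proof. by have [er _ _] := ee; rewrite /class_rep; case: arg_minnP; first exact: er. Qed.

Lemma class_rep_eq a b : (class_rep a == class_rep b) = e a b.
Proof.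
have [jr js jt] := ee; apply/eqP/idP => [h|jab].
  by apply: jt (class_repP a) _; rewrite h js class_repP.
apply/val_inj/eqP; rewrite eqn_leq /class_rep.
case: arg_minnP => [|a' ja' mina]; first exact: jr.
case: arg_minnP => [|b' jb' minb]; first exact: jr.
rewrite mina ?minb //; first by apply: jt ja'; rewrite js.
exact: jt jab jb'.
Qed.

Lemma class_rep_le a : (class_rep a <= a)%N.
Proof. by have [er _ _] := ee; rewrite /class_rep; case: arg_minnP => // b _; apply. Qed.
End ClassRep.

(** * Counting closed lifts of a walk *)

Section PermCount.
Local Open Scope group_scope.

(** One such permutation exists, and the others arise from it by permuting the points outside the
    image of [y]. *)
Lemma perm_count (T : finType) (I : finType) (C : {set I}) (y z : I -> T) :
    {in C &, forall i j, y i = y j <-> z i = z j} ->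
  #|[set s : {perm T} | [forall i in C, s (y i) == z i]]%SET| = (#|T| - #|y @: C|)`!.
Proof.
move=> yz; have [|s0 s0P] := @perm_extend T [seq (y i, z i) | i in C].
  by move=> _ _ /fintype.imageP[i iC ->] /fintype.imageP[j jC ->]; exact: (yz i j iC jC).
have sE i : i \in C -> s0 (y i) = z i.
  by move=> iC; apply: (s0P (y i, z i)); apply/fintype.imageP; exists i.
have -> : (#|T| - #|y @: C| = #|~: (y @: C)|)%N by rewrite [in RHS]cardsCs finset.setCK.
rewrite -card_perm.
have -> : [set s : {perm T} | [forall i in C, s (y i) == z i]]%SET
    = [set s * s0 | s in perm_on (~: (y @: C))]%SET.
  apply/setP => s; rewrite inE; apply/forall_inP/imsetP => [h|[t tC ->] i iC].
    exists (s * s0^-1); last by rewrite mulgVK.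
    rewrite unfold_in; apply/fintype.subsetP => x; rewrite !inE; apply: contraNN => /imsetP [i iC ->].
    by rewrite permM (eqP (h i iC)) -sE // permK.
  rewrite permM -sE //; apply/eqP; congr (s0 _).
  by apply: (out_perm tC); rewrite inE negbK imset_f.
by rewrite card_imset //; apply: mulIg.
Qed.

Lemma prod_perm_count (T I : finType) (N : nat) (lab : I -> T) (y z : I -> 'I_N) :
    (forall i j, lab i = lab j -> y i = y j <-> z i = z j) ->
  #|[set s : {ffun T -> 'S_N} | [forall i, s (lab i) (y i) == z i]]%SET|
    = (\prod_(t : T) (N - #|y @: [set i | lab i == t]%SET|)`!)%N.
Proof.
move=> yz; pose D t := [set s : 'S_N | [forall i in [set i | lab i == t]%SET, s (y i) == z i]]%SET.
have -> : #|[set s : {ffun T -> 'S_N} | [forall i, s (lab i) (y i) == z i]]%SET|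
    = #|(family (fun t => mem (D t)) : simpl_pred {ffun T -> 'S_N})|.
  apply: eq_card => s; rewrite inE; apply/forallP/familyP => [h t|h i].
    by rewrite inE; apply/forall_inP => i; rewrite inE => /eqP <-.
  have := h (lab i); rewrite inE => /forall_inP; apply; by rewrite inE.
rewrite card_family foldrE big_map big_enum /=; apply: eq_bigr => t _.
have yzt : {in [set i | lab i == t]%SET &, forall i j, y i = y j <-> z i = z j}.
  by move=> i j; rewrite !inE => /eqP li /eqP lj; apply: yz; rewrite li lj.
by have := perm_count yzt; rewrite card_ord.
Qed.

End PermCount.

Section RankProduct.
Variable m : nat.
Implicit Types A : {set 'I_m}.

(** Each factor subtracts the number of smaller elements. Written this way, falling factorials over
    the fibres of [J] involve [J] only through pairs it identifies. *)
Lemma ffact_rank (N : nat) A :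
  (\prod_(a in A) (N - #|[set b in A | (b < a)%N]%SET|) = N ^_ #|A|)%N.
Proof.
have [k] := ubnP #|A|; elim: k A => // k IH A; rewrite ltnS => le.
have [->|[i0 iA]] := finset.set_0Vmem A; first by rewrite big_set0 cards0.
have [M MA' Mmax] := @arg_maxnP _ i0 (mem A) val iA; have MA : M \in A := MA'.
have MAle b : b \in A -> (b <= M)%N by apply: Mmax.
rewrite (big_setD1 M) //= (cardsD1 M A) MA addnC addn1 ffactnSr mulnC; congr (_ * _)%N.
  rewrite -IH; last by move: le; rewrite (cardsD1 M A) MA.
  apply: eq_bigr => a; rewrite !inE => /andP[aM aA]; congr (_ - _)%N.
  apply: eq_card => b; rewrite !inE; case: (eqVneq b M) => [->|] //=.
  by rewrite ltnNge MAle // andbF.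
congr (_ - _)%N; apply: eq_card => b; rewrite !inE andbC; case: (boolP (b \in A)) => bA; last by rewrite !andbF.
by rewrite !andbT ltn_neqAle MAle // andbT.
Qed.

Lemma ffact_rank_lab (T : finType) (lab : 'I_m -> T) (N : nat) A :
  (\prod_(t : T) N ^_ #|[set a in A | lab a == t]%SET|
    = \prod_(a in A) (N - #|[set b in A | (b < a)%N && (lab b == lab a)]%SET|))%N.
Proof.
rewrite [RHS](partition_big lab predT) //=; apply: eq_bigr => t _.
rewrite -ffact_rank; apply: eq_big => a; first by rewrite inE.
rewrite inE => /andP[aA /eqP <-]; congr (_ - _)%N.
by apply: eq_card => b; rewrite !inE -andbA; case: (b \in A) => //=; rewrite andbC.
Qed.

End RankProduct.

Section WalkCount.
Variables (n : nat) (T : finType) (lab : 'I_n -> T) (dir : 'I_n -> bool).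
Notation P := 'I_n.+1.
Implicit Types (K J : {set P * P}) (i j : 'I_n) (a b : P).

Definition pos_next i : P := lift ord0 i.
Definition pos_here i : P := widen_ord (leqnSn n) i.
Definition osrc i : P := if dir i then pos_next i else pos_here i.
Definition otgt i : P := if dir i then pos_here i else pos_next i.

Definition rel_of (K : {set P * P}) : rel P := fun a b => (a, b) \in K.

(* A set [K] of pairs of positions encodes a quotient of the cycle reading the
   word: [rel_of K] identifies positions, [edge_of K] the edges leaving them. *)
Definition folded K := [/\ is_equiv (rel_of K), rel_of K ord0 ord_max &
  forall i j, lab i = lab j -> rel_of K (osrc i) (osrc j) = rel_of K (otgt i) (otgt j)].

Definition edge_of K : rel 'I_n := fun i j => (lab i == lab j) && rel_of K (osrc i) (osrc j).

Lemma edge_of_equiv K : is_equiv (rel_of K) -> is_equiv (edge_of K).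
Proof.
move=> [kr ks kt]; rewrite /edge_of; split.
- by move=> i; rewrite eqxx kr.
- by move=> i j; rewrite eq_sym ks.
- move=> j i k /andP[/eqP-> k1] /andP[/eqP-> k2]; rewrite eqxx; exact: kt k1 k2.
Qed.

Variable J : {set P * P}.
Hypothesis JK : is_equiv (rel_of J).
Hypothesis J0 : rel_of J ord0 ord_max.
Hypothesis Jlab : forall i j, lab i = lab j ->
  rel_of J (osrc i) (osrc j) /\ rel_of J (otgt i) (otgt j).

(* The weight [N (N-1) ... / N (N-1) ...] of the lifts with fibre relation [K]
   to a random [N]-cover of the graph of [J]. *)
Definition weight (R : realType) K (N : nat) : R :=
  ((\prod_(a in reps (rel_of K))
     (N - #|[set b in reps (rel_of K) | (b < a)%N && rel_of J b a]%SET|))%N)%:R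
  / ((\prod_(i in reps (edge_of K))
     (N - #|[set j in reps (edge_of K) | (j < i)%N && (lab j == lab i)]%SET|))%N)%:R.

Variable N : nat.
Hypothesis Nn : (n < N)%N.

Let word := [seq (lab i, dir i) | i <- enum 'I_n].
Let compat (s : {ffun T -> 'S_N}) (f : {ffun P -> 'I_N}) :=
  [forall i, s (lab i) (f (osrc i)) == f (otgt i)].

Let nth_word (x : T * bool) i : nth x word i = (lab i, dir i).
Proof. by rewrite (nth_map i) ?size_enum_ord // nth_ord_enum. Qed.

(** A fixed point amounts to its trajectory: a labelling of the positions compatible with every step
    that closes up. *)
Let fix_compat (s : {ffun T -> 'S_N}) : fixpoints 1 (eval_word s word)
  = #|[set f : {ffun P -> 'I_N} | compat s f && (f ord0 == f ord_max)]%SET|.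
Proof.
pose tr (x : 'I_N) : {ffun P -> 'I_N} := [ffun a : P => eval_word s (take a word) x].
have szw : size word = n by rewrite size_map size_enum_ord.
have trS x i : tr x (pos_next i) = letter_value s (lab i, dir i) (tr x (pos_here i)).
  rewrite !ffunE /= (take_nth (lab i, dir i)) ?szw //.
  by rewrite nth_word eval_rcons permM.
have trc x : compat s (tr x).
  apply/forallP => i; rewrite /osrc /otgt; have := trS x i; rewrite /letter_value /=.
  by case: (dir i) => ->; rewrite ?permKV.
have tr0 x : tr x ord0 = x by rewrite ffunE take0 eval_nil perm1.
have trn x : tr x ord_max = eval_word s word x by rewrite ffunE /= take_oversize ?szw.
have uniq_f f : compat s f -> f = tr (f ord0).
  move=> /forallP cf; apply/ffunP => -[a an].
  elim: a an => [|a IH] an; first by rewrite (_ : Ordinal an = ord0) ?tr0 //; apply: val_inj.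
  have an' : (a < n)%N by [].
  pose i := Ordinal an'.
  have -> : Ordinal an = pos_next i by apply: val_inj.
  have e : f (pos_here i) = tr (f ord0) (pos_here i).
    by have := IH (ltnW an); rewrite (_ : Ordinal _ = pos_here i) //; apply: val_inj.
  rewrite trS -e; have := cf i; rewrite /osrc /otgt /letter_value /=.
  by case: (dir i) => /eqP <-; rewrite ?permK.
rewrite /fixpoints -(card_imset _ (f := tr)); last by move=> x x' e; rewrite -(tr0 x) e tr0.
apply: eq_card => f; rewrite !inE; apply/imsetP/andP => [[x + ->]|[cf /eqP fe]].
  by rewrite inE expg1 => /eqP ex; rewrite trc tr0 trn ex.
exists (f ord0); last exact: uniq_f.
by rewrite inE expg1 /= -trn -uniq_f // fe.
Qed.

(** A point of the cover is a vertex of [J] together with a sheet, so two positions coincide when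
    both agree. *)
Let ker (f : {ffun P -> 'I_N}) : {set P * P} :=
  [set p | (p \in J) && (f p.1 == f p.2)]%SET.

Let ker_equiv f : is_equiv (rel_of (ker f)).
Proof.
have [jr js jt] := JK; split.
- by move=> a; rewrite /rel_of inE eqxx andbT; apply: jr.
- move=> a b; rewrite /rel_of !inE /= eq_sym; congr (_ && _); exact: js.
- move=> b a d; rewrite /rel_of !inE /= => /andP[j1 /eqP->] /andP[j2 /eqP->].
  by rewrite eqxx andbT; apply: jt j1 j2.
Qed.

Let ker_src f i j : lab i = lab j ->
  rel_of (ker f) (osrc i) (osrc j) = (f (osrc i) == f (osrc j)).
Proof. by move=> /Jlab [j1 _]; rewrite /rel_of inE /= [(_, _) \in _]j1. Qed.
Let ker_tgt f i j : lab i = lab j ->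
  rel_of (ker f) (otgt i) (otgt j) = (f (otgt i) == f (otgt j)).
Proof. by move=> /Jlab [_ j1]; rewrite /rel_of inE /= [(_, _) \in _]j1. Qed.

Let compat_folded s f : compat s f -> f ord0 = f ord_max -> folded (ker f).
Proof.
move=> /forallP cf f0; split; first exact: ker_equiv.
  by rewrite /rel_of inE /= [(_, _) \in _]J0 f0 eqxx.
move=> i j lij; rewrite ker_src // ker_tgt // -(eqP (cf i)) -(eqP (cf j)) lij.
by rewrite (inj_eq perm_inj).
Qed.

Let edge_fibre f t : folded (ker f) ->
  #|[set f (osrc i) | i in [set i | lab i == t]]%SET|
    = #|[set i in reps (edge_of (ker f)) | lab i == t]%SET|.
Proof.
move=> [ke _ _]; have ee := edge_of_equiv ke.
rewrite -(@card_in_imset _ _ (fun i => f (osrc i)) [set i in reps (edge_of (ker f)) | lab i == t]%SET).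
  apply: eq_card => x; apply/imsetP/imsetP => [[i]|[i]]; rewrite inE.
    move=> /eqP lt ->; have [j jr] := rep_exists i ee.
    move=> /andP[/eqP lij kij]; exists j; first by rewrite inE jr -lij lt eqxx.
    by apply/eqP; rewrite -ker_src.
  by move=> /andP[_ lt] ->; exists i; rewrite ?inE.
move=> i j; rewrite inE => /andP[ri /eqP li]; rewrite inE => /andP[rj /eqP lj] /eqP e.
by apply: (reps_inj ee) => //; rewrite /edge_of li lj eqxx /= ker_src ?li ?lj.
Qed.

Let count_sigma f : folded (ker f) -> #|[set s | compat s f]%SET|
  = (\prod_(t : T) (N - #|[set i in reps (edge_of (ker f)) | lab i == t]%SET|)`!)%N.
Proof.
move=> fk; have [_ _ fold] := fk.
rewrite (@prod_perm_count _ _ _ lab (fun i => f (osrc i)) (fun i => f (otgt i))).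
  by apply: eq_bigr => t _; rewrite edge_fibre.
move=> i j lij; have := fold i j lij; rewrite ker_src // ker_tgt //.
by move=> e; split=> /eqP h; apply/eqP; [rewrite -e|rewrite e].
Qed.

Notation vlab := (class_rep (rel_of J)).

(** Tuples of permutations, one per vertex of [J], act on the trajectories with kernel [K]. Starting
    from the trajectory [f0], each one is reached by the same number of tuples, counted by
    [prod_perm_count]. *)
Let count_f K : folded K -> K \subset J ->
  (#|[set f | ker f == K]%SET| *
    \prod_(v : P) (N - #|[set a in reps (rel_of K) | vlab a == v]%SET|)`!
   = N`! ^ n.+1)%N.
Proof.
move=> [ke _ _] /fintype.subsetP KJ; have [kr ks kt] := ke.
pose f0 : {ffun P -> 'I_N} := [ffun a => widen_ord Nn (class_rep (rel_of K) a)].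
have f0E a b : (f0 a == f0 b) = rel_of K a b.
  by rewrite !ffunE -(class_rep_eq ke).
pose cmp (s : {ffun P -> 'S_N}) (f : {ffun P -> 'I_N}) := [forall a, s (vlab a) (f0 a) == f a].
have kerK s f : cmp s f -> ker f = K.
  move=> /forallP sf; apply/setP => -[a b]; rewrite inE /=.
  have [jab|nj] := boolP ((a, b) \in J); last by apply/esym/negP => /KJ; apply/negP.
  rewrite -(eqP (sf a)) -(eqP (sf b)) /=.
  have /eqP -> : vlab a == vlab b by rewrite class_rep_eq.
  by rewrite (inj_eq perm_inj) f0E.
have cnt_f f : ker f == K -> #|[set s | cmp s f]%SET|
    = (\prod_(v : P) (N - #|[set a in reps (rel_of K) | vlab a == v]%SET|)`!)%N.
  move=> /eqP fK; rewrite (@prod_perm_count _ _ _ vlab f0 f).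
    apply: eq_bigr => v _; congr (_ - _)`!%N.
    rewrite -(@card_in_imset _ _ f0 [set a in reps (rel_of K) | vlab a == v]%SET).
      apply: eq_card => x; apply/imsetP/imsetP => [[a]|[a]]; rewrite inE.
        move=> /eqP <- ->; have [b rb kab] := rep_exists a ke.
        exists b; last by apply/eqP; rewrite f0E.
        by rewrite inE rb class_rep_eq //; have [_ js _] := JK; rewrite js; apply: KJ.
      by move=> /andP[_ va] ->; exists a; rewrite ?inE.
    move=> a b; rewrite inE => /andP[ra _]; rewrite inE => /andP[rb _] /eqP.
    by rewrite f0E => kab; apply: (reps_inj ke).
  move=> a b /eqP; rewrite class_rep_eq // => jab.
  have e : (f0 a == f0 b) = (f a == f b).
    by rewrite f0E -fK /rel_of inE /= [(a, b) \in J]jab.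
  by split=> /eqP h; apply/eqP; [rewrite -e|rewrite e].
rewrite -[RHS](_ : #|{ffun P -> 'S_N}| = _); last by rewrite card_ffun card_ord card_Sn.
transitivity (\sum_(f : {ffun P -> 'I_N} | ker f == K) #|[set s | cmp s f]%SET|)%N.
  rewrite (eq_bigr _ cnt_f) sum_nat_const; congr (_ * _)%N.
  by apply: eq_card => f; rewrite inE.
rewrite -[RHS]sum1_card (eq_bigr (fun f => \sum_(s : {ffun P -> 'S_N} | cmp s f) 1)%N).
  rewrite (exchange_big_dep predT) //=; apply: eq_bigr => s _.
  pose f : {ffun P -> 'I_N} := [ffun a => s (vlab a) (f0 a)].
  have cf : cmp s f by apply/forallP => a; rewrite [X in _ == X]ffunE.
  rewrite (big_pred1 f) // => g; apply/andP/eqP => [[_ /forallP sg]|->].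
    by apply/ffunP => a; rewrite [RHS]ffunE (eqP (sg a)).
  by split; [apply/eqP; exact: (kerK s f cf)|exact: cf].
by move=> f _; rewrite sum1_card; apply: eq_card => s; rewrite inE.
Qed.

Definition is_folded K := `[< folded K >].

(** Pairs of a cover and a closed trajectory are counted trajectory first, grouped by kernel; the
    number of covers compatible with a trajectory depends only on its kernel. *)
Lemma walk_count (R : realType) :
  (\sum_(s : {ffun T -> 'S_N}) (fixpoints 1 (eval_word s word))%:R)
     / #|{ffun T -> 'S_N}|%:R
  = \sum_(K : {set P * P} | is_folded K && (K \subset J)) weight R K N.
Proof.
have fz (m : nat) : (m`!%:R : R) != 0 by rewrite pnatr_eq0 -lt0n fact_gt0.
have -> : \sum_(s : {ffun T -> 'S_N}) (fixpoints 1 (eval_word s word))%:R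
   = ((\sum_(K : {set P * P} | is_folded K && (K \subset J))
        \sum_(f : {ffun P -> 'I_N} | ker f == K) #|[set s | compat s f]%SET|)%N)%:R :> R.
  rewrite -natr_sum; congr (_%:R).
  rewrite (eq_bigr (fun s => \sum_(f : {ffun P -> 'I_N} | compat s f && (f ord0 == f ord_max)) 1)%N).
    rewrite (exchange_big_dep (fun f : {ffun P -> 'I_N} => f ord0 == f ord_max)) /=.
      rewrite (partition_big ker predT) //= [RHS]big_mkcond /=; apply: eq_bigr => K _.
      case: ifP => [/andP[/asboolP fK KJ]|nK].
        apply: eq_big => [f|f /andP[f0 _]].
          case: (ker f =P K) => [fE|_]; last by rewrite andbF.
          have [_ + _] := fK; rewrite -fE /rel_of inE /= [(_, _) \in _]J0 /= => ->.
          by [].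
        by rewrite sum1_card; apply: eq_card => s; rewrite !inE unfold_in f0 andbT.
      rewrite big1 // => f /andP[/eqP f0 /eqP fE]; apply: big_pred0 => s.
      apply/negP => /andP[cf _]; move: nK; rewrite -fE => /negP; apply.
      apply/andP; split; first by apply/asboolP; apply: compat_folded cf f0.
      by apply/fintype.subsetP => p; rewrite inE => /andP[].
    by move=> s f _ /andP[].
  move=> s _; rewrite fix_compat sum1_card; apply: eq_card => f.
  by rewrite inE.
rewrite natr_sum mulr_suml; apply: eq_bigr => K /andP[/asboolP fK KJ].
have [f0 kf0|none] := pickP (fun f => ker f == K); last first.
  have := count_f fK KJ; rewrite (_ : #|_| = 0%N); first by rewrite mul0n => /esym/eqP; rewrite expn_eq0 -leqn0 leqNgt fact_gt0.
  by apply: eq_card0 => f; rewrite inE none.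
rewrite (eq_bigr (fun=> #|[set s | compat s f0]%SET|)); last first.
  move=> f /eqP fE; rewrite !count_sigma ?fE ?(eqP kf0) //.
have cA c : (\sum_(f : {ffun P -> 'I_N} | ker f == K) c = #|[set f | ker f == K]%SET| * c)%N.
  by rewrite sum_nat_const; congr (_ * _)%N; apply: eq_card => f; rewrite inE.
rewrite cA count_sigma (eqP kf0) //.
have cf := count_f fK KJ.
have leN (X : finType) (A : {set X}) : (#|A| <= #|X|)%N by apply: max_card.
have ffE (m : nat) : (m <= n.+1)%N -> (N`!%:R : R) = (N ^_ m)%:R * ((N - m)`!)%:R.
  by move=> mn; rewrite -natrM ffact_fact // (leq_trans mn).
have kV v : (#|[set a in reps (rel_of K) | vlab a == v]%SET| <= n.+1)%N.
  by apply: leq_trans (leN _ _) _; rewrite card_ord.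
have kE t : (#|[set i in reps (edge_of K) | lab i == t]%SET| <= n.+1)%N.
  by apply: leq_trans (leN _ _) _; rewrite card_ord.
rewrite /weight.
have -> : (\prod_(a in reps (rel_of K))
     (N - #|[set b in reps (rel_of K) | (b < a)%N && rel_of J b a]%SET|))%N
   = (\prod_(v : P) N ^_ #|[set a in reps (rel_of K) | vlab a == v]%SET|)%N.
  rewrite ffact_rank_lab; apply: eq_bigr => a _; congr (_ - _)%N.
  by apply: eq_card => b; rewrite !inE class_rep_eq.
rewrite -ffact_rank_lab.
set PV := (\prod_v _)%N in cf; set PE := (\prod_t (_ - _)`!)%N.
rewrite card_ffun card_Sn.
have V : (N`! ^ n.+1 = (\prod_(v : P) N ^_ #|[set a in reps (rel_of K) | vlab a == v]%SET|) * PV)%N.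
  rewrite /PV -big_split /= -[n.+1 in LHS](card_ord n.+1) -prod_nat_const.
  by apply: eq_bigr => v _; rewrite ffact_fact // (leq_trans (kV v)).
have E : (N`! ^ #|T| = (\prod_(t : T) N ^_ #|[set i in reps (edge_of K) | lab i == t]%SET|) * PE)%N.
  rewrite /PE -big_split /= -prod_nat_const.
  by apply: eq_bigr => t _; rewrite ffact_fact // (leq_trans (kE t)).
have PV0 : (0 < PV)%N by apply: prodn_gt0 => v; apply: fact_gt0.
have PE0 : (0 < PE)%N by apply: prodn_gt0 => v; apply: fact_gt0.
move: cf; rewrite V => /eqP; rewrite eqn_pmul2r // => /eqP ->.
have q0 : (\prod_(t : T) N ^_ #|[set i in reps (edge_of K) | lab i == t]%SET| != 0)%N.
  have : (0 < N`! ^ #|T|)%N by rewrite expn_gt0 fact_gt0.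
  by rewrite E muln_gt0 lt0n => /andP[].
rewrite E !natrM invfM mulrACA divff ?mulr1 // pnatr_eq0 -lt0n //.
Qed.

End WalkCount.

(** * Quotients of the cycle as subgroups of the free group *)

Section Quotients.
Local Open Scope group_scope.
Variables (r : nat) (x0 : 'I_r * bool) (s : seq ('I_r * bool)).
Let F := free_group r.
Let n := size s.
Notation P := 'I_n.+1.
Notation RT := {set P * P}.
Implicit Types (K J : RT) (H : set F) (i j : 'I_n) (a b : P).

Definition wlab i : 'I_r := lab x0 s i.
Definition wdir i : bool := (nth x0 s i).2.
Notation wsrc := (osrc wdir).
Notation wtgt := (otgt wdir).
Definition quo K := folded wlab wdir K.

Lemma wsrcE i : wsrc i = src x0 s i :> nat.
Proof. by rewrite /osrc /src /wdir; case: ifP. Qed.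
Lemma wtgtE i : wtgt i = tgt x0 s i :> nat.
Proof. by rewrite /otgt /tgt /wdir; case: ifP. Qed.

Definition relH H : RT := [set p : P * P | pos_rel H s p.1 p.2]%SET.

Lemma rel_relH H a b : rel_of (relH H) a b = pos_rel H s a b.
Proof. by rewrite /rel_of inE. Qed.

Lemma edge_relH H i j : edge_of wlab wdir (relH H) i j = edge_rel x0 H s i j.
Proof. by rewrite /edge_of rel_relH !wsrcE. Qed.

Lemma relH_quo H : is_subgroup H -> H (eval_word (@fg_gen r) s) -> quo (relH H).
Proof.
move=> sH Hs; split.
- split=> [a|a b|b a d]; rewrite ?rel_relH.
  + exact: pos_refl.
  + exact: pos_sym.
  + exact: pos_trans.
- rewrite rel_relH pos_sym //; apply/asboolP.
  by rewrite pfx0 invg1 mulg1 /pfx take_oversize.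
- by move=> i j lij; rewrite !rel_relH !wsrcE !wtgtE edge_tgt.
Qed.

(** The partial injections of a folded quotient are completed to permutations, and [H] is the
    stabilizer of the point that represents position 0. *)
Lemma quo_relH K : quo K -> exists H, [/\ is_subgroup H, H (eval_word (@fg_gen r) s) & relH H = K].
Proof.
move=> [ke k0 kf]; have [kr ks kt] := ke.
pose v (a : nat) : P := class_rep (rel_of K) (inord a).
have vE a b : (v a == v b) = rel_of K a b by rewrite /v !inord_val class_rep_eq.
have [|f fP] := @walk_perm r x0 n.+1 s v.
  move=> i j ilt jlt lij; have := kf (Ordinal ilt) (Ordinal jlt) lij.
  rewrite -!vE !wsrcE !wtgtE /= => e.
  by split=> /eqP h; apply/eqP; [rewrite -e|rewrite e].
have fpE a : eval_word f (pfx s a) (v 0%N) = v a.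
  by rewrite eval_hom_word fP // -ltnS.
have fH g h : eval_word f (g * h : F) = eval_word f g * eval_word f h by apply: eval_homM.
have f1 : eval_word f (1 : F) = 1 by rewrite eval_nil.
have fV (g : F) : eval_word f g^-1 = (eval_word f g)^-1.
  by apply: (@mulgI _ (eval_word f g)); rewrite -fH !mulgV f1.
exists [set g : F | eval_word f g (v 0%N) = v 0%N]; split.
- split => [|x y|x] /=.
  + by rewrite f1 perm1.
  + by move=> hx hy; rewrite fH permM hx hy.
  + by move=> hx; rewrite fV -{1}hx permK.
- rewrite /= eval_hom_word -[s]take_size fP //.
  by apply/eqP; rewrite -[size s]/(nat_of_ord (@ord_max n)) -[0%N]/(nat_of_ord (@ord0 n)) vE ks.
- apply/setP => -[a b]; rewrite inE /= -[RHS]/(rel_of K a b) -vE.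
  have e : eval_word f (pfx s a * (pfx s b)^-1) (v 0%N) = ((eval_word f (pfx s b))^-1)%g (v a).
    by rewrite fH permM fpE fV.
  apply/asboolP/eqP => /= h; last by rewrite e h -(fpE b) permK.
  by rewrite -(fpE b) -h e permKV.
Qed.

(* The fundamental group of the quotient graph [K], based at position [0]. *)
Definition grp K : set F :=
  Defs.generated [set g | exists a b, rel_of K a b /\ g = pfx s a * (pfx s b)^-1].

Lemma grp_subgroup K : is_subgroup (grp K). Proof. exact: gen_subgroup. Qed.

Lemma grp_relH H : grp (relH H) = walk_group H s.
Proof.
congr Defs.generated; rewrite eqEsubset; split=> g.
  move=> [a [b [/= + ->]]]; rewrite rel_relH => /asboolP h.
  by exists a, b; split=> //; rewrite -ltnS; apply: ltn_ord.
move=> [a [b [an bn -> h]]]; exists (inord a), (inord b).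
by rewrite rel_relH !inordK ?ltnS //; split=> //; apply/asboolP.
Qed.

Lemma relH_grp K : quo K -> relH (grp K) = K.
Proof.
move=> /quo_relH [H [sH _ <-]]; rewrite grp_relH; apply/setP => -[a b].
by rewrite !inE /= walk_group_idem // -ltnS.
Qed.

Lemma grp_closed K : quo K -> grp K (eval_word (@fg_gen r) s).
Proof.
by move=> /quo_relH [H [sH Hs <-]]; rewrite grp_relH; apply: walk_group_closed.
Qed.

Lemma grp_mem K a b : rel_of K a b -> grp K (pfx s a * (pfx s b)^-1).
Proof. by move=> kab; apply: sub_gen; exists a, b. Qed.

Lemma grp_sub_relH K H : is_subgroup H -> (grp K `<=` H) <-> (K \subset relH H).
Proof.
move=> sH; split=> h.
  apply/fintype.subsetP => -[a b] kab; rewrite inE; apply/asboolP.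
  by apply: h; apply: grp_mem.
apply: gen_sub => // _ [a [b [kab ->]]].
by have /fintype.subsetP/(_ _ kab) := h; rewrite inE => /asboolP.
Qed.

(** Quotients are thereby ordered like their subgroups, so joins and gluings can be computed among
    subgroups. *)
Lemma grp_sub K J : quo J -> (grp K `<=` grp J) <-> (K \subset J).
Proof. by move=> qJ; rewrite -{2}(relH_grp qJ); apply: grp_sub_relH; apply: grp_subgroup. Qed.

Lemma grp_inj K J : quo K -> quo J -> grp K = grp J -> K = J.
Proof. by move=> qK qJ e; rewrite -(relH_grp qK) e relH_grp. Qed.

Lemma grp_basis K : quo K -> exists b : seq F, [/\ uniq b, is_basis (grp K) [set` b] &
  (size b + #|reps (rel_of K)| = (#|reps (edge_of wlab wdir K)|).+1)%N].
Proof.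
move=> /quo_relH [H [sH _ <-]]; rewrite grp_relH.
have [b [ub bb eb]] := walk_basis x0 sH s; exists b; split=> //.
have <- : nvert H s = #|reps (rel_of (relH H))|.
  rewrite /nvert -count_iota_card; apply: eq_card => a; rewrite !inE.
  apply/allP/forallP => [h j|h j].
    by apply/implyP => ja; rewrite rel_relH; apply: h; rewrite mem_iota.
  rewrite mem_iota add0n => /= ja.
  by have := h (Ordinal (ltn_trans ja (ltn_ord a))); rewrite /= ja rel_relH.
rewrite eb; congr _.+1.
rewrite /nedge -count_iota_card; apply: eq_card => i; rewrite !inE.
apply/allP/forallP => [h j|h j].
  by apply/implyP => ja; rewrite edge_relH; apply: h; rewrite mem_iota.
rewrite mem_iota add0n => /= ja.
by have := h (Ordinal (ltn_trans ja (ltn_ord i))); rewrite /= ja edge_relH.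
Qed.

(** Each edge of [J] is named by its least step, so a cover of the graph of [J] is a tuple of
    permutations indexed by these names; the remaining coordinates of the tuple average out. *)
Definition elab J : 'I_n -> 'I_n := class_rep (edge_of wlab wdir J).
Definition eword J := [seq (elab J i, wdir i) | i <- enum 'I_n].

Lemma elab_eq J i j : quo J -> (elab J i == elab J j) = edge_of wlab wdir J i j.
Proof. by move=> [je _ _]; apply: class_rep_eq; apply: edge_of_equiv. Qed.

Definition pweight (R : realType) K J (N : nat) : R :=
  ((\prod_(a in reps (rel_of K))
     (N - #|[set b in reps (rel_of K) | (b < a)%N && rel_of J b a]%SET|))%N)%:R
  / ((\prod_(i in reps (edge_of wlab wdir K))
     (N - #|[set j in reps (edge_of wlab wdir K) | (j < i)%N && edge_of wlab wdir J j i]%SET|))%N)%:R.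

Lemma edge_elab J K : quo J -> K \subset J ->
  edge_of (elab J) wdir K = edge_of wlab wdir K.
Proof.
move=> qJ /fintype.subsetP KJ; apply/funext => i; apply/funext => j.
rewrite /edge_of elab_eq // /edge_of.
case kij: (rel_of K (wsrc i) (wsrc j)); rewrite ?andbF // !andbT.
have jij : rel_of J (wsrc i) (wsrc j) := KJ _ kij.
by rewrite jij andbT.
Qed.

Lemma quo_elab J K : quo J -> K \subset J -> folded (elab J) wdir K <-> quo K.
Proof.
move=> qJ KJ; have [_ _ jf] := qJ; have /fintype.subsetP KJ' := KJ.
split=> -[ke k0 kf]; split=> // i j lij; last first.
  apply: kf; move/eqP: lij; rewrite elab_eq // => /andP[/eqP //].
have [jij|nj] := boolP (rel_of J (wsrc i) (wsrc j)).
  by apply: kf; apply/eqP; rewrite elab_eq // /edge_of lij eqxx.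
rewrite (_ : rel_of K _ _ = false); last by apply/negP => /KJ' h; rewrite [rel_of J _ _]h in nj.
by apply/esym/negP => /KJ' h; move: nj; rewrite (jf _ _ lij) [rel_of J _ _]h.
Qed.

Lemma quo_count (R : realType) J N : quo J -> (n < N)%N ->
  (\sum_(t : {ffun 'I_n -> 'S_N}) (fixpoints 1 (eval_word t (eword J)))%:R
     / #|{ffun 'I_n -> 'S_N}|%:R)%R
  = (\sum_(K : RT | `[< quo K >] && (K \subset J)) pweight R K J N)%R.
Proof.
move=> qJ nN; have [je j0 jf] := qJ.
rewrite -mulr_suml (@walk_count n 'I_n (elab J) wdir J je j0) //.
  apply: eq_big => [K|K /andP[_ KJ]].
    case KJ: (K \subset J); rewrite ?andbF // !andbT.
    by apply/asboolP/asboolP => h; apply/(quo_elab qJ KJ).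
  rewrite /weight edge_elab // /pweight; congr (_ / _%:R)%R.
  apply: eq_bigr => i _; congr (_ - _)%N; apply: eq_card => j.
  by rewrite !inE elab_eq.
move=> i j /eqP; rewrite elab_eq // => /andP[/eqP lij jij].
by rewrite -jf.
Qed.

(** The full relation gives a graph with one vertex, whose covers are the tuples of permutations
    indexed by the generators. *)
Lemma base_count (R : realType) N : (n < N)%N -> quo [set: P * P]%SET ->
  (\sum_(t : {ffun 'I_r -> 'S_N}) (fixpoints 1 (eval_word t s))%:R
     / #|{ffun 'I_r -> 'S_N}|%:R)%R
  = (\sum_(K : RT | `[< quo K >]) pweight R K [set: P * P]%SET N)%R.
Proof.
move=> nN [je j0 jf]; have sE : s = [seq (wlab i, wdir i) | i <- enum 'I_n].
  apply: (@eq_from_nth _ x0); first by rewrite size_map size_enum_ord.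
  move=> i ilt; rewrite (nth_map (Ordinal ilt)) ?size_enum_ord //.
  rewrite -[X in nth _ (enum _) X]/(nat_of_ord (Ordinal ilt)) nth_ord_enum.
  by rewrite /wlab /lab /wdir -surjective_pairing.
rewrite -mulr_suml {1}sE (@walk_count n 'I_r wlab wdir [set: P * P]%SET je j0) //.
  apply: eq_big => [K|K _]; first by rewrite finset.subsetT andbT.
  rewrite /weight /pweight; congr (_ / _%:R)%R.
  apply: eq_bigr => i _; congr (_ - _)%N; apply: eq_card => j.
  by rewrite !inE /edge_of /rel_of inE andbT.
by move=> i j _; rewrite /rel_of !inE.
Qed.

End Quotients.

(** * Expansions in powers of 1/N *)

Section Approximation.
Variable R : realType.
Implicit Types (f g : nat -> R) (p q : {poly R}) (m : nat).

(** This is f(N) = p(1/N) + O(N^-m); only the coefficients of [p] below [m] carry information. *)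
Definition approx m f p := exists C N0, forall N, (N0 <= N)%N ->
  `|f N - p.[N%:R^-1]| <= C * N%:R^-1 ^+ m.

Lemma approx_ge0 m f p : approx m f p -> exists C N0, [/\ 0 <= C, (0 < N0)%N &
  forall N, (N0 <= N)%N -> `|f N - p.[N%:R^-1]| <= C * N%:R^-1 ^+ m].
Proof.
move=> [C [N0 h]]; exists `|C|, N0.+1; split=> // N NN.
apply: le_trans (h N (ltnW NN)) _; rewrite ler_wpM2r ?ler_norm //.
Qed.

Lemma horner_bound p : exists2 B, 0 <= B & forall x, `|x| <= 1 -> `|p.[x]| <= B.
Proof.
exists (\sum_(i < size p) `|p`_i|) => [|x x1]; first by apply: sumr_ge0.
rewrite horner_coef; apply: le_trans (ler_norm_sum _ _ _) _; apply: ler_sum => i _.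
by rewrite normrM ler_piMr // normrX exprn_ile1.
Qed.

Lemma invN_norm N : `|(N%:R^-1 : R)| <= 1.
Proof.
case: N => [|N]; first by rewrite invr0 normr0.
by rewrite ger0_norm ?invr_ge0 // invf_le1 ?ler1n.
Qed.

Lemma approx_refl m p : approx m (fun N => p.[N%:R^-1]) p.
Proof. by exists 0, 0%N => N _; rewrite subrr normr0 mul0r. Qed.

Lemma approx_eq m f g p : (exists N0, forall N, (N0 <= N)%N -> f N = g N) ->
  approx m f p -> approx m g p.
Proof.
move=> [N1 e] [C [N0 h]]; exists C, (maxn N0 N1) => N; rewrite geq_max => /andP[n0 n1].
by rewrite -e // h.
Qed.

Lemma approx_add m f g p q : approx m f p -> approx m g q ->
  approx m (fun N => f N + g N) (p + q).
Proof.
move=> [C [N0 h]] [D [N1 k]]; exists (C + D), (maxn N0 N1) => N.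
rewrite geq_max => /andP[n0 n1]; rewrite hornerD opprD addrACA mulrDl.
by apply: le_trans (ler_normD _ _) _; apply: lerD; [apply: h|apply: k].
Qed.

Lemma approx_mul m f g p q : approx m f p -> approx m g q ->
  approx m (fun N => f N * g N) (p * q).
Proof.
move=> /approx_ge0 [C [N0 [C0 _ h]]] /approx_ge0 [D [N1 [D0 _ k]]].
have [A A0 pA] := horner_bound p; have [B B0 qB] := horner_bound q.
exists (C * (D + B) + A * D), (maxn N0 N1) => N; rewrite geq_max => /andP[n0 n1].
rewrite hornerM; set x := N%:R^-1.
have x1 : `|x| <= 1 by apply: invN_norm.
have x0 : 0 <= x ^+ m by rewrite exprn_ge0 // invr_ge0.
have xm : x ^+ m <= 1.
  by rewrite exprn_ile1 ?invr_ge0 //; move: x1; rewrite ger0_norm ?invr_ge0.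
have gB : `|g N| <= D + B.
  rewrite -(subrK q.[x] (g N)); apply: le_trans (ler_normD _ _) _; apply: lerD.
    by apply: le_trans (k N n1) _; rewrite -/x ler_piMr.
  exact: qB.
have -> : f N * g N - p.[x] * q.[x] = (f N - p.[x]) * g N + p.[x] * (g N - q.[x]).
  ring.
apply: le_trans (ler_normD _ _) _; rewrite [X in _ <= X]mulrDl; apply: lerD; rewrite normrM.
  by rewrite mulrAC; apply: ler_pM => //; apply: h.
by rewrite -mulrA; apply: ler_pM => //; [apply: pA|apply: k].
Qed.

Lemma approx_sum m (I : Type) (r : seq I) (Q : pred I) (f : I -> nat -> R) (p : I -> {poly R}) :
  (forall i, Q i -> approx m (f i) (p i)) ->
  approx m (fun N => \sum_(i <- r | Q i) f i N) (\sum_(i <- r | Q i) p i).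
Proof.
move=> h; elim: r => [|i r IH].
  apply: approx_eq (approx_refl m _); exists 0%N => N _.
  by rewrite !big_nil horner0.
rewrite big_cons; apply: approx_eq (_ : approx m (fun N => (if Q i then f i N else 0) +
   \sum_(i <- r | Q i) f i N) _).
  by exists 0%N => N _; rewrite big_cons; case: ifP => // _; rewrite add0r.
case: ifP => Qi; first by apply: approx_add => //; apply: h.
by rewrite -[X in approx _ _ X]add0r; apply: approx_add => //;
   apply: approx_eq (approx_refl m 0); exists 0%N => N _; rewrite horner0.
Qed.

Lemma approx_prod m (I : Type) (r : seq I) (Q : pred I) (f : I -> nat -> R) (p : I -> {poly R}) :
  (forall i, Q i -> approx m (f i) (p i)) ->
  approx m (fun N => \prod_(i <- r | Q i) f i N) (\prod_(i <- r | Q i) p i).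
Proof.
move=> h; elim: r => [|i r IH].
  apply: approx_eq (approx_refl m _); exists 0%N => N _.
  by rewrite !big_nil hornerC.
rewrite big_cons; apply: approx_eq (_ : approx m (fun N => (if Q i then f i N else 1) *
   \prod_(i <- r | Q i) f i N) _).
  by exists 0%N => N _; rewrite big_cons; case: ifP => // _; rewrite mul1r.
case: ifP => Qi; first by apply: approx_mul => //; apply: h.
by rewrite -[X in approx _ _ X]mul1r; apply: approx_mul => //;
   apply: approx_eq (approx_refl m 1); exists 0%N => N _; rewrite hornerC.
Qed.

Lemma approx_geom m c : approx m (fun N => (1 - c%:R * N%:R^-1)^-1)
  (\sum_(q < m) (c%:R *: 'X) ^+ q).
Proof.
(* Beyond 2c the ratio y = c/N is at most 1/2, and the remainder y^m / (1 - y) is at most 2 y^m. *)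
exists (2 * c%:R ^+ m), (2 * c).+1 => N NN; set x := N%:R^-1.
have N0 : 0 < N%:R :> R by rewrite ltr0n (leq_trans _ NN).
have y2 : c%:R * x <= 2^-1.
  rewrite ler_pdivrMr // ler_pdivlMl ?ltr0n // -natrM ler_nat; exact: ltnW.
set y := c%:R * x in y2 *; have y0 : 0 <= y by rewrite mulr_ge0 // invr_ge0.
have h1 : 0 < 1 - y.
  by rewrite subr_gt0 (le_lt_trans y2) // invf_lt1 ?ltr1n.
have -> : (\sum_(q < m) (c%:R *: 'X) ^+ q).[x] = \sum_(q < m) y ^+ q.
  rewrite horner_sum; apply: eq_bigr => q _; rewrite horner_exp hornerZ hornerX //.
have -> : (1 - y)^-1 - \sum_(q < m) y ^+ q = y ^+ m / (1 - y).
  apply: (@mulIf _ (1 - y)); first by rewrite gt_eqF.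
  have e := subrX1 y m; rewrite mulrBl mulVf ?gt_eqF // divfK ?gt_eqF //.
  have -> : (\sum_(q < m) y ^+ q) * (1 - y) = 1 - y ^+ m.
    by rewrite -[1 - y ^+ m]opprB e; ring.
  by rewrite opprB addrC subrK.
rewrite ger0_norm; last by rewrite divr_ge0 ?exprn_ge0 // ltW.
have -> : 2 * c%:R ^+ m * x ^+ m = 2 * y ^+ m by rewrite /y exprMn mulrA.
rewrite ler_pdivrMr // mulrAC; apply: ler_peMl; first exact: exprn_ge0.
by clearbody y; lra.
Qed.

(** The constant term is the limit, hence 0; dividing by X lowers the order by one. *)
Lemma approx_zero m p : approx m (fun=> 0) p -> forall j, (j < m)%N -> p`_j = 0.
Proof.
elim: m p => // m IH p h.
have [q [c pE]] : exists q c, p = q * 'X + c%:P.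
  by elim/poly_ind: p h => [|q c _] _; [exists 0, 0; rewrite mul0r polyC0 addr0|exists q, c].
have [C [N0 [C0 N0_gt0 hC]]] := approx_ge0 h.
have [B B0 qB] := horner_bound q.
have c0 : c = 0.
  apply/eqP; apply: contraT => nc; have nc0 : 0 < `|c| by rewrite normr_gt0.
  pose N := maxn N0 (Num.truncn ((C + B) / `|c|)).+1.
  have Npos : 0 < N%:R :> R by rewrite ltr0n (leq_trans N0_gt0) // leq_maxl.
  have := hC N (leq_maxl _ _); rewrite pE hornerD hornerMX hornerC sub0r normrN.
  set x := N%:R^-1 => hx; have x1 := invN_norm N; rewrite -/x in x1.
  have x0 : 0 < x by rewrite invr_gt0.
  have : `|c| <= (C + B) * x.
    have -> : c = (q.[x] * x + c) - q.[x] * x by ring.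
    apply: le_trans (ler_normB _ _) _; rewrite mulrDl; apply: lerD.
      apply: le_trans hx _; apply: ler_wpM2l => //.
      rewrite exprS ler_piMr ?(ltW x0) // exprn_ile1 ?(ltW x0) //.
      by move: x1; rewrite ger0_norm ?(ltW x0).
    by rewrite normrM (ger0_norm (ltW x0)); apply: ler_wpM2r; rewrite ?(ltW x0) // qB.
  rewrite ler_pdivlMr // => hN.
  have : (C + B) / `|c| < N%:R.
    have : (C + B) / `|c| < (Num.truncn ((C + B) / `|c|)).+1%:R by apply: truncnS_gt.
    by move=> /lt_le_trans; apply; rewrite ler_nat leq_maxr.
  by rewrite ltr_pdivrMr // mulrC ltNge hN.
have hq : approx m (fun=> 0) q.
  exists C, N0 => N NN; have := hC N NN; rewrite pE c0 addr0 hornerMX !sub0r !normrN.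
  have Npos : 0 < N%:R :> R by rewrite ltr0n (leq_trans N0_gt0).
  have x0 : 0 < N%:R^-1 :> R by rewrite invr_gt0.
  by rewrite normrM (ger0_norm (ltW x0)) exprSr mulrA ler_pM2r.
case=> [|j] jm; rewrite pE c0 addr0 coefMX //=.
exact: IH.
Qed.

Lemma approx_unique m f p q : approx m f p -> approx m f q ->
  forall j, (j < m)%N -> p`_j = q`_j.
Proof.
move=> hp hq j jm; apply/eqP; rewrite -subr_eq0 -coefB; apply/eqP.
apply: (@approx_zero m) => //.
have hn : approx m (fun N => -1 * f N) (-1 * q).
  apply: approx_mul => //; apply: approx_eq (approx_refl m (-1)).
  by exists 0%N => N _; rewrite hornerN hornerC.
apply: approx_eq (_ : approx m (fun N => f N + -1 * f N) _).
  by exists 0%N => N _; rewrite mulN1r subrr.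
by rewrite -[- q]mulN1r; apply: approx_add.
Qed.

Lemma approx_coef m f p q : approx m f p -> (forall j, (j < m)%N -> p`_j = q`_j) ->
  approx m f q.
Proof.
move=> [C [N0 h]] pq; have [B B0 tB] := horner_bound (drop_poly m (p - q)).
exists (C + B), N0 => N NN; set x := N%:R^-1.
have x0 : 0 <= x by rewrite invr_ge0.
have e : p - q = drop_poly m (p - q) * 'X^m.
  rewrite -[LHS](poly_take_drop m) [X in X + _](_ : _ = 0) ?add0r //.
  apply/polyP => j; rewrite coef_take_poly coef0; case: ltnP => // jm.
  by rewrite coefB pq // subrr.
have -> : f N - q.[x] = (f N - p.[x]) + (p - q).[x] by rewrite hornerD hornerN; ring.
rewrite mulrDl; apply: le_trans (ler_normD _ _) _; apply: lerD; first exact: h.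
rewrite e hornerM hornerXn normrM [X in _ * X]ger0_norm ?exprn_ge0 //.
by rewrite ler_wpM2r ?exprn_ge0 // tB // invN_norm.
Qed.

End Approximation.

(** * Moebius inversion over quotients *)

Section Expansion.
Local Open Scope group_scope.
Variables (r : nat) (x0 : 'I_r * bool) (s : seq ('I_r * bool)).
Let F := free_group r.
Let n := size s.
Notation P := 'I_n.+1.
Notation RT := {set P * P}.
Notation quo := (quo x0).
Implicit Types (K J D : RT) (H : set F) (i j : 'I_n) (a b : P).
Let w : F := eval_word (@fg_gen r) s.

(** Generating a subgroup and reading off its coincidences performs transitive closure and folding
    at once. *)
Definition join D1 D2 : RT := relH s (Defs.generated (grp D1 `|` grp D2)).
Definition link K a b : RT :=
  relH s (Defs.generated (grp K `|` [set pfx s a * (pfx s b)^-1])).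
Definition reach K D (j : nat) :=
  exists2 l : seq F, (size l <= j)%N & grp D = Defs.generated (grp K `|` [set` l]).

Lemma relH_mono H H' : is_subgroup H' -> H `<=` H' -> relH s H \subset relH s H'.
Proof.
move=> sH HH; apply/fintype.subsetP => -[a b]; rewrite inE => h; rewrite inE.
by move: h => /asboolP h; apply/asboolP; apply: HH.
Qed.

Lemma grp_hull H : is_subgroup H -> grp (relH s H) `<=` H.
Proof. by move=> sH; rewrite grp_relH; apply: walk_group_sub. Qed.

Section Join.
Variables D1 D2 : RT.
Hypotheses (q1 : quo D1) (q2 : quo D2).
Let G12 := Defs.generated (grp D1 `|` grp D2).

Lemma join_quo : quo (join D1 D2).
Proof.
apply: relH_quo; first exact: gen_subgroup.
by apply: sub_gen; left; apply: grp_closed q1.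
Qed.

Lemma grp_join : grp (join D1 D2) = G12.
Proof.
rewrite eqEsubset; split; first by apply: grp_hull; apply: gen_subgroup.
apply: gen_sub; first exact: grp_subgroup.
move=> g [] gD; move: g gD.
  apply/(grp_sub D1 join_quo); rewrite -{1}(relH_grp q1); apply: relH_mono.
    exact: gen_subgroup.
  by move=> g gD; apply: sub_gen; left.
apply/(grp_sub D2 join_quo); rewrite -{1}(relH_grp q2); apply: relH_mono.
  exact: gen_subgroup.
by move=> g gD; apply: sub_gen; right.
Qed.

Lemma join_sub J : quo J -> (join D1 D2 \subset J) = (D1 \subset J) && (D2 \subset J).
Proof.
move=> qJ; apply/idP/andP => [/(grp_sub _ qJ) + |[/(grp_sub _ qJ) h1 /(grp_sub _ qJ) h2]].
  rewrite grp_join => h; split; apply/(grp_sub _ qJ) => g gD; apply: h; apply: sub_gen.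
    by left.
  by right.
apply/(grp_sub _ qJ); rewrite grp_join; apply: gen_sub; first exact: grp_subgroup.
by move=> g []; [apply: h1|apply: h2].
Qed.

Lemma join_reach K k1 k2 : reach K D1 k1 -> reach K D2 k2 -> reach K (join D1 D2) (k1 + k2).
Proof.
move=> [l1 s1 e1] [l2 s2 e2]; exists (l1 ++ l2); first by rewrite size_cat leq_add.
rewrite grp_join /G12 e1 e2 eqEsubset; split; apply: gen_sub; try exact: gen_subgroup.
  move=> g [] gl; apply: (gen_mono _ gl) => h [hK|hl]; apply: sub_gen; try (by left); right; rewrite /= mem_cat.
    by apply/orP; left.
  by apply/orP; right.
move=> g [gK|]; first by apply: sub_gen; left; apply: sub_gen; left.
rewrite /= mem_cat => /orP[gl|gl]; apply: sub_gen; [left|right]; apply: sub_gen; by right.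
Qed.
End Join.

Section Link.
Variables (K : RT) (a b : P).
Hypothesis qK : quo K.

Lemma link_quo : quo (link K a b).
Proof.
apply: relH_quo; first exact: gen_subgroup.
by apply: sub_gen; left; apply: grp_closed qK.
Qed.

Lemma grp_link : grp (link K a b) = Defs.generated (grp K `|` [set pfx s a * (pfx s b)^-1]).
Proof.
rewrite eqEsubset; split; first by apply: grp_hull; apply: gen_subgroup.
apply: gen_sub; first exact: grp_subgroup.
move=> g [gK|->].
  move: g gK; apply/(grp_sub K link_quo); rewrite -{1}(relH_grp qK); apply: relH_mono.
    exact: gen_subgroup.
  by move=> g gD; apply: sub_gen; left.
by apply: grp_mem; rewrite rel_relH; apply/asboolP; apply: sub_gen; right.
Qed.

Lemma link_sub J : quo J -> K \subset J -> (link K a b \subset J) = rel_of J a b.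
Proof.
move=> qJ KJ; apply/idP/idP => [/(grp_sub _ qJ)|jab].
  rewrite grp_link => h; rewrite -(relH_grp qJ) rel_relH; apply/asboolP; apply: h.
  by apply: sub_gen; right.
apply/(grp_sub _ qJ); rewrite grp_link; apply: gen_sub; first exact: grp_subgroup.
have /(grp_sub _ qJ) KJ' := KJ.
by move=> g [|->]; [apply: KJ'|apply: grp_mem].
Qed.

Lemma link_reach : reach K (link K a b) 1.
Proof.
exists [:: pfx s a * (pfx s b)^-1] => //; rewrite grp_link; congr (Defs.generated (_ `|` _)).
by rewrite eqEsubset; split=> g /=; rewrite inE => /eqP.
Qed.
End Link.

Lemma reach_refl K k : reach K K k.
Proof.
exists [::] => //; rewrite eqEsubset; split; first by move=> g gK; apply: sub_gen; left.
by apply: gen_sub; [apply: grp_subgroup|move=> g []].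
Qed.

Local Open Scope ring_scope.
Variable R : realType.

Section Expands.
Variable K : RT.
Hypothesis qK : quo K.
Implicit Types g : RT -> {poly R}.

(* Moebius inverse coefficients [A D] that vanish to the order prescribed by the
   number of generators to be added to [grp K] to obtain [grp D]. *)
Definition expansion g (A : RT -> {poly R}) :=
  (forall J, quo J -> K \subset J -> g J = \sum_(D : RT | `[< quo D >] && (D \subset J)) A D) /\
  (forall D k, quo D -> (A D)`_k != 0 -> reach K D k).
Definition expands g := exists A, expansion g A.

Lemma expands_eq g g' : (forall J, quo J -> K \subset J -> g J = g' J) ->
  expands g -> expands g'.
Proof. by move=> e [A [h1 h2]]; exists A; split=> // J qJ KJ; rewrite -e // h1. Qed.

Lemma expands_const (p : {poly R}) : expands (fun=> p).
Proof.
exists (fun D => if D == K then p else 0); split=> [J qJ KJ|D k _].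
  rewrite -big_mkcondr /= (big_pred1 K) // => D; apply/andP/eqP => [[_ /eqP] //|->].
  by split=> //; apply/andP; split=> //; apply/asboolP.
by case: (D =P K) => [->|_]; rewrite ?coef0 ?eqxx // => _; apply: reach_refl.
Qed.

(** As a function of [J], the indicator is the sum over quotients below [J] of a point mass at
    [link K a b]; the factor X pays for the generator this adds. *)
Lemma expands_rel a b : expands (fun J => (rel_of J a b)%:R *: 'X).
Proof.
exists (fun D => if D == link K a b then 'X else 0); split=> [J qJ KJ|D k _].
  rewrite -big_mkcondr /=; case jab: (rel_of J a b); rewrite ?scale1r ?scale0r.
    rewrite (big_pred1 (link K a b)) // => D; apply/andP/eqP => [[_ /eqP] //|->].
    split=> //; apply/andP; split; last by rewrite link_sub.
    by apply/asboolP; apply: link_quo.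
  rewrite big_pred0 // => D; apply/negP => /andP[/andP[_ DJ] /eqP e].
  by move: DJ; rewrite e link_sub // jab.
case: (D =P _) => [->|_]; rewrite ?coef0 ?eqxx // coefX.
by case: (k =P 1%N) => [-> _|]; rewrite ?eqxx //; apply: link_reach.
Qed.

Lemma expands_add g1 g2 : expands g1 -> expands g2 -> expands (fun J => g1 J + g2 J).
Proof.
move=> [A1 [h1 r1]] [A2 [h2 r2]]; exists (fun D => A1 D + A2 D); split=> [J qJ KJ|D k qD].
  by rewrite h1 // h2 // big_split.
rewrite coefD => h; case: (eqVneq (A1 D)`_k 0) => [e|]; last exact: r1.
by apply: r2 => //; move: h; rewrite e add0r.
Qed.

(** Two quotients lie below [J] exactly when their join does, so coefficients convolve along [join],
    where degrees and numbers of added generators both add up. *)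
Lemma expands_mul g1 g2 : expands g1 -> expands g2 -> expands (fun J => g1 J * g2 J).
Proof.
move=> [A1 [h1 r1]] [A2 [h2 r2]].
exists (fun D => \sum_(D1 : RT | `[< quo D1 >]) \sum_(D2 : RT | `[< quo D2 >] && (join D1 D2 == D)) A1 D1 * A2 D2).
split=> [J qJ KJ|D k qD].
  rewrite h1 // h2 // big_distrl /= [RHS](exchange_big_dep (fun D1 : RT => `[< quo D1 >])) //=.
  rewrite [LHS]big_mkcondr /=; apply: eq_bigr => D1 /asboolP q1.
  rewrite (exchange_big_dep (fun D2 : RT => `[< quo D2 >])) /=; last by move=> ? ? _ /andP[].
  case: ifP => D1J.
    rewrite big_distrr /= big_mkcondr; apply: eq_bigr => D2 /asboolP q2.
    have q12 := join_quo D2 q1.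
    case: ifP => D2J.
      rewrite (big_pred1 (join D1 D2)) // => D.
      rewrite (asboolT q2) (asboolT q1) andbT andTb eq_sym /=; apply/idP/eqP => [/andP[_ /eqP]|->] //.
      by rewrite eqxx join_sub // D1J D2J !andbT; apply/asboolP.
    rewrite big_pred0 // => D; apply/negP => /andP[/andP[/andP[_ +] _] /andP[_ /eqP e]].
    by rewrite -e join_sub // D2J andbF.
  rewrite big1 // => D2 /asboolP q2; rewrite big_pred0 // => D.
  apply/negP => /andP[/andP[/andP[_ +] _] /andP[_ /eqP e]].
  by rewrite -e join_sub // D1J.
apply: contra_neqP => nr; rewrite coef_sum big1 // => D1 /asboolP q1.
rewrite coef_sum big1 // => D2 /andP[/asboolP q2 /eqP e]; rewrite coefM big1 // => i _.
apply/eqP; apply: contra_notT nr; rewrite mulf_eq0 => /norP[n1 n2].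
rewrite -e -(subnKC (_ : i <= k)%N); last by rewrite -ltnS.
by apply: join_reach => //; [apply: r1|apply: r2].
Qed.

Lemma expands_sum (I : Type) (l : seq I) (Q : pred I) (g : I -> RT -> {poly R}) :
  (forall x, Q x -> expands (g x)) -> expands (fun J => \sum_(x <- l | Q x) g x J).
Proof.
move=> h; elim: l => [|x l IH].
  by apply: expands_eq (expands_const 0) => J _ _; rewrite big_nil.
case Qx: (Q x); last by apply: expands_eq IH => J _ _; rewrite big_cons Qx.
by apply: expands_eq (expands_add (h x Qx) IH) => J _ _; rewrite big_cons Qx.
Qed.

Lemma expands_prod (I : Type) (l : seq I) (Q : pred I) (g : I -> RT -> {poly R}) :
  (forall x, Q x -> expands (g x)) -> expands (fun J => \prod_(x <- l | Q x) g x J).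
Proof.
move=> h; elim: l => [|x l IH].
  by apply: expands_eq (expands_const 1) => J _ _; rewrite big_nil.
case Qx: (Q x); last by apply: expands_eq IH => J _ _; rewrite big_cons Qx.
by apply: expands_eq (expands_mul (h x Qx) IH) => J _ _; rewrite big_cons Qx.
Qed.

Lemma expands_exp g k : expands g -> expands (fun J => g J ^+ k).
Proof.
move=> h; elim: k => [|k IH].
  by apply: expands_eq (expands_const 1) => J _ _; rewrite expr0.
by apply: expands_eq (expands_mul h IH) => J _ _; rewrite exprS.
Qed.

Lemma expands_card (T : finType) (A : {set T}) (e : RT -> pred T) :
  (forall x, expands (fun J => (e J x)%:R *: 'X)) ->
  expands (fun J => #|[set x in A | e J x]%SET|%:R *: 'X).
Proof.
move=> h; have := @expands_sum _ (index_enum T) (mem A) (fun x J => (e J x)%:R *: 'X) (fun x _ => h x).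
apply: expands_eq => J _ _; rewrite -scaler_suml -natr_sum; congr (_%:R *: _).
rewrite -sum1_card [RHS](eq_bigl (fun x => (x \in A) && e J x)); last by move=> x; rewrite inE.
by rewrite big_mkcondr /=; apply: eq_bigr => x _; case: (e J x).
Qed.
End Expands.

Notation erel K := (edge_of (@wlab r x0 s) (@wdir r x0 s) K).

(** Edges minus vertices plus one, which [rkq_basis] identifies with the rank of [grp K]. *)
Definition quo_rank K := ((#|reps (erel K)|).+1 - #|reps (rel_of K)|)%N.

Definition vcount K J a := #|[set b in reps (rel_of K) | (b < a)%N && rel_of J b a]%SET|.
Definition ecount K J i := #|[set j in reps (erel K) | (j < i)%N && erel J j i]%SET|.

(** The weight without its leading power of N, with X for 1/N and each inverse factor replaced by
    its geometric series truncated at [m]. *)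
Definition gpoly m K J : {poly R} :=
  \prod_(a in reps (rel_of K)) (1 - (vcount K J a)%:R *: 'X) *
  \prod_(i in reps (erel K)) \sum_(q < m) ((ecount K J i)%:R *: 'X) ^+ q.

Lemma gpoly_expands m K : quo K -> expands K (gpoly m K).
Proof.
move=> qK; apply: expands_mul => //; apply: expands_prod => // x _.
  apply: expands_eq (_ : expands K (fun J => 1 + (-1)%:P * ((vcount K J x)%:R *: 'X))).
    by move=> J _ _; rewrite polyCN mulN1r.
  apply: expands_add => //; first exact: expands_const.
  apply: expands_mul => //; first exact: expands_const.
  apply: (@expands_card K qK _ _ (fun J b => (b < x)%N && rel_of J b x)) => b; case: (b < x)%N => /=.
    exact: expands_rel.
  by apply: expands_eq (expands_const qK 0) => J _ _; rewrite scale0r.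
apply: expands_sum => // q _; apply: expands_exp => //.
apply: (@expands_card K qK _ _ (fun J j => (j < x)%N && erel J j x)) => j; rewrite /edge_of.
case: (j < x)%N => /=; last by apply: expands_eq (expands_const qK 0) => J _ _; rewrite scale0r.
case: (_ == _) => /=; last by apply: expands_eq (expands_const qK 0) => J _ _; rewrite scale0r.
exact: expands_rel.
Qed.

(** A representative has no earlier element in its class, so for J = K all counts vanish; with
    [m.+1] terms the truncated series keep their constant term 1. *)
Lemma gpoly_diag m K : quo K -> gpoly m.+1 K K = 1.
Proof.
move=> qK; rewrite /gpoly !big1 ?mulr1 // => [i ri|a ra].
  rewrite (_ : ecount K K i = 0%N).
    rewrite big_ord_recl /= expr0 big1 ?addr0 // => q _.
    by rewrite scale0r expr0n.
  apply/eqP; rewrite cards_eq0; apply/eqP/setP => j; rewrite !inE.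
  move: ri; rewrite inE => /forallP /(_ j) /implyP h.
  apply/negP => /andP[_ /andP[ji kji]].
  have [_ es _] := @edge_of_equiv _ _ (@wlab r x0 s) (@wdir r x0 s) _ (let: And3 k _ _ := qK in k).
  by have := h ji; rewrite es kji.
rewrite (_ : vcount K K a = 0%N) ?scale0r ?subr0 //.
apply/eqP; rewrite cards_eq0; apply/eqP/setP => j; rewrite !inE.
move: ra; rewrite inE => /forallP /(_ j) /implyP h.
apply/negP => /andP[_ /andP[ji kji]]; have [[_ ks _] _ _] := qK.
by have := h ji; rewrite ks kji.
Qed.

End Expansion.

Section QuotientExpansion.
Local Open Scope group_scope.
Variables (R : realType) (r : nat) (x0 : 'I_r * bool) (s : seq ('I_r * bool)).
Let F := free_group r.
Let n := size s.
Notation P := 'I_n.+1.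
Notation RT := {set P * P}.
Notation quo := (quo x0).
Notation erel K := (edge_of (@wlab r x0 s) (@wdir r x0 s) K).
Notation rkq := (@quo_rank r x0 s).
Implicit Types (K J D : RT).
Hypothesis ws : eval_word (@fg_gen r) s <> 1 :> F.

Lemma rkq_basis K : quo K -> exists b : seq F,
  [/\ uniq b, is_basis (grp K) [set` b], size b = rkq K & (0 < rkq K)%N].
Proof.
move=> qK; have [b [ub bb e]] := @grp_basis r x0 s K qK; exists b.
have eb : size b = rkq K by rewrite /quo_rank -e addnK.
rewrite -eb; split=> //; case: b bb {ub e eb} => // -[gl _]; case: ws.
have := grp_closed qK; rewrite -gl; apply: (gen_sub (H := [set 1])).
  by split=> [//|x y -> ->|x ->] /=; rewrite ?mulg1 ?invg1.
by move=> g /=; rewrite inE.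
Qed.

Local Open Scope ring_scope.

Lemma approx_natB m c :
  approx m (fun N => (N - c)%:R / N%:R : R) (1 - c%:R *: 'X).
Proof.
apply: approx_eq (approx_refl m _); exists c.+1 => N cN.
rewrite hornerD hornerN hornerC hornerZ hornerX natrB; last exact: ltnW.
rewrite mulrBl divff // pnatr_eq0 -lt0n; exact: leq_trans cN.
Qed.

Lemma approx_invB m c : approx m (fun N => N%:R / (N - c)%:R : R)
  (\sum_(q < m) (c%:R *: 'X) ^+ q).
Proof.
apply: approx_eq (approx_geom R m c); exists c.+1 => N cN.
have N0 : (N%:R : R) != 0 by rewrite pnatr_eq0 -lt0n; exact: leq_trans cN.
rewrite natrB; last exact: ltnW.
by rewrite -[X in X - _](divff N0) -mulrBl invfM invrK mulrC.
Qed.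

(** Pulling one N out of every factor leaves N to the power vertices minus edges, that is 1 minus
    the rank. *)
Lemma pweight_approx m K J : quo K ->
  approx m (fun N => pweight x0 R K J N) ('X^((rkq K).-1) * gpoly x0 R m K J).
Proof.
move=> qK; have [b [_ _ _ r0]] := rkq_basis qK.
pose x (N : nat) : R := N%:R^-1 ^+ (rkq K).-1.
apply: approx_eq (_ : approx m (fun N => x N *
   (\prod_(a in reps (rel_of K)) ((N - vcount K J a)%:R / N%:R) *
    \prod_(i in reps (erel K)) (N%:R / (N - ecount x0 K J i)%:R))) _).
  exists 1%N => N N0; have Nz : (N%:R : R) != 0 by rewrite pnatr_eq0 -lt0n.
  have [v e eve] : exists2 v, #|reps (rel_of K)| = v & #|reps (erel K)| = ((rkq K).-1 + v)%N.
    exists #|reps (rel_of K)| => //; move: r0; rewrite /quo_rank; set v := #|reps (rel_of K)|.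
    by set e := #|reps (erel K)|; clearbody v e => {}r0; lia.
  rewrite /pweight !big_split /= !prodfV !prodr_const e eve /x !natr_prod exprVn exprD.
  rewrite -/(vcount _ _) -/(ecount _ _).
  set a := \prod_(i in reps (rel_of K)) _; set b' := \prod_(i in reps (erel K)) _.
  set y := N%:R ^+ (rkq K).-1; set z := N%:R ^+ v.
  have y0 : y != 0 by rewrite expf_neq0.
  have z0 : z != 0 by rewrite expf_neq0.
  set c := b'^-1; clearbody a c y z; field; exact/andP.
apply: approx_mul.
  apply: approx_eq (approx_refl m _); exists 0%N => N _.
  by rewrite hornerXn.
apply: approx_mul; apply: approx_prod => i _; [exact: approx_natB|exact: approx_invB].
Qed.


(** [Rq D] collects the coefficient at [D] of the expansions of all patterns [K]. Those coefficients
    vanish unless [K] is below [D], so exchanging the sums recovers the total over patterns below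
    [J]. *)
Lemma quotient_expansion m : exists Rq : RT -> {poly R},
  (forall J, quo J ->
     approx m.+1 (fun N => \sum_(K : RT | `[< quo K >] && (K \subset J)) pweight x0 R K J N)
       (\sum_(D : RT | `[< quo D >] && (D \subset J)) Rq D)) /\
  forall D, quo D -> exists A : RT -> {poly R},
    [/\ Rq D = \sum_(K : RT | `[< quo K >]) 'X^((rkq K).-1) * A K, A D = 1 &
        forall K k, quo K -> (A K)`_k != 0 -> reach K D k].
Proof.
have /choice [A AP] : forall K, exists A, quo K -> expansion x0 K (gpoly x0 R m.+1 K) A.
  move=> K; have [qK|nq] := pselect (quo K); last by exists (fun=> 0).
  by have [A AP] := gpoly_expands R m.+1 qK; exists A.
have A0 K D : quo K -> quo D -> ~~ (K \subset D) -> A K D = 0.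
  move=> qK qD KD; apply/polyP => k; rewrite coef0; apply/eqP; apply: contraT => nz.
  have [l _ e] := (AP K qK).2 D k qD nz; case/negP: KD; apply/(grp_sub _ qD).
  by rewrite e => g gK; apply: sub_gen; left.
have AD D : quo D -> A D D = 1.
  move=> qD; rewrite -(gpoly_diag R m qD) ((AP D qD).1 D qD) // (bigD1 D) /=; last first.
    by rewrite fintype.subxx andbT; apply/asboolP.
  rewrite big1 ?addr0 // => K /andP[/andP[/asboolP qK KD] nKD]; apply: A0 => //.
  by apply: contra nKD => DK; rewrite finset.eqEsubset KD DK.
exists (fun D => \sum_(K : RT | `[< quo K >]) 'X^((rkq K).-1) * A K D); split=> [J qJ|D qD].
  have -> : \sum_(D : RT | `[< quo D >] && (D \subset J))
        \sum_(K : RT | `[< quo K >]) 'X^((rkq K).-1) * A K D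
      = \sum_(K : RT | `[< quo K >] && (K \subset J)) 'X^((rkq K).-1) * gpoly x0 R m.+1 K J.
    rewrite exchange_big /= [RHS]big_mkcondr /=; apply: eq_bigr => K /asboolP qK.
    case: ifPn => KJ; first by rewrite ((AP K qK).1 J qJ KJ) big_distrr.
    rewrite big1 // => D /andP[/asboolP qD DJ]; rewrite A0 ?mulr0 //.
    by apply: contra KJ => KD; apply: fintype.subset_trans KD DJ.
  by apply: approx_sum => K /andP[/asboolP qK _]; apply: pweight_approx.
exists (A^~ D); split=> //; first exact: AD.
by move=> K k qK; apply: (AP K qK).2.
Qed.

End QuotientExpansion.

(** * Covers on which a power of u is primitive *)

Section Twist.
Local Open Scope group_scope.
Variables (r : nat) (x0 : 'I_r * bool) (s : seq ('I_r * bool)).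
Let F := free_group r.
Let n := size s.
Notation P := 'I_n.+1.
Notation RT := {set P * P}.
Variable J : RT.
Hypothesis qJ : quo x0 J.
Variable N : nat.
Notation T := {ffun 'I_n -> 'S_N}.
Variables (B : set F) (y : F) (q : nat).
Hypotheses (bB : is_basis (grp J) B) (By : B y).
Hypothesis yq : eval_word (@fg_gen r) s = y ^+ q.
Implicit Types (t : T) (i j : 'I_n) (a b : P).
Notation wsrc := (osrc (@wdir r x0 s)).
Notation wtgt := (otgt (@wdir r x0 s)).
Notation elab := (@elab r x0 s J).
Notation rep := (class_rep (rel_of J)).
Let H := grp J.

Let sH : is_subgroup H. Proof. exact: grp_subgroup. Qed.
Let Jeq : is_equiv (rel_of J). Proof. by case: qJ. Qed.

(** The holonomy of the cover [t] along the first [k] steps. *)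
Let E t (k : nat) : 'S_N := eval_word t (take k (eword x0 J)).

Let size_eword : size (eword x0 J) = n.
Proof. by rewrite size_map size_enum_ord. Qed.

Let nth_eword z i : nth z (eword x0 J) i = (elab i, wdir x0 i).
Proof. by rewrite (nth_map i) ?size_enum_ord // nth_ord_enum. Qed.

Let E0 t : E t 0 = 1. Proof. by rewrite /E take0 eval_nil. Qed.

Let E_step t i : E t i.+1 = E t i * letter_value t (elab i, wdir x0 i).
Proof.
by rewrite /E (take_nth (elab i, wdir x0 i)) ?size_eword // eval_rcons nth_eword.
Qed.

Let E_edge t i : (E t (wsrc i))^-1 * E t (wtgt i) = t (elab i).
Proof.
have := E_step t i; rewrite -[i.+1]/(nat_of_ord (pos_next i)) /osrc /otgt /letter_value /=.
by case: (wdir x0 i) => /= ->; rewrite ?mulKg // invgM invgK mulgVK.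
Qed.

Let pfx_wtgt i : pfx s (wtgt i) = pfx s (wsrc i) * fg_gen (wlab x0 i).
Proof. by rewrite wsrcE wtgtE; apply: pfx_edge. Qed.

Let edge_relE i j : edge_rel x0 H s i j = (elab i == elab j).
Proof. by rewrite elab_eq // -edge_relH (relH_grp qJ). Qed.

Let realizes t (p : F -> 'S_N) := (forall h g, H h -> p (h * g) = p h * p g) /\
  forall a, p (pfx s a) = E t a.

Let realizeP t : exists p : F -> 'S_N, realizes t p.
Proof.
have [|i j ilt jlt eij|p pM pE] := @walk_realize r x0 H sH _ s (E t).
- exact: E0.
- have e k (klt : (k < n)%N) : (E t (src x0 s k))^-1 * E t (tgt x0 s k) = t (elab (Ordinal klt)).
    by rewrite -E_edge wsrcE wtgtE.
  rewrite !(e _ ilt, e _ jlt); congr (t _); apply/eqP.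
  by rewrite -edge_relE.
- by exists p; split=> // a; apply: pE; rewrite -ltnS.
Qed.

Let p t := sval (cid (realizeP t)).
Let pP t : realizes t (p t). Proof. exact: (svalP (cid (realizeP t))). Qed.
Let pH t : morph_on H (p t). Proof. by move=> g h Hg _; apply: (pP t).1. Qed.

Let twistP t tau : exists rho : F -> 'S_N, morph_on H rho /\
  {in B, rho =1 fun x => if x == y then p t x * tau else p t x}.
Proof.
have [rho m e] := @basis_ext _ _ H B (fun x => if x == y then p t x * tau else p t x) bB.
by exists rho.
Qed.

Let rho t tau := sval (cid (twistP t tau)).
Let rhoM t tau : morph_on H (rho t tau).
Proof. exact: (svalP (cid (twistP t tau))).1. Qed.
Let rhoE t tau : {in B, rho t tau =1 fun x => if x == y then p t x * tau else p t x}.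
Proof. exact: (svalP (cid (twistP t tau))).2. Qed.

Let Hpq a b : rel_of J a b -> H (pfx s a * (pfx s b)^-1).
Proof. exact: grp_mem. Qed.

(** The holonomy wanted after twisting: the old one at the representative vertex, corrected by the
    twisted homomorphism on the loop back to it. *)
Let Q t tau a := rho t tau (pfx s a * (pfx s (rep a))^-1) * E t (rep a).

Let Q_rel t tau a b : rel_of J a b ->
  Q t tau a = rho t tau (pfx s a * (pfx s b)^-1) * Q t tau b.
Proof.
move=> ab; have /eqP e : rep a == rep b by rewrite class_rep_eq.
rewrite /Q e mulgA -rhoM; first by rewrite -mulgA mulKg.
  exact: Hpq.
by apply: Hpq; rewrite -e; have [_ js jt] := Jeq; apply: jt (class_repP Jeq a); rewrite js.
Qed.

(* A cover [t] of the graph of [J] induces a homomorphism on [grp J]; [twist]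
   multiplies its value at the basis element [y] by [tau]. *)
Definition twist t tau : T :=
  [ffun i => if elab i == i then (Q t tau (wsrc i))^-1 * Q t tau (wtgt i) else t i].

Let elab_edge i : [/\ wlab x0 i = wlab x0 (elab i), rel_of J (wsrc i) (wsrc (elab i)) &
   elab (elab i) = elab i].
Proof.
have ee : is_equiv (edge_of (@wlab r x0 s) (@wdir r x0 s) J) by apply: edge_of_equiv.
have h := class_repP ee i; have /andP[/eqP l1 j1] := h; split=> //.
by apply/eqP; rewrite eq_sym class_rep_eq.
Qed.

Let Q_edge t tau i : (Q t tau (wsrc i))^-1 * Q t tau (wtgt i) = twist t tau (elab i).
Proof.
have [li si ei] := elab_edge i; rewrite ffunE ei eqxx.
have ti : rel_of J (wtgt i) (wtgt (elab i)) by have [_ _ h] := qJ; rewrite -h.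
rewrite (Q_rel _ _ si) (Q_rel _ _ ti) !pfx_wtgt -li.
have -> : pfx s (wsrc i) * fg_gen (wlab x0 i) * (pfx s (wsrc (elab i)) * fg_gen (wlab x0 i))^-1
    = pfx s (wsrc i) * (pfx s (wsrc (elab i)))^-1 by rewrite invgM mulgA mulgK.
by rewrite invgM -mulgA mulKg.
Qed.

Let Q0 t tau : Q t tau ord0 = 1.
Proof.
rewrite /Q; have -> : rep ord0 = ord0.
  by apply: val_inj; apply/eqP; rewrite -leqn0 (class_rep_le Jeq).
by rewrite mulgV E0 mulg1 (morph_on1 sH (rhoM _ _)).
Qed.

Let E_twist t tau a : E (twist t tau) a = Q t tau a.
Proof.
case: a => a; elim: a => [|a IH] alt.
  by rewrite E0 -(Q0 t tau); congr Q; apply: val_inj.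
have alt' : (a < n)%N by [].
have := IH (ltnW alt); set a' := Ordinal _ => {}IH.
have := E_edge (twist t tau) (Ordinal alt'); rewrite -Q_edge.
have -> : Ordinal alt = pos_next (Ordinal alt') by apply: val_inj.
have e : a' = pos_here (Ordinal alt') by apply: val_inj.
rewrite e in IH; rewrite /osrc /otgt; case: (wdir x0 _); rewrite IH.
  by move/mulIg/invg_inj.
by move/mulgI.
Qed.

Let p_twist t tau h : H h -> p (twist t tau) h = rho t tau h.
Proof.
move=> Hh; apply: morph_on_gen_eq (mem_set Hh); [exact: pH|exact: rhoM|].
move=> _ /set_mem [a [b [jab ->]]]; have [pM pE] := pP (twist t tau).
apply: (@mulIg _ (Q t tau b)); rewrite -Q_rel // -!E_twist -(pE b) -pM.
  by rewrite mulgVK pE.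
exact: Hpq.
Qed.

Let HB x : B x -> H x. Proof. by case: bB => e _ Bx; rewrite /H -e; apply: sub_gen. Qed.

Definition twist_val t := p t y.

Lemma twist_valE t tau : twist_val (twist t tau) = twist_val t * tau.
Proof.
rewrite /twist_val p_twist; last exact: HB.
by rewrite rhoE ?eqxx //; apply/mem_set.
Qed.

Lemma twist_eval t : eval_word t (eword x0 J) = twist_val t ^+ q.
Proof.
rewrite -(morph_onX _ sH (pH t)); last exact: HB.
have [_ pE] := pP t; have := pE ord_max; rewrite /pfx take_size yq => ->.
by rewrite /E take_oversize // size_eword.
Qed.

(** Only the coordinates that name edges of [J] are altered, so twisting back restores the whole
    tuple. *)
Lemma twistK tau : cancel (twist^~ tau) (twist^~ tau^-1).
Proof.
move=> t; have rp h : H h -> rho (twist t tau) tau^-1 h = p t h.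
  case: bB => gB _ Hh; have Gh : Defs.generated B h by rewrite gB.
  apply: morph_on_gen_eq (mem_set Gh); rewrite ?gB; [exact: rhoM|exact: pH|].
  move=> x /set_mem Bx; rewrite rhoE ?p_twist; try exact: HB; last exact/mem_set.
  rewrite rhoE; last exact/mem_set.
  by case: eqP => _; rewrite ?mulgK.
have QE a : Q (twist t tau) tau^-1 a = E t a.
  have rr : rep (rep a) = rep a by apply/eqP; rewrite eq_sym class_rep_eq // class_repP.
  have jar : rel_of J a (rep a) by apply: class_repP.
  rewrite /Q rp; last exact: Hpq.
  have -> : E (twist t tau) (rep a) = E t (rep a).
    by rewrite E_twist /Q rr mulgV (morph_on1 sH (rhoM _ _)) mul1g.
  have [pM pE] := pP t; rewrite -pE -pM; last exact: Hpq.
  by rewrite mulgVK pE.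
apply/ffunP => i; rewrite ffunE; case: eqP => [ei|nei].
  by rewrite !QE E_edge ei.
by rewrite ffunE; case: eqP.
Qed.

(** Since [twist] permutes the covers, an average over [tau] may be inserted; it makes the value at
    [y] uniform, and the word evaluates to the q-th power of that value. *)
Lemma twist_count (R : realType) (f : 'S_N -> nat) :
  (\sum_(t : T) (f (eval_word t (eword x0 J)))%:R / #|T|%:R
    = \sum_(sigma : 'S_N) (f (sigma ^+ q)%g)%:R / #|'S_N|%:R :> R)%R.
Proof.
have cT : ((#|T|%:R : R) != 0)%R.
  by rewrite pnatr_eq0 card_ffun -lt0n expn_gt0 card_Sn fact_gt0.
have cS : ((#|'S_N|%:R : R) != 0)%R by rewrite pnatr_eq0 card_Sn -lt0n fact_gt0.
rewrite -!mulr_suml; apply: (@mulIf _ (#|T|%:R * #|'S_N|%:R)%R); first by rewrite mulf_neq0.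
rewrite mulrA divfK // [(#|T|%:R * _)%R]mulrC mulrA divfK //.
rewrite -!natr_sum -!natrM; congr (_%:R)%R.
transitivity (\sum_(tau : 'S_N) \sum_(t : T) f (twist_val t ^+ q))%N.
  by rewrite sum_nat_const mulnC; congr (_ * _)%N; apply: eq_bigr => t _; rewrite twist_eval.
transitivity (\sum_(tau : 'S_N) \sum_(t : T) f ((twist_val t * tau) ^+ q)%g)%N.
  apply: eq_bigr => tau _.
  rewrite (reindex (twist^~ tau)); first by apply: eq_bigr => t _; rewrite twist_valE.
  exists (twist^~ tau^-1) => t _; first exact: twistK.
  by have := twistK tau^-1 t; rewrite invgK.
rewrite exchange_big /= mulnC -sum_nat_const; apply: eq_bigr => t _.
by rewrite [RHS](reindex_inj (mulgI (twist_val t))).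
Qed.
End Twist.

(** * Fixed points of a power of a uniform permutation *)

Section PowerCount.
Local Open Scope group_scope.
Variable q : nat.
Hypothesis q0 : (0 < q)%N.
Let x0 : 'I_1 * bool := (ord0, false).
Let s := nseq q x0.
Notation n := (size s).
Notation P := 'I_n.+1.
Notation RT := {set P * P}.
Implicit Types K : RT.

Definition mod_rel (e : nat) : RT := [set z : P * P | (z.1 == z.2 %[mod e])%N]%SET.

Lemma rel_mod_rel e a b : rel_of (mod_rel e) a b = (a == b %[mod e])%N.
Proof. by rewrite /rel_of inE. Qed.

Let sz : n = q. Proof. exact: size_nseq. Qed.

Let labE (i j : 'I_n) : wlab x0 i = wlab x0 j.
Proof. by rewrite [LHS]ord1 [RHS]ord1. Qed.

Let dirE (i : 'I_n) : wdir x0 i = false.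
Proof. by rewrite /wdir /s nth_nseq if_same. Qed.

Let srcE (i : 'I_n) : osrc (@wdir 1 x0 s) i = pos_here i.
Proof. by rewrite /osrc dirE. Qed.

Let tgtE (i : 'I_n) : otgt (@wdir 1 x0 s) i = pos_next i.
Proof. by rewrite /otgt dirE. Qed.

Lemma mod_rel_quo e : (e %| q)%N -> quo x0 (mod_rel e).
Proof.
move=> eq; split.
- split=> [a|a b|b a d].
  + by rewrite rel_mod_rel.
  + by rewrite !rel_mod_rel eq_sym.
  + by rewrite !rel_mod_rel => /eqP->.
- by rewrite rel_mod_rel /= sz mod0n eq_sym.
- move=> i j _; rewrite !srcE !tgtE !rel_mod_rel.
  by rewrite -[RHS]/(1 + i == 1 + j %[mod e])%N eqn_modDl.
Qed.

(** With a single label, folding makes the relation invariant under shifts, so it is congruence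
    modulo the least positive position identified with 0. *)
Lemma quo_mod_rel K : quo x0 K -> exists2 e, (e \in divisors q) & K = mod_rel e.
Proof.
move=> [[kr ks kt] k0 kf].
pose k a b := rel_of K (inord a) (inord b).
have kS a b : (a < q)%N -> (b < q)%N -> k a.+1 b.+1 = k a b.
  rewrite -sz => alt blt; have := kf (Ordinal alt) (Ordinal blt) (labE _ _).
  rewrite !srcE !tgtE /k => e.
  have h c (clt : (c < n)%N) : inord c = pos_here (Ordinal clt) :> P.
    by apply: val_inj; rewrite /= inordK // ltnS ltnW.
  have h' c (clt : (c < n)%N) : inord c.+1 = pos_next (Ordinal clt) :> P.
    by apply: val_inj; rewrite /= inordK.
  by rewrite (h _ alt) (h _ blt) (h' _ alt) (h' _ blt) e.
have kD a b c : (a + c <= q)%N -> (b + c <= q)%N -> k (a + c)%N (b + c)%N = k a b.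
  elim: c => [|c IH]; first by rewrite !addn0.
  rewrite !addnS => al bl; rewrite kS // IH //; exact: ltnW.
have exk : exists e, (0 < e)%N && k 0%N e.
  exists q; rewrite q0 /k; have -> : inord 0 = ord0 :> P by apply: val_inj; rewrite /= inordK.
  by have -> : inord q = ord_max :> P by apply: val_inj; rewrite /= inordK ?sz.
have [e /andP[e0 ke] emin] := ex_minnP exk.
have eq : (e <= q)%N.
  apply: emin; rewrite q0 /k; have -> : inord 0 = ord0 :> P by apply: val_inj; rewrite /= inordK.
  by have -> : inord q = ord_max :> P by apply: val_inj; rewrite /= inordK ?sz.
have k0c c : (c <= q)%N -> k 0%N c = (e %| c)%N.
  have [m] := ubnP c; elim: m c => // m IH c; rewrite ltnS => cm cq.
  have [ce|ec] := ltnP c e.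
    case: c ce {cm cq} => [|c] ce; first by rewrite dvdn0 /k kr.
    rewrite gtnNdvd //; apply/negP => kc.
    by have := emin c.+1 kc; rewrite leqNgt ce.
  have -> : k 0%N c = k e c.
    apply/idP/idP => h; last exact: kt ke h.
    by apply: kt h; rewrite ks.
  have cE : c = (c - e + e)%N by rewrite subnK.
  have -> : k e c = k 0%N (c - e)%N.
    by rewrite -[RHS](kD _ _ e) ?add0n // ?subnK.
  rewrite IH; first by rewrite {2}cE dvdn_addl.
    by apply: leq_trans cm; rewrite ltn_subrL e0 (leq_trans e0 ec).
  exact: leq_trans (leq_subr _ _) cq.
have kab a b : (a <= b)%N -> (b <= q)%N -> k a b = (a == b %[mod e])%N.
  move=> ab bq; have bE : b = (b - a + a)%N by rewrite subnK.
  have -> : k a b = k 0%N (b - a)%N by rewrite -[RHS](kD _ _ a) ?add0n ?subnK // (leq_trans ab).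
  by rewrite k0c ?(leq_trans (leq_subr _ _)) // eq_sym eqn_mod_dvd.
exists e; first by rewrite -dvdn_divisors // -k0c // ; have := k0; rewrite /k;
  (have -> : inord 0 = ord0 :> P by apply: val_inj; rewrite /= inordK);
  (have -> : inord q = ord_max :> P by apply: val_inj; rewrite /= inordK ?sz).
apply/setP => -[a b]; rewrite inE /=.
have kE : ((a, b) \in K) = k a b by rewrite /k !inord_val.
have al : (a <= q)%N by rewrite -sz -ltnS.
have bl : (b <= q)%N by rewrite -sz -ltnS.
rewrite kE; have [ab|/ltnW ba] := leqP a b; first exact: kab.
by rewrite eq_sym -kab //; apply: ks.
Qed.

Lemma mod_rel_inj : {in divisors q &, injective mod_rel}.
Proof.
move=> e e'; rewrite -!dvdn_divisors // => eq e'q ee.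
have h f : (f %| q)%N -> ((e %| f) = (e' %| f))%N.
  move=> fq; have fl : (f < n.+1)%N by rewrite ltnS sz dvdn_leq.
  have := congr1 (fun K => rel_of K (Ordinal fl) ord0) ee.
  by rewrite !rel_mod_rel /= !mod0n.
by apply/eqP; rewrite eqn_dvd (h e') // dvdnn -(h e) // dvdnn.
Qed.

Lemma card_ord_lt m e : (e <= m)%N -> #|[set a : 'I_m | (a < e)%N]%SET| = e.
Proof.
move=> em; have wi : injective (widen_ord em) by move=> a b /(congr1 val) /= /val_inj.
rewrite -[RHS]card_ord -(card_imset _ wi).
apply: eq_card => a; rewrite inE; apply/idP/imsetP => [ae|[b _ ->]] //=.
by exists (Ordinal ae) => //; apply: val_inj.
Qed.

(** The quotient is a cycle with as many vertices as edges, and the two falling factorials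
    cancel. *)
Lemma pweight_mod_rel (R : realType) N e : (e \in divisors q) -> (q < N)%N ->
  pweight x0 R (mod_rel e) [set: P * P]%SET N = 1%R.
Proof.
rewrite -dvdn_divisors // => eq qN; have eq' := dvdn_leq q0 eq.
have e0 : (0 < e)%N by apply: dvdn_gt0 eq.
have ne a b : (b < a)%N -> (a < e)%N -> (a == b %[mod e])%N = false.
  by move=> ba ae; rewrite !modn_small ?gtn_eqF //; apply: ltn_trans ae.
have vr : reps (rel_of (mod_rel e)) = [set a : P | (a < e)%N]%SET.
  apply/setP => a; rewrite !inE; apply/forallP/idP => [h|ae b].
    rewrite ltnNge; apply/negP => ea.
    have lt : (a - e < n.+1)%N by apply: leq_ltn_trans (leq_subr _ _) _.
    have := h (Ordinal lt); rewrite /= ltn_subrL e0 (leq_trans e0 ea) /= rel_mod_rel /=.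
    by rewrite -{1}(subnK ea) modnDr eqxx.
  by apply/implyP => ba; rewrite rel_mod_rel ne.
have er : reps (edge_of (@wlab 1 x0 s) (@wdir 1 x0 s) (mod_rel e)) = [set i : 'I_n | (i < e)%N]%SET.
  apply/setP => a; rewrite !inE; apply/forallP/idP => [h|ae b].
    rewrite ltnNge; apply/negP => ea.
    have lt : (a - e < n)%N by apply: leq_ltn_trans (leq_subr _ _) _.
    have := h (Ordinal lt); rewrite /= ltn_subrL e0 (leq_trans e0 ea) /= /edge_of !srcE.
    by rewrite rel_mod_rel /= (labE a (Ordinal lt)) eqxx -{1}(subnK ea) modnDr eqxx.
  by apply/implyP => ba; rewrite /edge_of !srcE rel_mod_rel /= ne ?andbF.
rewrite /pweight vr er.
have -> : (\prod_(a in [set a : P | (a < e)%N]%SET) (N - #|[set b in [set a : P | (a < e)%N] |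
    (b < a)%N && rel_of [set: P * P] b a]%SET|) = N ^_ e)%N.
  rewrite -[in RHS](@card_ord_lt n.+1 e) ?sz 1?ltnW // -ffact_rank.
  apply: eq_bigr => a _; congr (_ - _)%N; apply: eq_card => b.
  by rewrite !inE /rel_of inE andbT.
have -> : (\prod_(i in [set i : 'I_n | (i < e)%N]%SET) (N - #|[set j in [set i : 'I_n | (i < e)%N] |
    (j < i)%N && edge_of (@wlab 1 x0 s) (@wdir 1 x0 s) [set: P * P] j i]%SET|) = N ^_ e)%N.
  rewrite -[in RHS](@card_ord_lt n e) ?sz // -ffact_rank.
  apply: eq_bigr => a _; congr (_ - _)%N; apply: eq_card => b.
  by rewrite !inE /edge_of /rel_of inE andbT (labE b a) eqxx andbT.
rewrite divff // pnatr_eq0 -lt0n ffact_gt0; exact: leq_trans (ltnW qN).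
Qed.

(** This is the count of closed lifts for the q-th power of the generator of a free group of rank 1:
    its quotients are the cycles whose length divides [q], each of weight 1. *)
Lemma perm_power_fixpoints (R : realType) N : (q < N)%N ->
  (\sum_(sigma : 'S_N) (fixpoints 1 (sigma ^+ q)%g)%:R / #|'S_N|%:R = (num_divisors q)%:R :> R)%R.
Proof.
move=> qN; have qT : quo x0 [set: P * P]%SET.
  have -> : [set: P * P]%SET = mod_rel 1 by apply/setP => z; rewrite !inE !modn1.
  by apply: mod_rel_quo; rewrite dvd1n.
have nN : (n < N)%N by rewrite sz.
have h := @base_count 1 x0 s R N nN qT.
transitivity (\sum_(K : RT | `[< quo x0 K >]) 1 : R)%R; last first.
  rewrite sumr_const /num_divisors -(size_map mod_rel); congr (_%:R)%R.
  have /card_uniqP <- : uniq (map mod_rel (divisors q)).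
    by rewrite map_inj_in_uniq ?divisors_uniq //; apply: mod_rel_inj.
  apply: eq_card => K; rewrite unfold_in; apply/asboolP/mapP => [/quo_mod_rel [e]|[e]].
    by exists e.
  by rewrite -dvdn_divisors // => ed ->; apply: mod_rel_quo.
transitivity (\sum_(K : RT | `[< quo x0 K >]) pweight x0 R K [set: P * P]%SET N)%R; last first.
  by apply: eq_bigr => K /asboolP /quo_mod_rel [e eq ->]; apply: pweight_mod_rel.
rewrite -h (reindex (fun t : {ffun 'I_1 -> 'S_N} => t ord0)).
  rewrite card_ffun card_ord expn1; apply: eq_bigr => t _; congr ((fixpoints 1 _)%:R / _)%R.
  by rewrite /s; elim: (q) => [|m IH]; rewrite ?eval_nil ?expg0 // expgS IH eval_cons.
exists (fun sigma => [ffun=> sigma]) => t _; last by rewrite ffunE.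
by apply/ffunP => i; rewrite ffunE (ord1 i).
Qed.
End PowerCount.

(** * Critical quotients *)

Section LeastPower.
Local Open Scope group_scope.
Variables (G : groupType) (u : G).
Implicit Types (H : set G) (j k m : nat).

Definition least_power H k :=
  [/\ (0 < k)%N, H (u ^+ k) & forall j, (0 < j < k)%N -> ~ H (u ^+ j)].

Lemma least_power_exists H m : (0 < m)%N -> H (u ^+ m) -> exists k, least_power H k.
Proof.
move=> m0 Hm; have exk : exists k, `[< (0 < k)%N /\ H (u ^+ k) >].
  by exists m; apply/asboolP.
have [k /asboolP [k0 Hk] kmin] := ex_minnP exk; exists k; split=> // j /andP[j0 jk] Hj.
have := kmin j (asboolT (conj j0 Hj)); by rewrite leqNgt jk.
Qed.

Lemma least_power_dvd H k m : is_subgroup H -> least_power H k ->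
  H (u ^+ m) <-> (k %| m)%N.
Proof.
move=> sH [k0 Hk kmin]; split=> [Hm|/dvdnP [q ->]]; last first.
  by rewrite mulnC expgnA; apply: sgpX.
rewrite /dvdn; apply/eqP; have [//|pos] := posnP (m %% k)%N.
case: (kmin (m %% k)%N); first by rewrite pos ltn_mod.
move: Hm; rewrite {1}(divn_eq m k) expgnDr mulnC expgnA.
have hx : H ((u ^+ k) ^+ (m %/ k)) by apply: sgpX.
by move/(sgpMl sH _ hx).
Qed.

Lemma least_power_unique H k k' : least_power H k -> least_power H k' -> k = k'.
Proof.
move=> [k0 Hk km] [k0' Hk' km']; apply/eqP; rewrite eqn_leq; apply/andP; split.
  by rewrite leqNgt; apply/negP => lt; apply: (km k') => //; rewrite k0'.
by rewrite leqNgt; apply/negP => lt; apply: (km' k) => //; rewrite k0.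
Qed.

(** The homomorphism to Z/k that sends the whole basis to 1 kills every k-th power. *)
Lemma primitive_not_power H v k : H v -> (1 < k)%N -> is_subgroup H -> ~ primitive_in H (v ^+ k).
Proof.
move=> Hv k1 sH [B bB Bv].
have [p pM pE] := @basis_ext _ 'Z_k H B (fun=> Zp1) bB.
have := pE _ (mem_set Bv); rewrite (morph_onX _ sH pM Hv).
by rewrite Zp_expg => /(congr1 val) /=; move: (nat_of_ord _) => a; rewrite Zp_cast // modnMl modn_small.
Qed.

(* The universal property passes from [b ++ l] to [B `|` l]. *)
Lemma basis_replace H K B (b l : seq G) : uniq (b ++ l) -> is_basis H [set` b ++ l] ->
  is_basis K [set` b] -> is_basis K B -> is_basis H (B `|` [set` l]).
Proof.
move=> ubl bH bK bB; have KH : K `<=` H.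
  rewrite -(gen_basis bK) -(gen_basis bH); apply: gen_mono => x /= xb.
  by apply: sub_gen; rewrite /= mem_cat xb.
have sH : is_subgroup H by rewrite -(gen_basis bH); apply: gen_subgroup.
apply: basis_crit => [|n f].
  rewrite eqEsubset; split.
    apply: gen_sub => // x [Bx|xl]; last first.
      by rewrite -(gen_basis bH); apply: sub_gen; rewrite /= mem_cat xl orbT.
    by apply: KH; rewrite -(gen_basis bB); apply: sub_gen.
  rewrite -{1}(gen_basis bH); apply: gen_sub; first exact: gen_subgroup.
  move=> x; rewrite /= mem_cat => /orP[xb|xl]; last by apply: sub_gen; right.
  have : K x by rewrite -(gen_basis bK); apply: sub_gen.
  rewrite -(gen_basis bB) => h; apply: (gen_mono _ h) => y By.
  by apply: sub_gen; left.
have [p pM pE] := basis_ext f bB.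
have [q qM qE] := basis_ext (fun x => if x \in b then p x else f x) bH.
exists q => // x /set_mem [Bx|xl]; last first.
  rewrite qE; last by apply/mem_set; rewrite /= mem_cat xl orbT.
  by case: ifP => // xb; move: ubl; rewrite cat_uniq => /and3P[_ /hasP]; case; exists x.
rewrite -pE; last exact/mem_set.
have gK := gen_basis bK.
have Kx : K x by rewrite -(gen_basis bB); apply: sub_gen.
apply: (@morph_on_gen_eq _ _ [set` b]); rewrite ?gK ?inE //.
  by move=> y z Ky Kz; apply: qM; apply: KH.
move=> y /set_mem /= yb; rewrite qE ?yb //; by apply/mem_set; rewrite /= mem_cat yb.
Qed.

End LeastPower.

Lemma least_le (Q : nat -> Prop) k : Q k -> exists2 m, least Q = Some m & (m <= k)%N.
Proof.
move=> Qk; rewrite /least; case: pselect => [exQ|nex]; last first.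
  by case: nex; exists k; apply/asboolP.
by case: ex_minnP => m _ mmin; exists m => //; apply: mmin; apply/asboolP.
Qed.

Lemma least_some (Q : nat -> Prop) m : least Q = Some m -> Q m.
Proof.
rewrite /least; case: pselect => // exQ [<-].
by case: ex_minnP => k /asboolP.
Qed.

Lemma divisors_multiples d k : (0 < d)%N -> (k %| d)%N ->
  size [seq e <- divisors d | (k %| e)%N] = num_divisors (d %/ k).
Proof.
move=> d0 kd; have k0 : (0 < k)%N by apply: dvdn_gt0 kd.
have dk0 : (0 < d %/ k)%N by rewrite divn_gt0 // dvdn_leq.
rewrite /num_divisors -[RHS](size_map (muln k)); apply: perm_size; apply: uniq_perm.
- by rewrite filter_uniq // divisors_uniq.
- rewrite map_inj_uniq ?divisors_uniq // => a b /eqP.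
  by rewrite eqn_pmul2l // => /eqP.
- move=> e; rewrite mem_filter -dvdn_divisors //; apply/andP/mapP => [[ke ed]|[e']].
    exists (e %/ k)%N; last by rewrite mulnC divnK.
    by rewrite -dvdn_divisors // dvdn_divRL // divnK.
  rewrite -dvdn_divisors // dvdn_divRL // => h ->.
  by rewrite dvdn_mulr //; split=> //; rewrite mulnC.
Qed.

(** * Quotients of the power word: good, cyclic and critical *)

Section PowerWord.
Local Open Scope group_scope.
Variables (R : realType) (r : nat) (x0 : 'I_r * bool) (u : free_group r) (d : nat).
Hypotheses (u1 : u <> 1) (npu : non_power u) (d0 : (0 < d)%N).
Let F := free_group r.
(** The letters of [u] are repeated without cancellation, so that all powers of [u] up to the d-th
    occur among the prefixes. *)
Let s := power_word (val u) d.
Notation n := (size s).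
Notation P := 'I_n.+1.
Notation RT := {set P * P}.
Notation quo := (quo x0).
Notation rkq := (@quo_rank r x0 s).
Implicit Types (K J D : RT) (H : set F).

Let wE : eval_word (@fg_gen r) s = u ^+ d.
Proof. by rewrite eval_power_word eval_val. Qed.

Let ws : eval_word (@fg_gen r) s <> 1.
Proof. by rewrite wE; apply: fg_torsion_free. Qed.

(** These are the quotients for which the expected number of closed lifts is known exactly. *)
Definition good J := exists2 k, least_power u (grp J) k & primitive_in (grp J) (u ^+ k).

Lemma grp_least J : quo J -> exists2 k, least_power u (grp J) k & (k %| d)%N.
Proof.
move=> qJ; have h : grp J (u ^+ d) by rewrite -wE; apply: grp_closed qJ.
have [k lk] := least_power_exists d0 h; exists k => //.
by apply/(least_power_dvd _ (grp_subgroup J) lk).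
Qed.

Lemma grp_rk J : quo J -> rk (grp J) = Some (rkq J).
Proof.
by move=> qJ; have [b [ub bb <- _]] := rkq_basis ws qJ; apply: rk_basis.
Qed.

Lemma good_sub J D : quo J -> quo D -> D \subset J -> good J -> good D.
Proof.
move=> qJ qD DJ [k lk pk]; have [m lm md] := grp_least qD.
have [m0 Dm mmin] := lm; have sJ := grp_subgroup J.
have sub : grp D `<=` grp J by apply/(grp_sub D qJ).
have /dvdnP [c mE] : (k %| m)%N by apply/(least_power_dvd _ sJ lk); apply: sub.
have c0 : (0 < c)%N by move: m0; rewrite mE muln_gt0 => /andP[].
have k0 : (0 < k)%N by case: lk.
have uE j : u ^+ (j * k)%N = (u ^+ k) ^+ j by rewrite mulnC expgnA.
exists m => //; rewrite mE uE.
have [b [_ bb _ _]] := rkq_basis ws qD.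
apply: (primitive_power_sub pk (grp_subgroup D) sub (esym (gen_basis bb)) c0).
  by rewrite -uE -mE.
move=> j /andP[j0 jc]; rewrite -uE; apply: mmin.
by rewrite muln_gt0 j0 k0 mE ltn_pmul2r.
Qed.

Lemma good_count J k N : quo J -> least_power u (grp J) k -> primitive_in (grp J) (u ^+ k) ->
  (maxn n d < N)%N ->
  (\sum_(K : RT | `[< quo K >] && (K \subset J)) pweight x0 R K J N
    = (num_divisors (d %/ k))%:R :> R)%R.
Proof.
move=> qJ lk [B bB Bk]; rewrite gtn_max => /andP[nN dN].
have [k' lk' kd] := grp_least qJ; rewrite -(least_power_unique lk lk') in kd.
have k0 : (0 < k)%N by case: lk.
have wq : eval_word (@fg_gen r) s = (u ^+ k) ^+ (d %/ k)%N.
  by rewrite wE -expgnA mulnC divnK.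
rewrite -(quo_count R qJ nN) (@twist_count _ _ _ _ qJ N B _ _ bB Bk wq R (@fixpoints 1 N)).
apply: perm_power_fixpoints; first by rewrite divn_gt0 // dvdn_leq.
exact: leq_ltn_trans (leq_div _ _) dN.
Qed.

Lemma relH_pow H e : (e %| d)%N -> H (u ^+ e) -> grp (relH s H) (u ^+ e).
Proof.
move=> ed He; have le : (e * size (val u) + 0 <= d * size (val u))%N.
  by rewrite addn0 leq_mul2r dvdn_leq ?orbT.
have pE : pfx s (e * size (val u)) = u ^+ e.
  by have := pfx_power le; rewrite addn0 pfx0 mulg1 eval_val.
have lt : (e * size (val u) < n.+1)%N by rewrite ltnS size_power_word -[X in (X <= _)%N]addn0.
have := @grp_mem r s (relH s H) (Ordinal lt) ord0; rewrite pfx0 invg1 mulg1 pE; apply.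
by rewrite rel_relH; apply/asboolP; rewrite pfx0 invg1 mulg1 pE.
Qed.

Definition cyc e : RT := relH s (Defs.generated [set u ^+ e]).

Section Cyclic.
Variable e : nat.
Hypothesis ed : (e %| d)%N.
Let e0 : (0 < e)%N. Proof. exact: dvdn_gt0 ed. Qed.
Let H := Defs.generated [set u ^+ e].
Let sH : is_subgroup H. Proof. exact: gen_subgroup. Qed.
Let Hu : H (u ^+ e). Proof. exact: sub_gen. Qed.

Lemma cyc_quo : quo (cyc e).
Proof.
apply: relH_quo => //; rewrite wE; have /dvdnP [c ->] := ed.
by rewrite mulnC expgnA; exact: (sgpX sH c Hu).
Qed.

Lemma grp_cyc : grp (cyc e) = H.
Proof.
rewrite eqEsubset; split; first exact: grp_hull.
apply: gen_sub => [|_ ->]; first exact: grp_subgroup.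
exact: relH_pow.
Qed.

Lemma cyc_sub J : quo J -> (cyc e \subset J) <-> grp J (u ^+ e).
Proof.
move=> qJ; split=> [/(grp_sub _ qJ)|h].
  by rewrite grp_cyc; apply.
apply/(grp_sub _ qJ); rewrite grp_cyc; apply: gen_sub => [|_ -> //].
exact: grp_subgroup.
Qed.

(** A single generator of a group of positive rank is a basis, by the Hopf property. *)
Lemma cyc_primitive : primitive_in H (u ^+ e).
Proof.
have [b [ub bb sb b0]] := rkq_basis ws cyc_quo; rewrite grp_cyc in bb.
exists [set` [:: u ^+ e]]; last by rewrite /= mem_head.
apply: (gens_basis 1 ub bb); last by rewrite /= sb.
by congr Defs.generated; rewrite eqEsubset; split=> g /=; rewrite inE => /eqP.
Qed.

(** A smaller power of [u] in [H] would make the generator a proper power inside [H], contrary to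
    its primitivity. *)
Lemma cyc_least : least_power u H e.
Proof.
have [k lk] := least_power_exists e0 Hu.
have /dvdnP [c eE] : (k %| e)%N by apply/(least_power_dvd _ sH lk).
have [c1|c1] := leqP c 1.
  suff -> : e = k by [].
  by move: e0; rewrite eE; case: (c) c1 => [|[|]] //; rewrite mul1n.
have [_ Hk _] := lk; have := primitive_not_power Hk c1 sH; case.
by rewrite -expgnA mulnC -eE; apply: cyc_primitive.
Qed.

Lemma cyc_good : good (cyc e).
Proof. by exists e; rewrite grp_cyc; [apply: cyc_least|apply: cyc_primitive]. Qed.
End Cyclic.

Lemma cyc_below J k : quo J -> least_power u (grp J) k ->
  size [seq e <- divisors d | cyc e \subset J] = num_divisors (d %/ k).
Proof.
move=> qJ lk; have [k' lk' kd] := grp_least qJ; rewrite -(least_power_unique lk lk') in kd.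
rewrite -divisors_multiples //; congr size; apply: eq_in_filter => e.
rewrite -dvdn_divisors // => ed; apply/idP/idP.
  by move=> /(cyc_sub ed qJ) /(least_power_dvd _ (grp_subgroup J) lk).
by move=> h; apply/(cyc_sub ed qJ)/(least_power_dvd _ (grp_subgroup J) lk).
Qed.

Definition rank_witness m := exists H,
  [/\ is_subgroup H, rk H = Some m, H u & ~ primitive_in H u].

(** If [u] itself lies in the group, that group is a candidate for the primitivity rank; otherwise
    [root_drop] supplies a candidate of strictly smaller rank. *)
Lemma bad_rank J : quo J -> ~ good J ->
  exists2 m, primitivity_rank u = Some m & (m <= rkq J)%N /\ (m = rkq J -> grp J u).
Proof.
move=> qJ bad; have [k lk _] := grp_least qJ; have [k0 Hk kmin] := lk.
have np : ~ primitive_in (grp J) (u ^+ k) by move=> p; apply: bad; exists k.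
have [k1|k2] := leqP k 1.
  have k1' : k = 1%N by apply/eqP; rewrite eqn_leq k1 k0.
  rewrite k1' expg1 in Hk np.
  have [|m mE mle] := @least_le rank_witness (rkq J); last by exists m.
  by exists (grp J); split=> //; [apply: grp_subgroup|apply: grp_rk].
have [H [m [sH Hu npH rkH mlt]]] :=
  root_drop u1 npu k2 (grp_subgroup J) (grp_rk qJ) Hk kmin np.
have [|m' m'E m'le] := @least_le rank_witness m; first by exists H.
exists m' => //; split; first by apply: leq_trans m'le (ltnW mlt).
by move=> e; move: (leq_ltn_trans m'le mlt); rewrite e ltnn.
Qed.


Lemma reach_gens K D k (b : seq F) : is_basis (grp K) [set` b] -> reach K D k ->
  exists2 l : seq F, (size l <= k)%N & Defs.generated [set` b ++ l] = grp D.
Proof.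
move=> bb [l sl ->]; exists l => //; rewrite -(gen_basis bb) eqEsubset; split; apply: gen_sub;
  try exact: gen_subgroup.
  move=> x; rewrite /= mem_cat => /orP[xb|xl]; apply: sub_gen; [left|right] => //.
  exact: sub_gen.
move=> x [|xl]; first by apply: gen_mono => y yb; apply: sub_gen; rewrite /= mem_cat [_ \in b]yb.
by apply: sub_gen; rewrite /= mem_cat [_ \in l]xl orbT.
Qed.

Lemma reach_rank K D k : quo K -> quo D -> reach K D k -> (rkq D <= rkq K + k)%N.
Proof.
move=> qK qD rD; have [b [ub bb <- _]] := rkq_basis ws qK.
have [bD [ubD bbD <- _]] := rkq_basis ws qD.
have [l sl gl] := reach_gens bb rD; apply: leq_trans (basis_size_le 1 ubD bbD gl) _.
by rewrite size_cat leq_add2l.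
Qed.

(** By the Hopf property a basis of [grp K] and the added generators form a basis of [grp D], so the
    primitive power survives; as [u] is in [grp D], its exponent must be 1. *)
Lemma reach_good K D k : quo K -> quo D -> reach K D k -> (rkq D = rkq K + k)%N ->
  good K -> grp D u -> good D.
Proof.
move=> qK qD rD rkE [k' lk' [B bB Bk']] Du; have [b [ub bb sb _]] := rkq_basis ws qK.
have [bD [ubD bbD sbD _]] := rkq_basis ws qD.
have [l sl gl] := reach_gens bb rD.
have sz : (size (b ++ l) <= size bD)%N by rewrite size_cat sb sbD rkE leq_add2l.
have bl := gens_basis 1 ubD bbD gl sz; have ul := gens_uniq 1 ubD bbD gl sz.
have bD' := basis_replace ul bl bb bB.
have pD : primitive_in (grp D) (u ^+ k') by exists (B `|` [set` l]) => //; left.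
have sD := grp_subgroup D.
have [k1|k1] := leqP k' 1; last by case: (primitive_not_power Du k1 sD).
have k'1 : k' = 1%N by case: lk'; case: (k') k1 => [|[|]].
exists 1%N; last by rewrite -k'1.
by split=> [//||j /andP[j0]]; rewrite ?expg1 // ltnNge j0.
Qed.

Lemma reach0 K D : quo K -> quo D -> reach K D 0 -> K = D.
Proof.
move=> qK qD [[|//] _ e]; apply: (grp_inj qK qD); rewrite e eqEsubset; split.
  by move=> g gK; apply: sub_gen; left.
by apply: gen_sub; [apply: grp_subgroup|move=> g []].
Qed.

Local Open Scope ring_scope.

(** In degree below [m] only the term K = D, whose coefficient is 1, survives. *)
Lemma bad_coef (p : {poly R}) D (A : RT -> {poly R}) m j :
  p = \sum_(K : RT | `[< quo K >]) 'X^((rkq K).-1) * A K -> A D = 1 ->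
  (forall K k, quo K -> (A K)`_k != 0 -> reach K D k) ->
  quo D -> ~ good D -> primitivity_rank u = Some m -> (j < m)%N ->
  p`_j = ((rkq D == m) && (j == m.-1))%:R.
Proof.
move=> -> AD Ar qD bD um jm.
have [m' + [mle mD]] := bad_rank qD bD; rewrite um => -[mm]; subst m'.
have [_ [_ _ _ rD0]] := rkq_basis ws qD.
rewrite coef_sum (bigD1 D) /=; last exact/asboolP.
rewrite big1 ?addr0 => [|K /andP[/asboolP qK KD]]; rewrite coefXnM; last first.
  case: ltnP => // jK; apply/eqP; apply: contraT => nz.
  have rK := Ar K _ qK nz; have le := reach_rank qK qD rK.
  have [_ [_ _ _ rK0]] := rkq_basis ws qK.
  (* A term of degree j from [K] gives rk D at most j + 1, hence at most [m]; with m at most rk D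
     all are equal. *)
  have kE : (rkq K + (j - (rkq K).-1) = j.+1)%N.
    by move: jK rK0; case: (rkq K) => //= c; rewrite addSn => cj _; rewrite subnKC.
  rewrite kE in le; have e1 : m = rkq D.
    by apply/eqP; rewrite eqn_leq mle (leq_trans le jm).
  (* A good [K] would make [D] good; a bad one has rank at least [m], leaving no generator to
     add. *)
  have [gK|bK] := pselect (good K).
    case: bD; apply: reach_good rK _ gK (mD e1) => //.
    by apply/eqP; rewrite kE eqn_leq le -e1.
  have [m' + [mle' _]] := bad_rank qK bK; rewrite um => -[mm]; subst m'.
  have k0 : (j - (rkq K).-1 = 0)%N.
    by move: mle' jm jK; case: (rkq K) rK0 => //= c _; lia.
  by case/eqP: KD; apply: reach0 => //; rewrite -k0.
rewrite AD coef1; case: ltnP => h.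
  by case: eqP => //= e; rewrite -e; case: eqP => // e'; move: h; rewrite e' e ltnn.
have e : rkq D = m by apply/eqP; rewrite eqn_leq mle andbT; move: h rD0 jm; lia.
rewrite e eqxx /=; congr (nat_of_bool _)%:R.
by apply/eqP/eqP; move: h jm rD0; rewrite e; lia.
Qed.

Lemma cyc_count (Q : pred RT) :
  (\sum_(D : RT | Q D) count (fun e => cyc e == D) (divisors d)
    = count (fun e => Q (cyc e)) (divisors d))%N.
Proof.
transitivity (\sum_(D : RT | Q D) \sum_(e <- divisors d) (cyc e == D))%N.
  by apply: eq_bigr => D _; rewrite -sum1_count big_mkcond.
rewrite exchange_big /= -sum1_count [RHS]big_mkcond; apply: eq_bigr => e _.
case: ifP => Qe; last first.
  by rewrite big1 // => D QD; case: eqP => // e'; move: QD; rewrite -e' Qe.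
by rewrite (bigD1 (cyc e)) //= eqxx big1 // => D /andP[_ /negbTE]; rewrite eq_sym => ->.
Qed.

(** Induction on the size of [D]: everything below [D] is good, the total is the constant tau(d/k),
    and by [cyc_below] exactly that many cyclic quotients lie below [D]. *)
Lemma good_coef m (Rq : RT -> {poly R}) :
  (forall J, quo J ->
     approx m (fun N => \sum_(K : RT | `[< quo K >] && (K \subset J)) pweight x0 R K J N)
       (\sum_(D : RT | `[< quo D >] && (D \subset J)) Rq D)) ->
  forall D j, quo D -> good D -> (j < m)%N ->
  (Rq D)`_j = (count (fun e => cyc e == D) (divisors d) * (j == 0%N))%:R.
Proof.
move=> RqP D j + + jm; have [c] := ubnP #|D|; elim: c D => // c IH D; rewrite ltnS => Dc qD gD.
have [k lk pk] := gD.
have ap : approx m (fun N => \sum_(K : RT | `[< quo K >] && (K \subset D)) pweight x0 R K D N)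
    ((num_divisors (d %/ k))%:R%:P : {poly R}).
  apply: approx_eq (approx_refl m _); exists (maxn n d).+1 => N nN.
  by rewrite hornerC (good_count qD lk pk nN).
have := approx_unique (RqP D qD) ap jm; rewrite coef_sum coefC.
rewrite (bigD1 D) /=; last by rewrite fintype.subxx andbT; apply/asboolP.
rewrite (eq_bigr (fun D' => (count (fun e => cyc e == D') (divisors d) * (j == 0%N))%:R)); last first.
  move=> D' /andP[/andP[/asboolP qD' DD'] nD]; apply: IH => //; last exact: good_sub DD' gD.
  apply: leq_trans Dc; apply: proper_card; by rewrite finset.properEneq nD.
rewrite -natr_sum -big_distrl /= cyc_count => h.
have cE : (count (fun e => cyc e == D) (divisors d) +
    count (fun e => `[< quo (cyc e) >] && (cyc e \subset D) && (cyc e != D)) (divisors d)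
    = num_divisors (d %/ k))%N.
  rewrite -(cyc_below qD lk) size_filter.
  have -> : count (fun e => `[< quo (cyc e) >] && (cyc e \subset D) && (cyc e != D)) (divisors d)
    = count (fun e => (cyc e \subset D) && (cyc e != D)) (divisors d).
    apply: eq_in_count => e; rewrite -dvdn_divisors // => ed.
    by rewrite (asboolT (cyc_quo ed)).
  rewrite -count_predUI.
  rewrite [X in (_ + X)%N](eq_count (a2 := pred0)) => [|e]; last first.
    by rewrite /=; case: eqP; rewrite ?andbF.
  rewrite count_pred0 addn0; apply: eq_count => e /=.
  by case: eqP => [->|] /=; rewrite ?fintype.subxx ?andbT.
case: (j =P 0%N) h => [_|_]; rewrite ?muln0 ?muln1 ?addr0 // => h.
by apply: (addIr (count (fun e => `[< quo (cyc e) >] && (cyc e \subset D) && (cyc e != D)) (divisors d))%:R);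
  rewrite h -natrD cE.
Qed.

Let T : RT := [set: P * P]%SET.

Let topE : T = relH s setT.
Proof. by apply/setP => z; rewrite !inE; apply/esym/asboolP. Qed.

Lemma top_quo : quo T.
Proof. by rewrite topE; apply: relH_quo. Qed.

Lemma top_mem : grp T u.
Proof. by rewrite topE -(expg1 u); apply: relH_pow; rewrite ?dvd1n. Qed.

Lemma top_count N : (n < N)%N -> expected_fixpoints R (u ^+ d)%g 1 N
  = \sum_(K : RT | `[< quo K >] && (K \subset T)) pweight x0 R K T N.
Proof.
move=> nN; rewrite (eq_bigl (fun K => `[< quo K >])) => [|K]; last first.
  by rewrite finset.subsetT andbT.
rewrite -(base_count R nN top_quo) /expected_fixpoints mulr_suml; apply: eq_bigr => t _.
by rewrite -wE eval_hom_word.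
Qed.

(** The top quotient is good and contains [u], so the first power is [u] itself and the count is
    exact. *)
Lemma all_good_count : primitivity_rank u = None ->
  exists N0, forall N, (N0 <= N)%N -> expected_fixpoints R (u ^+ d)%g 1 N = (num_divisors d)%:R.
Proof.
move=> uN; have gT : good T.
  by apply: contrapT => /(bad_rank top_quo) [m]; rewrite uN.
have [k lk pk] := gT; have k1 : (k %| 1)%N.
  by apply/(least_power_dvd _ (grp_subgroup T) lk); rewrite expg1; apply: top_mem.
exists (maxn n d).+1 => N NN; rewrite top_count; last first.
  by apply: leq_ltn_trans NN; apply: leq_maxl.
rewrite (good_count top_quo lk pk NN); move: k1; rewrite dvdn1 => /eqP ->.
by rewrite divn1.
Qed.

Definition crit_quotients m := [set D : RT | `[< [/\ quo D, ~ good D & rkq D = m] >]]%SET.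

Lemma expansion_coef m : primitivity_rank u = Some m.+1 -> exists2 p : {poly R},
  approx m.+1 (expected_fixpoints R (u ^+ d)%g 1) p &
  forall j, (j < m.+1)%N ->
    p`_j = (num_divisors d * (j == 0%N) + #|crit_quotients m.+1| * (j == m))%:R.
Proof.
move=> um; have [Rq [RqP RqA]] := quotient_expansion R x0 ws m.
exists (\sum_(D : RT | `[< quo D >] && (D \subset T)) Rq D).
  apply: approx_eq (RqP T top_quo); exists n.+1 => N NN.
  by rewrite top_count.
move=> j jm; rewrite coef_sum (bigID (fun D => `[< good D >])) /=.
rewrite (eq_bigr (fun D => (count (fun e => cyc e == D) (divisors d) * (j == 0%N))%:R)); last first.
  by move=> D /andP[/andP[/asboolP qD _] /asboolP gD]; apply: (good_coef RqP qD gD jm).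
rewrite -natr_sum -big_distrl /= cyc_count natrD; congr (_ + _).
  congr (_ * _)%:R; rewrite /num_divisors -[size (divisors d)]count_predT; apply: eq_in_count => e.
  rewrite -dvdn_divisors // => ed; rewrite (asboolT (cyc_quo ed)) (asboolT (cyc_good ed)).
  by rewrite finset.subsetT.
rewrite (eq_bigr (fun D => ((rkq D == m.+1) && (j == m) : nat)%:R)); last first.
  move=> D /andP[/andP[/asboolP qD _] /asboolP bD].
  by have [A [RA AD Ar]] := RqA D qD; apply: bad_coef RA AD Ar qD bD um jm.
rewrite -natr_sum; congr (_%:R); rewrite -sum1_card big_distrl /=.
rewrite [RHS]big_mkcond [LHS]big_mkcond; apply: eq_bigr => D _.
rewrite finset.subsetT andbT inE mul1n.
have -> : `[< [/\ quo D, ~ good D & rkq D = m.+1] >]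
    = [&& `[< quo D >], ~~ `[< good D >] & rkq D == m.+1].
  apply/asboolP/and3P => [[qD bD /eqP e]|[/asboolP qD /asboolP bD /eqP e]] //.
  by split=> //; apply/asboolP.
by case: `[< quo D >] => //; case: `[< good D >] => //=; case: eqP.
Qed.


Lemma primitivity_rank_gt0 m : primitivity_rank u = Some m -> (0 < m)%N.
Proof.
move=> /least_some [H [sH rH Hu _]]; case: m rH => // /rk_some [b [_ b0 bb]].
case: b b0 bb => // _ bb; case: u1; move: Hu; rewrite -(gen_basis bb).
apply: (@gen_sub _ _ [set 1%g]) => //.
by split=> [//|x y -> ->|x ->] /=; rewrite ?mulg1 ?invg1.
Qed.

Lemma crit_grp m D : primitivity_rank u = Some m -> D \in crit_quotients m -> Crit u (grp D).
Proof.
move=> um; rewrite inE => /asboolP [qD bD rD].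
have [m' + [_ /(_ _) mD]] := bad_rank qD bD; rewrite um => -[mm]; subst m'.
have Du := mD (esym rD); split=> //.
- exact: grp_subgroup.
- by rewrite grp_rk // um rD.
- move=> pD; apply: bD; exists 1%N; rewrite ?expg1 //.
  by split=> [//||j /andP[j0]]; rewrite ?expg1 // ltnNge j0.
Qed.

(** Otherwise the traced group is a free factor of smaller rank containing [u]. Either [u] is
    primitive there, hence in [H], or the primitivity rank would be smaller. *)
Lemma crit_walk m H : primitivity_rank u = Some m -> Crit u H -> walk_group H s = H.
Proof.
move=> um [sH rH Hu npH]; have [b [ub sb bb]] := rk_some (etrans rH um).
have Hw : H (eval_word (@fg_gen r) s) by rewrite wE; apply: sgpX.
have [s' s'E] := walk_of_fg sH Hw (esym (gen_basis bb)).
have qD := relH_quo x0 sH Hw; set D := relH s H in qD.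
have gD : grp D = walk_group H s by apply: grp_relH.
have [bD [ubD bbD sbD _]] := rkq_basis ws qD; rewrite gD in bbD.
have [l [ul lW bl _]] := walk_basis_cat x0 sH s' bbD; rewrite s'E in bl.
case: l ul lW bl => [|g l] ul lW bl.
  rewrite -(gen_basis bbD) -[RHS](gen_basis bl); congr Defs.generated.
  by rewrite eqEsubset; split=> x; [left|case].
have Du : grp D u by rewrite -(expg1 u); apply: relH_pow; rewrite ?dvd1n ?expg1.
have rD : (rkq D < m)%N.
  have e : [set` bD] `|` [set` g :: l] = [set` bD ++ g :: l].
    rewrite eqEsubset; split=> x /=; rewrite mem_cat; first by case=> ->; rewrite ?orbT.
    by move=> /orP; case; [left|right].
  rewrite e in bl.
  have ubl : uniq (bD ++ g :: l).
    rewrite cat_uniq ubD ul andbT; apply/hasPn => x /lW nx; apply/negP => xb; apply: nx.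
    by rewrite -(gen_basis bbD); apply: sub_gen.
  by rewrite -sb (basis_size_eq ub bb ubl bl) size_cat /= sbD -addSnnS leq_addr.
have [pD|npD] := pselect (primitive_in (walk_group H s) u).
  by case: npH; rewrite -s'E; apply: (primitive_walk_cat x0 sH).
have [|m' m'E m'le] := @least_le rank_witness (rkq D).
  by exists (grp D); split; [apply: grp_subgroup|apply: grp_rk| |rewrite gD].
by move: m'E; rewrite [least _]um => -[mm]; move: rD; rewrite mm ltnNge m'le.
Qed.

Lemma crit_card m : primitivity_rank u = Some m ->
  #|` fset_set (Crit u)| = #|crit_quotients m|.
Proof.
move=> um; pose b := [seq grp D | D <- enum (crit_quotients m)].
have bE : Crit u = [set` b].
  rewrite eqEsubset; split=> [H cH|_ /mapP [D + ->]]; last first.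
    by rewrite mem_enum; apply: crit_grp.
  have [sH rH Hu npH] := cH; have Hw : H (eval_word (@fg_gen r) s) by rewrite wE; apply: sgpX.
  have qD := relH_quo x0 sH Hw; have HE := crit_walk um cH.
  apply/mapP; exists (relH s H); last by rewrite grp_relH.
  rewrite mem_enum inE; apply/asboolP; split=> //.
    move=> [k [k0 Hk kmin]]; rewrite grp_relH HE => pk; apply: npH.
    suff k1 : k = 1%N by rewrite k1 expg1 in pk.
    apply/eqP; rewrite eqn_leq k0 andbT leqNgt; apply/negP => k1.
    by apply: (kmin 1%N k1); rewrite expg1 grp_relH HE.
  have := grp_rk qD; rewrite grp_relH HE rH um => -[] //.
have ub : uniq b.
  rewrite map_inj_in_uniq ?enum_uniq // => D D'; rewrite !mem_enum inE => /asboolP [qD _ _].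
  by rewrite inE => /asboolP [qD' _ _]; apply: (grp_inj qD qD').
have -> : #|crit_quotients m| = size b by rewrite size_map cardE.
have -> : Crit u = [set` [fset x in b]%fset].
  by rewrite bE eqEsubset; split=> x /=; rewrite !inE.
by rewrite set_fsetK card_fseq undup_id.
Qed.

End PowerWord.

Theorem corollary1p6 (R : realType) (r : nat) (hr : (1 <= r)%N)
    (u : free_group r) (hu1 : u <> 1%g) (hu : non_power u)
    (d : nat) (hd : (1 <= d)%N) :
  expected_fixpoints R (u ^+ d)%g 1 = expected_fixpoints R u d /\
  expected_fixpoints R u d =
    (fun N : nat => (num_divisors d)%:R
       + (#|` fset_set (Crit u)|)%:R
         * inv_pow R N (omap predn (primitivity_rank u)))
    +O_\oo (fun N : nat => inv_pow R N (primitivity_rank u)).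
Proof.
have e : expected_fixpoints R (u ^+ d)%g 1 = expected_fixpoints R u d.
  apply/funext => N; rewrite /expected_fixpoints; congr (_ / _); apply: eq_bigr => t _.
  by rewrite /fixpoints eval_homX expg1.
split=> //; rewrite -e; pose x0 : 'I_r * bool := (Ordinal hr, false).
apply/eqaddOP.
case um : (primitivity_rank u) => [m|]; last first.
  (* Both powers of N are 0 here, so the error bound asks for equality for all large N. *)
  have [N0 h] := all_good_count R x0 hu1 hu hd um.
  exists 1; split=> [|k k1]; first by rewrite num_real.
  exists N0 => // N /= NN; rewrite !fctE /= h // mulr0 addr0 subrr normr0.
  by rewrite ?mulr0.
(* The rank is positive, so the predecessor in the exponent is exact. *)
case: m um (primitivity_rank_gt0 hu1 um) => // m um _.
have [p ap pE] := expansion_coef R x0 hu1 hu hd um.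
pose q : {poly R} := (num_divisors d)%:R%:P + (#|` fset_set (Crit u)|)%:R *: 'X^m.
have [C [N0 [C0 N1 h]]] : exists C N0, [/\ 0 <= C, (0 < N0)%N &
    forall N, (N0 <= N)%N ->
      `|expected_fixpoints R (u ^+ d)%g 1 N - q.[N%:R^-1]| <= C * N%:R^-1 ^+ m.+1].
  apply: approx_ge0; apply: approx_coef ap _ => j jm; rewrite pE // /q coefD coefC coefZ coefXn.
  rewrite (crit_card x0 hu1 hu hd um) natrD !natrM; congr (_ + _).
  by case: (j == 0%N); rewrite ?mulr1 ?mulr0.
exists C; split=> [|k kC]; first by rewrite num_real.
exists N0 => // N /= NN; rewrite !fctE /=; apply: le_trans (_ : C * N%:R^-1 ^+ m.+1 <= _).
  by have := h N NN; rewrite /q hornerD hornerC hornerZ hornerXn [in X in `|X|]exprVn.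
rewrite ger0_norm ?invr_ge0 ?exprn_ge0 // exprVn.
by apply: ler_wpM2r; rewrite ?invr_ge0 ?exprn_ge0 // ltW.
Qed.
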